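(* Let $\mathbb F$ be an algebraically closed field of characteristic zero. For all integers $d>k\ge2$ there is a constant $B_{d,k}$ depending only on $d,k$ such that for all $n,m\ge1$ and every linear map $\phi:P(n,d)\to\mathrm{Ten}(m,k)$ with $a:=\max\{\mathrm{brk}(\phi(\ell^d)):\ell\in P(n,1)\}\ge1$, the border potency satisfies $$\mathrm{Bpot}(\phi)\le B_{d,k}\cdot n^{\lfloor (k-1)d/k\rfloor}.$$
   Context: $P(n,d)$: homogeneous degree-$d$ polynomials in $n$ variables. The border rank $\mathrm{brk}(T)$ of $T\in\mathrm{Ten}(m,k)=(\mathbb F^m)^{\otimes k}$ is the least $r$ such that $T$ lies in the Zariski closure of the set of tensors of tensor rank $\le r$. The border potency is $\mathrm{Bpot}(\phi)=\max\{\mathrm{brk}(\phi(f)):f\in P(n,d)\}/a$. *)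

(* Defs.v *)
From HB Require Import structures.
From mathcomp Require Import all_boot all_order all_algebra.
From Stdlib Require Import ClassicalEpsilon.
Set Implicit Arguments. Unset Strict Implicit. Unset Printing Implicit Defensive.
Import Order.TTheory GRing.Theory Num.Theory.
Local Open Scope ring_scope.

Notation mon n d :=
  {e : {ffun 'I_n -> 'I_d.+1} | (\sum_(i < n) (e i : nat) == d)%N}.

(* P(n,d): homogeneous degree-d polynomials in n variables, represented by
   their coefficient vectors in the monomial basis. *)
Notation Pol F n d := {ffun mon n d -> F^o}.

(* Ten(m,k) = (F^m)^{(x)k}: coordinates indexed by k-tuples of indices < m. *)
Notation tidx m k := {ffun 'I_k -> 'I_m}.
Notation Ten F m k := {ffun tidx m k -> F^o}.

(* The power l^d of the linear form l = sum_i c_i x_i, expanded by the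
   multinomial theorem: coefficient of x^e is (d choose e) * prod_i c_i^e_i. *)
Definition lin_pow (F : fieldType) (n d : nat) (c : 'I_n -> F) : Pol F n d :=
  [ffun e : mon n d =>
     ((d`! %/ \prod_(i < n) (val e i : nat)`!)%N)%:R
     * \prod_(i < n) c i ^+ (val e i : nat)].

Definition mpoly (F : fieldType) (I : finType) := seq (F * {ffun I -> nat}).
Definition meval (F : fieldType) (I : finType) (p : mpoly F I) (x : I -> F) : F :=
  \sum_(t <- p) t.1 * \prod_(i : I) x i ^+ (t.2 i).

Definition zariski_closure (F : fieldType) (I : finType) (S : (I -> F) -> Prop)
  (x : I -> F) : Prop :=
  forall p : mpoly F I, (forall y, S y -> meval p y = 0) -> meval p x = 0.

Definition trk_le (F : fieldType) (m k r : nat) (T : Ten F m k) : Prop :=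
  exists v : 'I_r -> 'I_k -> 'I_m -> F,
    T = [ffun ix : tidx m k => \sum_(j < r) \prod_(t < k) v j t (ix t)].

Definition brk_le (F : fieldType) (m k r : nat) (T : Ten F m k) : Prop :=
  zariski_closure (fun y : tidx m k -> F => trk_le r [ffun ix => y ix])
                  (fun ix => T ix).

Definition is_brk (F : fieldType) (m k : nat) (T : Ten F m k) (r : nat) : Prop :=
  brk_le r T /\ forall r', brk_le r' T -> (r <= r')%N.

(* The border rank as a function (it exists since T has rank <= m^k). *)
Definition brk (F : fieldType) (m k : nat) (T : Ten F m k) : nat :=
  epsilon (inhabits 0%N) (fun r => is_brk T r).

(* Main.v *)
Require Import Defs.
From HB Require Import structures.
From mathcomp Require Import all_boot all_order all_algebra ring zify.
From mathcomp Require Import closed_field mpoly.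
From mathcomp Require Import boolp classical_sets filter.
Set Implicit Arguments. Unset Strict Implicit. Unset Printing Implicit Defensive.
Import GRing.Theory.
Local Open Scope ring_scope.

(* Fix [p] vanishing on the tensors of rank at most [R = a k^d n^q], where
   [q = floor((k-1)d/k)].  Write [T(c) = phi((c.x)^d)].  At a point [c] with
   algebraically independent coordinates (found in an ultrapower of F), curve
   selection realises [T(c)] as the leading coefficient in [e] of a sum of [a]
   products
     [sum_j w_j1(e) (x) ... (x) w_jk(e) = e^s (T(c) + O(e))],
   with polynomial vectors [w_jt] over an extension of [F(c)].  In characteristic
   zero the derivations d/dc_i extend to that field and act on the coefficients
   of the [w_jt]; the operators of order d in them recover every [phi(f)] from
   [T(c)].  By the Leibniz rule such an operator turns each product into [k^d]
   families of terms, one for each distribution of the d derivatives over the k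
   factors.
   Some factor receives at least d/k of the derivatives; the terms that agree
   outside that factor add up to a single product, so a family has rank at most
   [n^q].  Hence [phi(f) + O(e)] has rank at most [R], and [p(phi(f)) = 0].

   Curve selection is proved without algebraic geometry, by a going-down
   argument with places: Noether normalisation makes the coordinates [psi]
   integral over a polynomial ring [K[y]]; the specialisation of y along a
   generic line through the given point extends to psi, and a further place
   extension reaches the parameters of psi. *)

(** * Evaluation of polynomials *)

(** The derivatives act on the vectors [w_jt], so a separate curve for each point c is not enough:
    the curve must depend on c. A single generic point over a larger field achieves this, but the
    rank hypothesis only concerns points over F; the ultrapower carries it over, since a polynomial
    over it is a family of polynomials over F. The curve must also end exactly at [T(c)], whereas an
    extension of the specialisation of y may reach another point of the same finite fibre. Going
    down therefore follows one linear form u that tells the point from the rest of the fibre, and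
    chooses the conjugate of u that tends to 0. The derivations treat e as a constant, so they
    preserve the factor [e^s] and the order of the error term. At nonzero e that factor is divided
    out and p vanishes; e = 0 follows because p is then zero as a polynomial in e. The exponent is d
    - ceil(d/k) = floor((k-1)d/k), the number of letters left free outside the largest class.
    Characteristic zero serves twice: to extend derivations to algebraic elements, and to divide by
    the factorials that iterated derivatives of monomials produce. *)

Lemma mmap_comp (A B C : comNzRingType) N (g : {rmorphism B -> C}) (f : {rmorphism A -> B})
   (u : 'I_N -> B) (p : {mpoly A[N]}) : g (mmap f u p) = mmap (g \o f) (fun i => g (u i)) p.
Proof.
rewrite /mmap rmorph_sum; apply: eq_bigr => m _; rewrite rmorphM; congr (_ * _).
by rewrite rmorph_prod; apply: eq_bigr => i _; rewrite rmorphXn.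
Qed.

Lemma mmap_eq (A B : comNzRingType) N (f g : A -> B) (u v : 'I_N -> B) (p : {mpoly A[N]}) :
  f =1 g -> u =1 v -> mmap f u p = mmap g v p.
Proof.
move=> fg uv; rewrite /mmap; apply: eq_bigr => m _; rewrite fg; congr (_ * _).
by apply: eq_bigr => i _; rewrite uv.
Qed.

Lemma mmap_map_mpoly (A B C : comNzRingType) N (f : {rmorphism B -> C}) (g : {rmorphism A -> B})
    (u : 'I_N -> C) (p : {mpoly A[N]}) :
  mmap f u (map_mpoly g p) = mmap (f \o g) u p.
Proof.
rewrite /map_mpoly (@mmap_comp _ _ _ _ (mmap f u) (@mpolyC N B \o g : {rmorphism _ -> _})).
by apply: mmap_eq => [a|i] /=; rewrite ?mmapC // mmapX mmap1U.
Qed.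

Lemma mmap_homog (K : comNzRingType) (S : comNzRingType) (f : K -> S) N k (p : {mpoly K[N]}) (c : S) v :
  p \is k.-homog -> mmap f (fun j => c * v j) p = c ^+ k * mmap f v p.
Proof.
move/dhomogP => hp; rewrite /mmap mulr_sumr; apply: eq_big_seq => m /hp <-.
rewrite mulrCA; congr (_ * _); rewrite -[X in _ = _ ^+ X * _]/(mdeg m) mdegE -prodrXr /mmap1 -big_split /=.
by apply: eq_bigr => i _; rewrite exprMn.
Qed.

Lemma mmap_muni (A B : comNzRingType) N (f : {rmorphism A -> B}) (u : 'I_N -> B) (t : B)
    (p : {mpoly A[N.+1]}) :
  mmap f (fun i => if unlift ord_max i is Some j then u j else t) p =
  (map_poly (mmap f u) (muni p)).[t].
Proof.
rewrite muniE rmorph_sum horner_sum [LHS]/mmap; apply: eq_bigr => m _ /=.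
rewrite map_polyZ map_polyXn hornerZ hornerXn /= mmapZ -mulrA; congr (_ * _).
rewrite mmapX /mmap1 big_ord_recr /= unlift_none; congr (_ * _).
apply: eq_bigr => i _; rewrite mnmE.
have -> : widen_ord (leqnSn N) i = lift ord_max i.
  by apply: val_inj; rewrite /= /bump leqNgt ltn_ord.
by rewrite liftK.
Qed.

Lemma mmap_morph (R S : comNzRingType) n (g : {rmorphism {mpoly R[n]} -> S})
    (f : {rmorphism R -> S}) (h : 'I_n -> S) :
  (forall a, g a%:MP = f a) -> (forall i, g 'X_i = h i) -> g =1 mmap f h.
Proof.
move=> gC gX p; rewrite {1}[p]mpolyE rmorph_sum /= /mmap; apply: eq_bigr => m _.
rewrite -mul_mpolyC rmorphM /= gC; congr (_ * _).
rewrite mpolyXE_id rmorph_prod; apply: eq_bigr => i _.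
by rewrite rmorphXn /= gX.
Qed.

(** Induction on the number of variables: some coefficient of [muni p] survives at a point [c], and
    a closed field has an element off the roots of the resulting univariate polynomial. *)
Lemma mpoly_nonroot (F : closedFieldType) n (p : {mpoly F[n]}) :
  p != 0 -> exists c : 'I_n -> F, p.@[c] != 0.
Proof.
elim: n p => [|n IH] p p0.
  exists (fun _ => 0); rewrite (nvar0_mpolyC p) mevalC.
  by apply: contra p0 => /eqP H; rewrite (nvar0_mpolyC p) H mpolyC0.
have [m0 m0p] : exists m0, m0 \in msupp p.
  exists (mlead p); exact: mlead_supp.
(* [r] forgets the last exponent; the two together determine a monomial, so nothing cancels the
   coefficient of [m0]. *)
pose r (m : 'X_{1..n.+1}) : 'X_{1..n} := [multinom m (widen_ord (leqnSn n) i) | i < n].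
have rinj m m' : r m = r m' -> m ord_max = m' ord_max -> m = m'.
  move=> /mnmP H1 H2; apply/mnmP => i; case: (unliftP ord_max i) => [j ->|-> //].
  have := H1 j; rewrite !mnmE; have -> // : lift ord_max j = widen_ord (leqnSn n) j.
  by apply: val_inj; rewrite /= /bump leqNgt ltn_ord.
have [c Hc] : exists c : 'I_n -> F, ((muni p)`_(m0 ord_max)).@[c] != 0.
  apply: IH; apply/eqP => /(congr1 (mcoeff (r m0))); rewrite mcoeff0.
  rewrite muniE coef_sum raddf_sum /= (bigD1_seq m0) ?msupp_uniq //= big1 ?addr0.
    rewrite coefZ coefXn eqxx mulr1 mcoeffZ mcoeffX eqxx mulr1.
    by apply/eqP; rewrite -mcoeff_msupp.
  move=> m mm0; rewrite coefZ coefXn; case: eqP => [e|_]; last by rewrite mulr0 mcoeff0.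
  rewrite mulr1 mcoeffZ mcoeffX; case: eqP => [e'|_]; last by rewrite mulr0.
  by rewrite (rinj m m0) ?eqxx in mm0.
have P0 : map_poly (meval c) (muni p) != 0.
  by apply: contraNneq Hc => H; rewrite -coef_map H coef0.
have [t Ht] := closed_nonrootP _ P0.
exists (fun i => if unlift ord_max i is Some j then c j else t).
by rewrite [X in X != 0](mmap_muni idfun c t p).
Qed.

(** * Ultrapowers and generic points *)

Local Open Scope quotient_scope.
Local Open Scope classical_set_scope.

Section Ultrapower.
Variables (X : Type) (F : closedFieldType) (U : set_system X).
Hypothesis UU : UltraFilter U.

Let U_filter : Filter U := @filter_filter _ _ (ultra_proper).

Definition ueqv (f g : X -> F) : bool := `[< U [set i | f i = g i] >].

Lemma ueqv_equiv : equiv_class_of ueqv.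
Proof.
split=> [f|f g|g f h].
- by apply/asboolP; apply: filterS filterT => i.
- by apply/asboolP/asboolP => H; apply: filterS H => i /= ->.
- move=> /asboolP fg /asboolP gh; apply/asboolP.
  by apply: filterS2 fg gh => i /= -> ->.
Qed.
Canonical ueqv_rel := EquivRelPack ueqv_equiv.
Definition upow := {eq_quot ueqv}.
HB.instance Definition _ := Choice.on upow.
HB.instance Definition _ := EqQuotient.on upow.

Definition ucl (f : X -> F) : upow := \pi_upow f.

Lemma uclP f g : ucl f = ucl g <-> U [set i | f i = g i].
Proof.
by split=> [/eqmodP/asboolP|H] //; apply/eqmodP/asboolP.
Qed.

Lemma ucl_surj x : exists f, x = ucl f.
Proof. by exists (repr x); rewrite /ucl reprK. Qed.

Lemma ucl_repr f : U [set i | repr (ucl f) i = f i].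
Proof. by apply/uclP; rewrite /ucl reprK. Qed.

Definition uadd (x y : upow) := ucl (fun i => repr x i + repr y i).
Definition umul (x y : upow) := ucl (fun i => repr x i * repr y i).
Definition uopp (x : upow) := ucl (fun i => - repr x i).
Definition uinv (x : upow) := ucl (fun i => (repr x i)^-1).

Lemma uaddE f g : uadd (ucl f) (ucl g) = ucl (fun i => f i + g i).
Proof. by apply/uclP; apply: filterS2 (ucl_repr f) (ucl_repr g) => i /= -> ->. Qed.
Lemma umulE f g : umul (ucl f) (ucl g) = ucl (fun i => f i * g i).
Proof. by apply/uclP; apply: filterS2 (ucl_repr f) (ucl_repr g) => i /= -> ->. Qed.
Lemma uoppE f : uopp (ucl f) = ucl (fun i => - f i).
Proof. by apply/uclP; apply: filterS (ucl_repr f) => i /= ->. Qed.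
Lemma uinvE f : uinv (ucl f) = ucl (fun i => (f i)^-1).
Proof. by apply/uclP; apply: filterS (ucl_repr f) => i /= ->. Qed.

Lemma uaddA : associative uadd.
Proof.
move=> x y z; case: (ucl_surj x) (ucl_surj y) (ucl_surj z) => f -> [g ->] [h ->].
by rewrite !uaddE; congr ucl; apply/funext => i; rewrite addrA.
Qed.
Lemma uaddC : commutative uadd.
Proof.
move=> x y; case: (ucl_surj x) (ucl_surj y) => f -> [g ->].
by rewrite !uaddE; congr ucl; apply/funext => i; rewrite addrC.
Qed.
Lemma uadd0 : left_id (ucl (fun=> 0)) uadd.
Proof.
move=> x; case: (ucl_surj x) => f ->.
by rewrite !uaddE; congr ucl; apply/funext => i; rewrite add0r.
Qed.
Lemma uaddN : left_inverse (ucl (fun=> 0)) uopp uadd.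
Proof.
move=> x; case: (ucl_surj x) => f ->.
by rewrite uoppE !uaddE; congr ucl; apply/funext => i; rewrite addNr.
Qed.
HB.instance Definition _ := GRing.isZmodule.Build upow uaddA uaddC uadd0 uaddN.

Lemma umulA : associative umul.
Proof.
move=> x y z; case: (ucl_surj x) (ucl_surj y) (ucl_surj z) => f -> [g ->] [h ->].
by rewrite !umulE; congr ucl; apply/funext => i; rewrite mulrA.
Qed.
Lemma umulC : commutative umul.
Proof.
move=> x y; case: (ucl_surj x) (ucl_surj y) => f -> [g ->].
by rewrite !umulE; congr ucl; apply/funext => i; rewrite mulrC.
Qed.
Lemma umul1 : left_id (ucl (fun=> 1)) umul.
Proof.
move=> x; case: (ucl_surj x) => f ->.
by rewrite !umulE; congr ucl; apply/funext => i; rewrite mul1r.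
Qed.
Lemma umulDl : left_distributive umul +%R.
Proof.
move=> x y z; case: (ucl_surj x) (ucl_surj y) (ucl_surj z) => f -> [g ->] [h ->].
rewrite -[RHS]/(uadd _ _) -[ucl f + ucl g]/(uadd _ _) !(umulE, uaddE).
by congr ucl; apply/funext => i; rewrite mulrDl.
Qed.
Lemma u1neq0 : ucl (fun=> 1) != 0.
Proof.
apply/eqP => /uclP H; have [i /= /eqP] := filter_ex H.
by rewrite oner_eq0.
Qed.
HB.instance Definition _ :=
  GRing.Zmodule_isComNzRing.Build upow umulA umulC umul1 umulDl u1neq0.

Lemma umulV (x : upow) : x != 0 -> uinv x * x = 1.
Proof.
case: (ucl_surj x) => f -> fN0; rewrite uinvE [LHS]umulE; apply/uclP.
have [H|H] := in_ultra_setVsetC [set i | f i = 0] UU.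
  by case/eqP: fN0; apply/uclP.
by apply: filterS H => i /= /eqP fi0; rewrite mulVf.
Qed.
Lemma uinv0 : uinv 0 = 0.
Proof. by rewrite [LHS]uinvE; congr ucl; apply/funext => i; rewrite invr0. Qed.
HB.instance Definition _ := GRing.ComNzRing_isField.Build upow umulV uinv0.

Lemma uclD f g : ucl (fun i => f i + g i) = ucl f + ucl g.
Proof. by rewrite -[RHS]/(uadd _ _) uaddE. Qed.
Lemma uclM f g : ucl (fun i => f i * g i) = ucl f * ucl g.
Proof. by rewrite -[RHS]/(umul _ _) umulE. Qed.

Lemma ucl_sum (I : Type) (r : seq I) (P : pred I) (f : I -> X -> F) :
  ucl (fun i => \sum_(j <- r | P j) f j i) = \sum_(j <- r | P j) ucl (f j).
Proof.
elim: r => [|j r IH]; first by rewrite big_nil; apply/uclP; apply: filterS filterT => i _; rewrite /= big_nil.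
rewrite big_cons -IH; case: ifP => Pj; last first.
  by congr ucl; apply/funext => i; rewrite big_cons Pj.
by rewrite -uclD; congr ucl; apply/funext => i; rewrite big_cons Pj.
Qed.

Lemma ucl_prod (I : Type) (r : seq I) (P : pred I) (f : I -> X -> F) :
  ucl (fun i => \prod_(j <- r | P j) f j i) = \prod_(j <- r | P j) ucl (f j).
Proof.
elim: r => [|j r IH]; first by rewrite big_nil; apply/uclP; apply: filterS filterT => i _; rewrite /= big_nil.
rewrite big_cons -IH; case: ifP => Pj; last first.
  by congr ucl; apply/funext => i; rewrite big_cons Pj.
by rewrite -uclM; congr ucl; apply/funext => i; rewrite big_cons Pj.
Qed.

Lemma ucl_exp f n : ucl (fun i => f i ^+ n) = ucl f ^+ n.
Proof.
elim: n => [|n IH]; first by rewrite expr0; apply/uclP; apply: filterS filterT => i _.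
by rewrite exprS -IH -uclM; congr ucl; apply/funext => i; rewrite exprS.
Qed.

(** Roots are chosen index by index. With the representatives [repr (P j)] fixed, the equation holds
    at every index, not merely on a set of [U]. *)
Lemma upow_closed : GRing.closed_field_axiom upow.
Proof.
move=> n P n0; pose x i := xget 0 [set x : F | x ^+ n = \sum_(j < n) repr (P j) i * x ^+ j].
exists (ucl x); rewrite -ucl_exp.
have -> : \sum_(i < n) P i * ucl x ^+ i =
   ucl (fun i => \sum_(j < n) repr (P j) i * x i ^+ j).
  rewrite ucl_sum; apply: eq_bigr => j _.
  by rewrite uclM ucl_exp [ucl (repr (P j))]reprK.
congr ucl; apply/funext => i; rewrite /x; case: xgetP => [y -> //|H].
by have [y Hy] := @solve_monicpoly F n (fun j => repr (P j) i) n0; case: (H y).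
Qed.
HB.instance Definition _ := Field_isAlgClosed.Build upow upow_closed.

Definition uconst (a : F) : upow := ucl (fun=> a).
Lemma uconst_zmod : zmod_morphism uconst.
Proof. by move=> a b; rewrite -[RHS]/(uadd (uconst a) (uopp (uconst b))) uoppE uaddE. Qed.
Lemma uconst_monoid : monoid_morphism uconst.
Proof. by split => // a b; rewrite /uconst uclM. Qed.
HB.instance Definition _ := GRing.isZmodMorphism.Build F upow uconst uconst_zmod.
HB.instance Definition _ := GRing.isMonoidMorphism.Build F upow uconst uconst_monoid.
Lemma mmap_ucl n (u : 'I_n -> X -> F) (p : {mpoly F[n]}) :
  mmap (uconst) (fun i => ucl (u i)) p = ucl (fun c => p.@[fun i => u i c]).
Proof.
rewrite /mmap [in RHS](_ : (fun c => _) = (fun c => \sum_(m <- msupp p) p@_m * \prod_i u i c ^+ m i)) //.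
rewrite ucl_sum; apply: eq_bigr => m _; rewrite uclM; congr (_ * _).
by rewrite ucl_prod; apply: eq_bigr => i _; rewrite ucl_exp.
Qed.

End Ultrapower.

(** Nonvanishing loci are nonempty, and that of a product lies in those of its factors, so they
    generate a proper filter; an ultrafilter above it is taken. *)
Lemma exists_generic (F : closedFieldType) n :
  exists U : set_system ('I_n -> F), UltraFilter U /\
    forall p : {mpoly F[n]}, p != 0 -> U [set c | p.@[c] <> 0].
Proof.
pose B (p : {mpoly F[n]}) := [set c : 'I_n -> F | p.@[c] <> 0].
have PF : ProperFilter (filter_from [set p : {mpoly F[n]} | p <> 0] B).
  apply: filter_from_proper.
    apply: filter_from_filter; first by exists 1; apply/eqP; exact: oner_neq0.
    move=> p q /= /eqP p0 /eqP q0; exists (p * q); first by apply/eqP; rewrite mulf_neq0.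
    move=> c; rewrite /B /= mevalM => /eqP; rewrite mulf_eq0 negb_or => /andP[a b].
    by split; apply/eqP.
  by move=> p /= /eqP p0; have [c /eqP Hc] := mpoly_nonroot p0; exists c.
have [U [UU sU]] := ultraFilterLemma PF.
by exists U; split=> // p /eqP p0; apply: sU; exists p.
Qed.

Section GenericPoint.
Variables (F : closedFieldType) (n : nat) (U : set_system ('I_n -> F)).
Hypothesis UU : UltraFilter U.
(** The identity family of points, read as one point of the ultrapower. *)
Definition gpt (i : 'I_n) : upow F UU := ucl UU (fun c => c i).

Hypothesis Ugen : forall p : {mpoly F[n]}, p != 0 -> U [set c | p.@[c] <> 0].
Lemma gpt_generic (p : {mpoly F[n]}) : mmap (uconst UU) gpt p = 0 -> p = 0.
Proof.
rewrite mmap_ucl => /uclP H; apply: contrapT => /eqP p0.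
by have [c []] := filter_ex (filterI H (Ugen p0)).
Qed.
End GenericPoint.

Definition alg_indep (F K : fieldType) (iota : F -> K) n (c : 'I_n -> K) :=
  forall p : {mpoly F[n]}, mmap iota c p = 0 -> p = 0.

Lemma generic_extension (F : closedFieldType) n :
  exists (K : closedFieldType) (iota : {rmorphism F -> K}) (c : 'I_n -> K),
    alg_indep iota c.
Proof.
have [U [UU HU]] := exists_generic F n.
exists (upow F UU : closedFieldType), (uconst UU : {rmorphism _ -> _}), (gpt UU).
exact: gpt_generic.
Qed.

(** * Places *)

(** [Zorn_bigcup] also asks for the union of the empty chain, so [P] admits [set0] besides the good
    sets above [A0]; nonemptiness of [A0] keeps [set0] from being maximal. *)
Lemma rel_zorn (T : Type) (Good : set T -> Prop) (A0 : set T) :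
  Good A0 -> A0 !=set0 ->
  (forall F : set (set T), F !=set0 -> (forall A, F A -> Good A) ->
     total_on F subset -> Good (\bigcup_(X in F) X)) ->
  exists A, [/\ Good A, A0 `<=` A & forall B, Good B -> A `<=` B -> B `<=` A].
Proof.
move=> G0 [t0 A0t] Gch; pose P A := A = set0 \/ (Good A /\ A0 `<=` A).
have [F sFP totF|A [PA maxA]] := @Zorn_bigcup T P.
  case: (pselect (exists2 A, F A & A0 `<=` A)) => [[A FA A0A]|nA]; last first.
    left; rewrite -subset0 => t [A FA At].
    case: (sFP _ FA) => [A_0|[_ A0A]]; first by rewrite A_0 in At.
    by case: nA; exists A.
  right; pose F' := [set B | F B /\ A0 `<=` B].
  have -> : \bigcup_(X in F) X = \bigcup_(X in F') X.
    rewrite eqEsubset; split=> t [B FB Bt]; last by exists B => //; case: FB.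
    case: (sFP _ FB) => [B_0|[_ A0B]]; first by rewrite B_0 in Bt.
    by exists B.
  split; last by move=> t At; exists A => //; apply: A0A.
  apply: Gch; first by exists A.
    move=> B [FB A0B]; case: (sFP _ FB) => [B_0|[]//].
    by have := A0B _ A0t; rewrite B_0.
  by move=> B C [FB _] [FC _]; apply: totF.
case: PA => [A_0|[GA A0A]].
  have : ~ P A0.
    apply: maxA; rewrite A_0; split; first exact: sub0set.
    by move=> /(_ _ A0t).
  by case; right; split.
exists A; split=> // B GB AB; apply: contrapT => nBA.
have : ~ P B by apply: maxA.
by case; right; split=> // t /A0A /AB.
Qed.

Section SubringRel.
Variables (A B : comNzRingType).
Implicit Types G : A -> B -> Prop.

(** A subring of the product of [A] and [B]. With [rel_functional] it is the graph of a ring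
    morphism defined on a subring of [A], so that Zorn's lemma handles map and domain as one set. *)
Definition subring_rel G :=
  [/\ G 1 1, forall a b a' b', G a b -> G a' b' -> G (a - a') (b - b')
           & forall a b a' b', G a b -> G a' b' -> G (a * a') (b * b')].
Definition rel_functional G := forall b, G 0 b -> b = 0.

End SubringRel.

Section Closure.
Variables (A B : comNzRingType) (G : A -> B -> Prop).
Hypothesis sG : subring_rel G.

Lemma srel1 : G 1 1. Proof. by case: sG. Qed.
Lemma srelB a b a' b' : G a b -> G a' b' -> G (a - a') (b - b').
Proof. by case: sG => _ H _; apply: H. Qed.
Lemma srelM a b a' b' : G a b -> G a' b' -> G (a * a') (b * b').
Proof. by case: sG => _ _; apply. Qed.
Lemma srel0 : G 0 0.
Proof. by have := srelB srel1 srel1; rewrite !subrr. Qed.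
Lemma srelN a b : G a b -> G (- a) (- b).
Proof. by move/(srelB srel0); rewrite !sub0r. Qed.
Lemma srelD a b a' b' : G a b -> G a' b' -> G (a + a') (b + b').
Proof. by move=> H /srelN /(srelB H); rewrite !opprK. Qed.
Lemma srel_sum (I : Type) (r : seq I) (P : pred I) (f : I -> A) (g : I -> B) :
  (forall i, P i -> G (f i) (g i)) ->
  G (\sum_(i <- r | P i) f i) (\sum_(i <- r | P i) g i).
Proof. by move=> H; elim/big_rec2: _ => [|i a b Pi]; [exact: srel0|apply: srelD; apply: H]. Qed.
Lemma srel_prod (I : Type) (r : seq I) (P : pred I) (f : I -> A) (g : I -> B) :
  (forall i, P i -> G (f i) (g i)) ->
  G (\prod_(i <- r | P i) f i) (\prod_(i <- r | P i) g i).
Proof. by move=> H; elim/big_rec2: _ => [|i a b Pi]; [exact: srel1|apply: srelM; apply: H]. Qed.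
Lemma srelX a b n : G a b -> G (a ^+ n) (b ^+ n).
Proof. by move=> H; elim: n => [|n IH]; [exact: srel1|rewrite !exprS; apply: srelM]. Qed.

Lemma srel_inj a b b' : rel_functional G -> G a b -> G a b' -> b = b'.
Proof.
move=> fG H /(srelB H); rewrite subrr => /fG /eqP.
by rewrite subr_eq0 => /eqP.
Qed.

Definition poly_rel (P : {poly A}) (Q : {poly B}) := forall i, G P`_i Q`_i.

Lemma poly_rel_ring : subring_rel poly_rel.
Proof.
split.
- by move=> i; rewrite !coef1; case: (i == 0)%N; [exact: srel1|exact: srel0].
- by move=> a b a' b' H H' i; rewrite !coefB; apply: srelB.
- by move=> a b a' b' H H' i; rewrite !coefM; apply: srel_sum => j _; apply: srelM.
Qed.

Lemma poly_relC a b : G a b -> poly_rel a%:P b%:P.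
Proof. by move=> H i; rewrite !coefC; case: ifP => // _; exact: srel0. Qed.

Lemma poly_relX : poly_rel 'X 'X.
Proof. by move=> i; rewrite !coefX; case: eqP => _; [exact: srel1|exact: srel0]. Qed.

Lemma poly_relXn n : poly_rel 'X^n 'X^n.
Proof. by move=> i; rewrite !coefXn; case: eqP => _; [exact: srel1|exact: srel0]. Qed.

Lemma poly_rel_horner P Q a b : poly_rel P Q -> G a b -> G P.[a] Q.[b].
Proof.
move=> HPQ Hab; rewrite (@horner_coef_wide _ (maxn (size P) (size Q))) ?leq_maxl //.
rewrite (@horner_coef_wide _ (maxn (size P) (size Q)) Q) ?leq_maxr //.
by apply: srel_sum => i _; apply: srelM => //; apply: srelX.
Qed.

(** For a subring [G], the subring of the product generated by [G] and the pair [(z, w)]. *)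
Definition adj_rel (z : A) (w : B) a b :=
  exists P Q, [/\ poly_rel P Q, a = P.[z] & b = Q.[w]].

Lemma adj_rel_ring z w : subring_rel (adj_rel z w).
Proof.
split.
- by exists 1, 1; rewrite !hornerE; split=> //; case: poly_rel_ring.
- move=> _ _ _ _ [P [Q [H -> ->]]] [P' [Q' [H' -> ->]]].
  by exists (P - P'), (Q - Q'); rewrite !hornerE; split=> //; case: poly_rel_ring => _ + _; apply.
- move=> _ _ _ _ [P [Q [H -> ->]]] [P' [Q' [H' -> ->]]].
  by exists (P * P'), (Q * Q'); rewrite !hornerM; split=> //; case: poly_rel_ring => _ _; apply.
Qed.

Lemma adj_rel_sub z w a b : G a b -> adj_rel z w a b.
Proof. by exists a%:P, b%:P; rewrite !hornerC; split=> //; apply: poly_relC. Qed.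

Lemma adj_rel_gen z w : adj_rel z w z w.
Proof. by exists 'X, 'X; rewrite !hornerX; split=> //; apply: poly_relX. Qed.
End Closure.

Section Place.
Variables (E : fieldType) (Om : closedFieldType).
Implicit Types G : E -> Om -> Prop.

(** The graph of the residue map of a valuation ring: elements related to something form the ring,
    those related to 0 its maximal ideal. *)
Definition place G := [/\ subring_rel G, rel_functional G &
  forall z, (exists w, G z w) \/ G z^-1 0].

Section Max.
Variable G : E -> Om -> Prop.
Hypotheses (sG : subring_rel G) (fG : rel_functional G).
Hypothesis maxG : forall G', subring_rel G' -> rel_functional G' ->
  (forall a b, G a b -> G' a b) -> forall a b, G' a b -> G a b.

(** Localisation: fractions whose denominator has nonzero image form a functional subring above [G],
    hence [G] itself by maximality. *)
Let max_inv b w : G b w -> w != 0 -> G b^-1 w^-1.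
Proof.
move=> Gbw w0.
pose G' x y := exists c u s t, [/\ G c u, G s t, t != 0, x = c / s & y = u / t].
have nz s t : G s t -> t != 0 -> s != 0.
  by move=> Gst; apply: contra_neq => s0; apply: fG; rewrite -s0.
apply: (maxG (G' := G')).
- split.
  + by exists 1, 1, 1, 1; rewrite !divr1 oner_neq0; split=> //; apply: srel1.
  + move=> _ _ _ _ [c [u [s [t [Gc Gs t0 -> ->]]]]] [c' [u' [s' [t' [Gc' Gs' t0' -> ->]]]]].
    exists (c * s' - c' * s), (u * t' - u' * t), (s * s'), (t * t').
    split; [|exact: srelM|by rewrite mulf_neq0| |].
    * by apply: srelB => //; apply: srelM.
    * by rewrite -mulNr addf_div ?mulNr //; apply: nz; eassumption.
    * by rewrite -mulNr addf_div ?mulNr.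
  + move=> _ _ _ _ [c [u [s [t [Gc Gs t0 -> ->]]]]] [c' [u' [s' [t' [Gc' Gs' t0' -> ->]]]]].
    exists (c * c'), (u * u'), (s * s'), (t * t').
    by rewrite !mulf_div mulf_neq0 //; split=> //; apply: srelM.
- move=> y [c [u [s [t [Gc Gs t0 /esym /eqP + ->]]]]].
  rewrite mulf_eq0 invr_eq0 (negbTE (nz _ _ Gs t0)) orbF => /eqP c0.
  by move: Gc; rewrite c0 => /fG ->; rewrite mul0r.
- by move=> x y Gxy; exists x, y, 1, 1; rewrite !divr1 oner_neq0; split=> //; apply: srel1.
- by exists 1, 1, b, w; rewrite !div1r; split=> //; apply: srel1.
Qed.

(** The constraints on a possible image [w] of [z]: [w] has to be a root of all these
    polynomials. *)
Let J z (Q : {poly Om}) := exists2 P, poly_rel G P Q & P.[z] = 0.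

Let max_adj z w : (forall Q, J z Q -> Q.[w] = 0) -> G z w.
Proof.
move=> H; apply: (maxG (G' := adj_rel G z w)).
- exact: adj_rel_ring.
- by move=> b [P [Q [HPQ /esym P0 ->]]]; apply: H; exists P.
- by move=> a b; apply: adj_rel_sub.
- exact: adj_rel_gen.
Qed.

(** [J z] behaves like an ideal with an element [Q0] of least degree. Either [Q0] is constant, or it
    has a root [w] since [Om] is closed, and by division [w] is a root of all of [J z]. *)
Let max_or z : (exists w, G z w) \/ J z 1.
Proof.
case: (pselect (exists Q, J z Q /\ Q != 0)) => [[Q1 JQ1]|nQ]; last first.
  left; exists 0; apply: max_adj => Q JQ; have [->|Q0] := eqVneq Q 0; first by rewrite horner0.
  by case: nQ; exists Q.
have [Q0 [[JQ0 Q00] minQ]] : exists Q0, (J z Q0 /\ Q0 != 0) /\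
    forall Q, J z Q -> Q != 0 -> (size Q0 <= size Q)%N.
  have ex : exists n, `[< exists Q, (J z Q /\ Q != 0) /\ size Q = n >].
    by exists (size Q1); apply/asboolP; exists Q1.
  case: (ex_minnP ex) => n /asboolP [Q0 [HQ0 sQ0]] minn; exists Q0; split=> // Q JQ Q0'.
  by rewrite sQ0; apply: minn; apply/asboolP; exists Q.
have [P0 HPQ0 P0z] := JQ0.
have lQ0 : lead_coef Q0 != 0 by rewrite lead_coef_eq0.
have GL : G P0`_(size Q0).-1 (lead_coef Q0) by apply: HPQ0.
have GLi := max_inv GL lQ0.
have [Q0c|Q0nc] := leqP (size Q0) 1.
  right; have [c c0 eQ0] : exists2 c, c != 0 & Q0 = c%:P.
    by exists Q0`_0; [rewrite (size1_polyC Q0c) polyC_eq0 in Q00|rewrite -size1_polyC].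
  exists (P0 * (P0`_(size Q0).-1)^-1%:P); last by rewrite hornerM P0z mul0r.
  have -> : 1 = Q0 * (lead_coef Q0)^-1%:P.
    by rewrite eQ0 lead_coefC -polyCM divff.
  apply: (srelM (poly_rel_ring sG)) => //; exact: poly_relC.
left; have [w rw] : exists w, root Q0 w by apply/closed_rootP; rewrite neq_ltn Q0nc orbT.
exists w; apply: max_adj => Q; have [n] := ubnP (size Q); elim: n Q => // n IH Q szQ [P HPQ Pz].
have [->|nQ] := eqVneq Q 0; first by rewrite horner0.
have leQ : (size Q0 <= size Q)%N by apply: minQ => //; exists P.
(* The division step is done on the lifts as well: [c] lies over [u] because [max_inv] inverts the
   lift of the leading coefficient of [Q0]. *)
pose p := P`_(size Q).-1; pose c := p / P0`_(size Q0).-1.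
pose u := lead_coef Q / lead_coef Q0; pose s := (size Q - size Q0)%N.
have Gcu : G c u by apply: srelM => //; apply: HPQ.
pose P' := P - c%:P * 'X^s * P0; pose Q' := Q - u%:P * 'X^s * Q0.
have : Q'.[w] = 0.
  apply: IH; last first.
    exists P'; last by rewrite hornerD hornerN hornerM Pz P0z mulr0 subrr.
    have rr := poly_rel_ring sG.
    apply: (srelB rr) => //; apply: (srelM rr) => //; apply: (srelM rr).
      exact: poly_relC.
    exact: poly_relXn.
  have sQ : size (u%:P * 'X^s * Q0) = size Q.
    rewrite -mulrA mul_polyC size_scale; last first.
      by rewrite mulf_neq0 ?invr_eq0 // lead_coef_eq0.
    by rewrite mulrC size_mulXn // /s subnK.
  have lQ : lead_coef (u%:P * 'X^s * Q0) = lead_coef Q.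
    by rewrite !lead_coefM lead_coefC lead_coefXn mulr1 mulfVK.
  rewrite -ltnS; apply: leq_trans szQ; rewrite ltnS.
  have sQ1 : (0 < size Q)%N by rewrite lt0n size_poly_eq0.
  have le : (size Q' <= size Q)%N.
    by rewrite (leq_trans (size_polyD _ _)) // size_polyN sQ geq_max leqnn.
  rewrite ltn_neqAle le andbT; apply/eqP => eqs.
  have : lead_coef Q' = 0.
    rewrite lead_coefE eqs coefB -lead_coefE -sQ -lead_coefE lQ; exact: subrr.
  by move/eqP; rewrite lead_coef_eq0 => /eqP Q'0; move: sQ1; rewrite -eqs Q'0 size_poly0.
rewrite /Q' hornerD hornerN !hornerM (eqP (rw : Q0.[w] == 0)) mulr0 subr0.
by [].
Qed.

(** The degree descent of Chevalley's lemma. The reversal of [P'], divided by the constant term of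
    [P'], is monic and vanishes at [z]. It removes the top term of [P], whose coefficient has image
    0, so the image stays 1. *)
Let reduce z P P' : z != 0 -> poly_rel G P 1 -> poly_rel G P' 1 ->
  P.[z] = 0 -> P'.[z^-1] = 0 -> (size P' <= size P)%N ->
  exists P1, [/\ poly_rel G P1 1, P1.[z] = 0 & (size P1 < size P)%N].
Proof.
move=> z0 GP GP' Pz P'z leP.
have G0 : G P'`_0 1 by have := GP' 0%N; rewrite coef1.
have P0 : P'`_0 != 0 by apply/eqP => e; move: G0; rewrite e => /fG /eqP; rewrite oner_eq0.
have GV : G (P'`_0)^-1 1 by have := max_inv G0 (oner_neq0 _); rewrite invr1.
have sP' : (1 < size P')%N.
  rewrite ltnNge; apply/negP => s1; move: P'z; rewrite (size1_polyC s1) hornerC => e.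
  by rewrite e eqxx in P0.
pose m := (size P').-1; have em : size P' = m.+1 by rewrite /m prednK // ltnW.
pose n := (size P).-1.
have sP : (1 < size P)%N by apply: leq_trans leP.
have en : size P = n.+1 by rewrite /n prednK // ltnW.
have m0 : (0 < m)%N by rewrite -ltnS -em.
have n0 : (0 < n)%N by rewrite -ltnS -en.
pose R := \poly_(j < m.+1) (P'`_(m - j) / P'`_0).
have Rz : R.[z] = 0.
  have : P'.[z^-1] * z ^+ m / P'`_0 = 0 by rewrite P'z !mul0r.
  move=> <-; rewrite horner_poly horner_coef em mulr_suml mulr_suml.
  rewrite (reindex_inj rev_ord_inj) /=; apply: eq_bigr => i _.
  have im : (i <= m)%N by rewrite -ltnS.
  by rewrite subSS subKn // mulrAC exprB ?unitfE // exprVn -!mulrA; congr (_ * _); rewrite mulrCA.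
pose P1 := P - (P`_n)%:P * 'X^(n - m) * R.
have Gn : G P`_n 0 by have := GP n; rewrite coef1; case: (n) n0.
have rr := poly_rel_ring sG.
have [S GRS] : exists S, poly_rel G R S.
  exists (\poly_(j < m.+1) ((1 : {poly Om})`_(m - j) / 1)) => i.
  rewrite !coef_poly; case: ifP => _; last exact: srel0.
  by apply: srelM => //; rewrite invr1.
exists P1; split.
- have -> : 1 = 1 - (0%:P * 'X^(n - m) * S) :> {poly Om} by rewrite polyC0 !mul0r subr0.
  apply: (srelB rr) => //; apply: (srelM rr) => //; apply: (srelM rr); first exact: poly_relC.
  exact: poly_relXn.
- by rewrite /P1 hornerD hornerN hornerM Rz mulr0 Pz subr0.
- rewrite en ltnS; apply/leq_sizeP => j; rewrite leq_eqVlt => /orP[/eqP <-|nj].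
    rewrite coefB -mulrA coefCM coefXnM ltnNge leq_subr /= subKn; last by rewrite -ltnS -en -em.
    by rewrite coef_poly ltnSn subnn divff // mulr1 subrr.
  rewrite coefB nth_default ?en // sub0r -mulrA coefCM coefXnM.
  case: ifP => _; first by rewrite mulr0 oppr0.
  rewrite coef_poly ltnS; case: leqP => [|_]; last by rewrite mulr0 oppr0.
  rewrite leq_subLR => H; have := leq_trans nj H; rewrite subnK ?ltnn //.
  by rewrite -ltnS -en -em.
Qed.

Let not_both z : z != 0 -> J z 1 -> J z^-1 1 -> False.
Proof.
move=> z0 [P GP Pz] [P' GP' P'z].
have [N] := ubnP (size P + size P'); elim: N z P P' z0 GP Pz GP' P'z => // N IH z P P' z0 GP Pz GP' P'z lt.
have [le|/ltnW le] := leqP (size P') (size P).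
  have [P1 [G1 P1z s1]] := reduce z0 GP GP' Pz P'z le.
  by apply: (IH z P1 P') => //; rewrite -ltnS; apply: leq_trans lt; rewrite ltnS ltn_add2r.
have z0' : z^-1 != 0 by rewrite invr_eq0.
have [|P1 [G1 P1z s1]] := reduce z0' GP' GP P'z _ le; first by rewrite invrK.
by apply: (IH z P P1) => //; rewrite -ltnS; apply: leq_trans lt; rewrite ltnS ltn_add2l.
Qed.

Lemma max_place : place G.
Proof.
split=> // z; have [->|z0] := eqVneq z 0; first by left; exists 0; apply: srel0.
have [|Jz] := max_or z; first by left.
have [[w Gw]|Jz'] := max_or z^-1; last by case: (not_both z0 Jz Jz').
have [w0|w0] := eqVneq w 0; first by right; rewrite -w0.
by left; exists w^-1; rewrite -[z]invrK; apply: max_inv.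
Qed.
End Max.

(** Chevalley's extension theorem: Zorn's lemma gives a maximal partial morphism, and maximality
    forces its domain to be a valuation ring. *)
Lemma place_extension G0 : subring_rel G0 -> rel_functional G0 ->
  exists2 G, place G & forall a b, G0 a b -> G a b.
Proof.
move=> sG0 fG0; pose rel (S : set (E * Om)) a b := S (a, b).
pose Good (S : set (E * Om)) := subring_rel (rel S) /\ rel_functional (rel S).
have [|||S [[sS fS] S0 maxS]] := @rel_zorn _ Good [set x | G0 x.1 x.2].
- by split.
- by exists (1, 1); apply: (srel1 sG0).
- move=> F [S1 FS1] HF tot; split.
    split.
    + by exists S1 => //; have [[]] := HF _ FS1.
    + move=> a b a' b' [S FS Sab] [S' FS' Sab'].
      have [/(_ _ Sab)|/(_ _ Sab')] := tot _ _ FS FS'.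
        by move=> H; exists S' => //; have [s _] := HF _ FS'; apply: (srelB s).
      by move=> H; exists S => //; have [s _] := HF _ FS; apply: (srelB s).
    + move=> a b a' b' [S FS Sab] [S' FS' Sab'].
      have [/(_ _ Sab)|/(_ _ Sab')] := tot _ _ FS FS'.
        by move=> H; exists S' => //; have [s _] := HF _ FS'; apply: (srelM s).
      by move=> H; exists S => //; have [s _] := HF _ FS; apply: (srelM s).
  by move=> b [S FS Sb]; have [_ f] := HF _ FS; apply: f.
exists (rel S); last by move=> a b H; apply: S0.
apply: max_place => // G' sG' fG' sub a b G'ab.
apply: (maxS [set x | G' x.1 x.2]) => // -[c e] /=; exact: sub.
Qed.
End Place.

(** * Derivations *)

Section DerRel.
Variable K : fieldType.
Hypothesis charK : [pchar K] =i pred0.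

(** The graph of a derivation from a subring of [K] to [K]; equivalently, a subring of the dual
    numbers that meets the infinitesimals only in 0. *)
Definition der_rel (D : K -> K -> Prop) :=
  [/\ D 1 0, forall a a' b b', D a a' -> D b b' -> D (a - b) (a' - b'),
      forall a a' b b', D a a' -> D b b' -> D (a * b) (a' * b + a * b')
    & forall b, D 0 b -> b = 0].

Section Max.
Variable D : K -> K -> Prop.
Hypothesis dD : der_rel D.
Hypothesis maxD : forall D', der_rel D' -> (forall a b, D a b -> D' a b) ->
  forall a b, D' a b -> D a b.

Let D1 : D 1 0. Proof. by case: dD. Qed.
Let DB a a' b b' : D a a' -> D b b' -> D (a - b) (a' - b').
Proof. by case: dD => _ H _ _; apply: H. Qed.
Let DM a a' b b' : D a a' -> D b b' -> D (a * b) (a' * b + a * b').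
Proof. by case: dD => _ _ H _; apply: H. Qed.
Let D0 : D 0 0. Proof. by have := DB D1 D1; rewrite !subrr. Qed.
Let DN a a' : D a a' -> D (- a) (- a').
Proof. by move/(DB D0); rewrite !sub0r. Qed.
Let DD a a' b b' : D a a' -> D b b' -> D (a + b) (a' + b').
Proof. by move=> H /DN /(DB H); rewrite !opprK. Qed.
Let Df b : D 0 b -> b = 0. Proof. by case: dD => _ _ _; apply. Qed.

Let DP (P Q : {poly K}) := forall i, D P`_i Q`_i.
Let DPB P P' Q Q' : DP P P' -> DP Q Q' -> DP (P - Q) (P' - Q').
Proof. by move=> H H' i; rewrite !coefB; apply: DB. Qed.
Let DPM P P' Q Q' : DP P P' -> DP Q Q' -> DP (P * Q) (P' * Q + P * Q').
Proof.
move=> H H' i; rewrite coefD !coefM -big_split /=.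
by elim/big_rec2: _ => [//|j a b _]; apply: DD; apply: DM.
Qed.
Let DPC a a' : D a a' -> DP a%:P a'%:P.
Proof. by move=> H i; rewrite !coefC; case: ifP. Qed.
Let DPXn n : DP 'X^n 0.
Proof. by move=> i; rewrite coefXn coef0; case: eqP. Qed.
Let DP_deriv P P' : DP P P' -> DP P^`() P'^`().
Proof.
move=> H i; rewrite !coef_deriv; move: (H i.+1); move: P`_i.+1 P'`_i.+1 => a a' Ha.
by elim: i.+1 => [|n IH]; [rewrite !mulr0n|rewrite !mulrSr; apply: DD].
Qed.
Let DP0 Q : DP 0 Q -> Q = 0.
Proof. by move=> H; apply/polyP => i; have := H i; rewrite !coef0 => /Df. Qed.

(** The chain rule: the derivative forced on [P.[z]] once that of [z] is [w], with [P'] holding the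
    derivatives of the coefficients. *)
Let ev (z w : K) (P P' : {poly K}) := P'.[z] + P^`().[z] * w.

Let max_adj z w : (forall P P', DP P P' -> P.[z] = 0 -> ev z w P P' = 0) -> D z w.
Proof.
move=> H; pose D' a b := exists P P', [/\ DP P P', a = P.[z] & b = ev z w P P'].
apply: (maxD (D' := D')).
- split.
  + by exists 1, 0; rewrite /ev -[1]polyC1 derivC !hornerE; split=> //; apply: DPC.
  + move=> _ _ _ _ [P [P' [HP -> ->]]] [Q [Q' [HQ -> ->]]].
    exists (P - Q), (P' - Q'); split; [exact: DPB|by rewrite !hornerE|].
    by rewrite /ev derivB !hornerE; ring.
  + move=> _ _ _ _ [P [P' [HP -> ->]]] [Q [Q' [HQ -> ->]]].
    exists (P * Q), (P' * Q + P * Q'); split; [exact: DPM|by rewrite !hornerE|].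
    by rewrite /ev derivM !hornerE; ring.
  + by move=> b [P [P' [HP /esym P0 ->]]]; apply: H.
- move=> a b Dab; exists a%:P, b%:P; split; [exact: DPC|by rewrite hornerC|].
  by rewrite /ev derivC !hornerE.
- exists 'X, 0; split; [exact: (DPXn 1)|by rewrite hornerX|].
  by rewrite /ev derivX !hornerE.
Qed.

(** If [z] satisfies no equation over the domain, the value 0 is consistent. Otherwise an equation
    [P0] of least degree has nonzero derivative at [z] in characteristic zero, which determines [w];
    the other equations follow by division. *)
Lemma max_der_total z : exists w, D z w.
Proof.
case: (pselect (exists P P', [/\ DP P P', P.[z] = 0 & P != 0])) => [[P1 [P1' HP1]]|nP]; last first.
  exists 0; apply: max_adj => P P' HP Pz; have [P0|P0] := eqVneq P 0.
    by move: HP; rewrite P0 /ev => /DP0 ->; rewrite deriv0 !hornerE.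
  by case: nP; exists P, P'.
have [P0 [P0' [HP0 P0z P00 minP]]] : exists P0 P0', [/\ DP P0 P0', P0.[z] = 0, P0 != 0 &
    forall P P', DP P P' -> P.[z] = 0 -> P != 0 -> (size P0 <= size P)%N].
  have ex : exists n, `[< exists P P', [/\ DP P P', P.[z] = 0, P != 0 & size P = n] >].
    by exists (size P1); apply/asboolP; exists P1, P1'; case: HP1.
  case: (ex_minnP ex) => n /asboolP [P0 [P0' [H1 H2 H3 H4]]] minn.
  exists P0, P0'; split=> // P P' HP Pz Pn0.
  by rewrite H4; apply: minn; apply/asboolP; exists P, P'.
have sP0 : (1 < size P0)%N.
  rewrite ltnNge; apply/negP => s1; move: P0z P00; rewrite (size1_polyC s1) hornerC => ->.
  by rewrite eqxx.
have dP0 : P0^`().[z] != 0.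
  apply/eqP => dz; have dP0n : P0^`() != 0.
    apply/eqP => /(congr1 (fun p : {poly K} => p`_(size P0).-2)).
    rewrite coef0 coef_deriv; have -> : (size P0).-2.+1 = (size P0).-1.
      by rewrite prednK // -ltnS prednK // ltnW.
    rewrite -mulr_natr; apply/eqP; rewrite mulf_neq0 //.
      by rewrite -lead_coefE lead_coef_eq0.
    by move/pcharf0P: charK => ->; rewrite -lt0n -ltnS prednK // ltnW.
  have := minP _ _ (DP_deriv HP0) dz dP0n.
  by rewrite leqNgt lt_size_deriv.
have [w ev0] : exists w, ev z w P0 P0' = 0.
  by exists (- P0'.[z] / P0^`().[z]); rewrite /ev mulrC divfK // subrr.
exists w; apply: max_adj => P P'.
have [n] := ubnP (size P); elim: n P P' => // n IH P P' szP HP Pz.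
have [P_0|nP] := eqVneq P 0.
  by move: HP; rewrite P_0 /ev => /DP0 ->; rewrite deriv0 !hornerE.
have leP : (size P0 <= size P)%N by apply: minP Pz nP.
set p := lead_coef P; set p0 := lead_coef P0; pose s := (size P - size P0)%N.
set p' := P'`_(size P).-1; set p0' := P0'`_(size P0).-1.
have pn0 : p != 0 by rewrite lead_coef_eq0.
have p0n0 : p0 != 0 by rewrite lead_coef_eq0.
(* Pseudo-division by cross-multiplication of leading coefficients, with no inverses taken in the
   domain of [D]; [Q'] carries the derivatives of the coefficients of [Q]. *)
pose Q := p0%:P * P - p%:P * 'X^s * P0.
pose Q' := (p0'%:P * P + p0%:P * P') - ((p'%:P * 'X^s + p%:P * 0) * P0 + p%:P * 'X^s * P0').
have HQ : DP Q Q'.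
  apply: DPB; first by apply: DPM => //; apply: DPC; apply: HP0.
  apply: DPM => //; apply: DPM; last exact: DPXn.
  by apply: DPC; apply: HP.
have : ev z w Q Q' = 0.
  apply: IH HQ _; last by rewrite /Q hornerD hornerN !hornerM Pz P0z !mulr0 subr0.
  have sQ1 : size (p0%:P * P) = size P by rewrite mul_polyC size_scale.
  have sQ : size (p%:P * 'X^s * P0) = size P.
    by rewrite -mulrA mul_polyC size_scale // mulrC size_mulXn // /s subnK.
  rewrite -ltnS; apply: leq_trans szP; rewrite ltnS.
  have sPp : (0 < size P)%N by rewrite lt0n size_poly_eq0.
  rewrite -(prednK sPp) ltnS; apply/leq_sizeP => j; rewrite leq_eqVlt => /orP[/eqP <-|jP].
    rewrite coefB -{1}sQ1 -sQ -!lead_coefE !lead_coefM !lead_coefC lead_coefXn -/p -/p0.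
    by rewrite mulr1 mulrC subrr.
  by rewrite prednK // in jP; rewrite coefB !nth_default ?subrr // ?sQ1 ?sQ.
have -> : ev z w Q Q' = p0 * ev z w P P' - p * z ^+ s * ev z w P0 P0'
   + (p0' + 0) * P.[z] - (p' * z ^+ s + p * (s%:R * z ^+ s.-1) * w) * P0.[z].
  rewrite /ev /Q /Q' !(derivB, derivM, derivC, derivXn) !(hornerD, hornerN, hornerM, hornerC, hornerXn, hornerMn, mul0r, mulr0, addr0, add0r).
  rewrite -(mulr_natl (z ^+ s.-1) s); move: (z ^+ s) (z ^+ s.-1) (s%:R : K) => u u' v; ring.
rewrite ev0 Pz P0z !(mulr0, subr0, addr0) => /eqP.
by rewrite mulf_eq0 (negbTE p0n0) => /eqP.
Qed.
End Max.

Lemma derivation_extension D0 : der_rel D0 ->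
  exists d : K -> K, [/\ forall a b, d (a - b) = d a - d b,
    forall a b, d (a * b) = d a * b + a * d b & forall a b, D0 a b -> d a = b].
Proof.
move=> dD0; pose rel (S : set (K * K)) a b := S (a, b).
have [|||S [dS S0 maxS]] := @rel_zorn _ (fun S => der_rel (rel S)) [set x | D0 x.1 x.2].
- by [].
- by exists (1, 0); case: dD0.
- move=> F [S1 FS1] HF tot; split.
  + by exists S1 => //; have [] := HF _ FS1.
  + move=> a a' b b' [S FS Sab] [S' FS' Sab'].
    have [/(_ _ Sab)|/(_ _ Sab')] := tot _ _ FS FS'.
      by move=> H; exists S' => //; have [_ s _ _] := HF _ FS'; apply: s.
    by move=> H; exists S => //; have [_ s _ _] := HF _ FS; apply: s.
  + move=> a a' b b' [S FS Sab] [S' FS' Sab'].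
    have [/(_ _ Sab)|/(_ _ Sab')] := tot _ _ FS FS'.
      by move=> H; exists S' => //; have [_ _ s _] := HF _ FS'; apply: s.
    by move=> H; exists S => //; have [_ _ s _] := HF _ FS; apply: s.
  + by move=> b [S FS Sb]; have [_ _ _ f] := HF _ FS; apply: f.
have tS z : exists w, rel S z w.
  apply: (max_der_total dS) => D' dD' sub a b D'ab.
  by apply: (maxS [set x | D' x.1 x.2]) => // -[c e] /=; apply: sub.
have [d Hd] := choice tS; exists d.
have inj a b b' : rel S a b -> rel S a b' -> b = b'.
  case: dS => _ B _ f Sb Sb'; have := B _ _ _ _ Sb Sb'; rewrite subrr => /f /eqP.
  by rewrite subr_eq0 => /eqP.
case: (dS) => _ B M _; split=> a b.
- by apply: inj (Hd _) _; apply: B; apply: Hd.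
- by apply: inj (Hd _) _; apply: M; apply: Hd.
- by move=> /(S0 (a, b)) H; apply: inj (Hd _) H.
Qed.
End DerRel.

Local Close Scope classical_set_scope.

(** * Integrality over polynomial rings *)

(** The rational root argument, homogenised: after division by the gcd, [g'] divides a power of [f']
    and is coprime to it, hence is constant. *)
Lemma dvdp_integral (k : fieldType) (f g : {poly k}) D (P : nat -> {poly k}) :
  g != 0 -> f ^+ D + \sum_(i < D) P i * f ^+ i * g ^+ (D - i) = 0 -> g %| f.
Proof.
move=> g0; set d := gcdp f g; set f' := f %/ d; set g' := g %/ d.
have ef : f = f' * d by rewrite divpK // dvdp_gcdl.
have eg : g = g' * d by rewrite divpK // dvdp_gcdr.
have d0 : d != 0 by rewrite gcdp_eq0 negb_and g0 orbT.
have cop : coprimep f' g' by apply: coprimep_div_gcd; rewrite g0 orbT.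
move=> H; have {H} : f' ^+ D + \sum_(i < D) P i * f' ^+ i * g' ^+ (D - i) = 0.
  apply: (mulIf (expf_neq0 D d0)); rewrite mul0r -[RHS]H {H} mulrDl -exprMn -ef; congr (_ + _).
  rewrite mulr_suml; apply: eq_bigr => i _; rewrite [in RHS]ef [in RHS]eg.
  have -> : d ^+ D = d ^+ i * d ^+ (D - i) by rewrite -exprD subnKC // ltnW.
  by rewrite !exprMn; move: (f' ^+ i) (g' ^+ _) (d ^+ i) (d ^+ _) => a b a' b'; ring.
move/eqP; rewrite addr_eq0 => /eqP H.
have : g' %| f' ^+ D.
  rewrite H dvdpNr; elim/big_ind: _ => [|x y|i _]; [exact: dvdp0|exact: dvdp_add|].
  by rewrite dvdp_mull // dvdp_exp // subn_gt0.
have cop' : coprimep g' (f' ^+ D) by rewrite coprimep_sym coprimep_expl.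
rewrite -[f' ^+ D]mulr1 Gauss_dvdpr // dvdp1 => /size_poly1P [c c0 e].
by rewrite {1}eg e mul_polyC dvdpZl // dvdp_gcdl.
Qed.

Lemma integral_relation_morph (R S : comNzRingType) (j : {rmorphism R -> S}) (f g : R) D
    (P : nat -> R) :
  f ^+ D + \sum_(i < D) P i * f ^+ i * g ^+ (D - i) = 0 ->
  j f ^+ D + \sum_(i < D) j (P i) * j f ^+ i * j g ^+ (D - i) = 0.
Proof.
move/(congr1 j); rewrite rmorph0 => H; rewrite -[RHS]H {H} rmorphD rmorphXn rmorph_sum; congr (_ + _).
by apply: eq_bigr => i _; rewrite !rmorphM !rmorphXn.
Qed.

Section MPolyIntegrallyClosed.
Variables (K : closedFieldType) (r : nat).
Local Notation R := {mpoly K[r]}.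

(* Along a line through a point where g does not vanish, f / g is a polynomial
   in one variable; solving for its coefficients from the bottom only divides
   by the nonzero constant g.@[y0]. *)
Lemma mpoly_dvd_integral (f g : R) D (P : nat -> R) :
  g != 0 -> f ^+ D + \sum_(i < D) P i * f ^+ i * g ^+ (D - i) = 0 ->
  exists b, f = g * b.
Proof.
move=> g0 H; have [y0 gy0] := mpoly_nonroot g0.
pose h i : {poly R} := ((y0 i)%:MP)%:P + ('X_i : R)%:P * 'X.
have [th [thC thX]] : exists th : {rmorphism R -> {poly R}},
    (forall a, th a%:MP = (a%:MP)%:P) /\ (forall i, th 'X_i = h i).
  exists (mmap (polyC \o @mpolyC r K : {rmorphism _ -> _}) h).
  by split=> [a|i]; rewrite /= ?mmapC // mmapX mmap1U.
have [j [jinj jE]] : exists j : {rmorphism {poly R} -> {poly {fraction R}}},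
    injective j /\ forall p i, (j p)`_i = tofrac p`_i.
  exists (map_poly (@tofrac R)); split=> [|p i]; last by rewrite coef_map.
  by apply: map_inj_poly; [move=> x y /eqP; rewrite tofrac_eq => /eqP|exact: rmorph0].
(* At line parameter 1, [th] becomes the translation by [y0]; [sh'] undoes it, so a factorisation of
   [th f] yields one of [f]. *)
pose sh : {rmorphism R -> R} := horner_eval 1 \o th.
pose sh' : {rmorphism R -> R} := mmap (@mpolyC r K) (fun i => 'X_i - (y0 i)%:MP).
have shK p : sh' (sh p) = p.
  rewrite -[LHS]/((sh' \o sh) p) (@mmap_morph _ _ _ _ (@mpolyC r K) (fun i => 'X_i)).
  - by apply/esym; apply: (@mmap_morph _ _ _ idfun (@mpolyC r K) (fun i => 'X_i)).
  - by move=> a; rewrite /sh /= /horner_eval thC hornerC mmapC.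
  - move=> i; rewrite /sh /= /horner_eval thX /h !hornerE rmorphD /= mmapC mmapX mmap1U.
    by rewrite addrC subrK.
have th0 p : (th p)`_0 = (p.@[y0])%:MP.
  rewrite -horner_coef0 -[LHS]/((horner_eval 0 \o th) p).
  rewrite (@mmap_morph _ _ _ _ (@mpolyC r K) (fun i => (y0 i)%:MP)).
  - rewrite -[RHS]/((@mpolyC r K \o meval y0) p).
    apply/esym/(@mmap_morph _ _ _ ((@mpolyC r K \o meval y0) : {rmorphism _ -> _})) => [a|i] /=.
      by rewrite mevalC.
    by rewrite mevalXU.
  - by move=> a; rewrite /= /horner_eval thC hornerC.
  - by move=> i; rewrite /= /horner_eval thX /h !hornerE.
have thg0 : th g != 0.
  apply/eqP => e; move: (th0 g); rewrite e coef0 => /esym /eqP.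
  by rewrite mpolyC_eq0 (negbTE gy0).
have : j (th g) %| j (th f).
  apply: (@dvdp_integral _ _ _ D (fun i => j (th (P i)))); first by rewrite (raddf_eq0 _ jinj).
  have H' := integral_relation_morph th H.
  exact: (@integral_relation_morph _ _ j _ _ _ (fun i => th (P i)) H').
rewrite dvdp_eq => /eqP; set b := _ %/ _ => Hb.
have bP i : exists c, tofrac c = b`_i.
  have [n] := ubnP i; elim: n i => // n IH i lin.
  have := congr1 (fun p : {poly _} => p`_i) Hb; rewrite /= mulrC coefM jE.
  rewrite big_ord_recl /= subn0 jE th0 => e.
  have [c Hc] : exists c, tofrac c = \sum_(l < i) (j (th g))`_(bump 0 l) * b`_(i - bump 0 l).
    elim/big_rec: _ => [|l x _ [c <-]]; first by exists 0; rewrite rmorph0.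
    have [|c' <-] := IH (i - bump 0 l)%N.
      by rewrite ltnS in lin; apply: leq_trans lin; rewrite /bump /= add1n subnSK // leq_subr.
    by exists ((th g)`_(bump 0 l) * c' + c); rewrite rmorphD rmorphM jE.
  exists ((g.@[y0])^-1%:MP * ((th f)`_i - c)).
  rewrite tofracM tofracB Hc e /= addrK mulrA -tofracM -mpolyCM mulVf //.
  by rewrite rmorph1 mul1r.
have [c Hc] := choice bP; pose b' := \poly_(i < size b) c i.
have eb : b = j b'.
  apply/polyP => i; rewrite jE coef_poly; case: ltnP => [_|le]; first by rewrite Hc.
  by rewrite rmorph0 nth_default.
have {}Hb : th f = b' * th g by apply: jinj; rewrite Hb eb rmorphM.
have e : sh f = sh g * b'.[1] by rewrite /sh /= /horner_eval Hb hornerM mulrC.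
by exists (sh' b'.[1]); rewrite -[LHS]shK e rmorphM shK.
Qed.
End MPolyIntegrallyClosed.

Section MonicMinPoly.
Variables (K E : closedFieldType) (r : nat).
Local Notation R := {mpoly K[r]}.
Variable rho : {rmorphism R -> E}.
Hypothesis rho_inj : forall p, rho p = 0 -> p = 0.

Lemma integral_fraction (f g : R) :
  g != 0 -> integralOver rho (rho f / rho g) -> exists b, f = g * b.
Proof.
move=> g0 [q mq rq]; apply: (@mpoly_dvd_integral _ _ f g (size q).-1 (fun i => q`_i)) => //.
set D := (size q).-1.
have sq : size q = D.+1 by rewrite prednK // lt0n size_poly_eq0 monic_neq0.
apply: rho_inj; rewrite rmorphD rmorphXn rmorph_sum.
have rg0 : rho g != 0 by apply: contra_neq g0; apply: rho_inj.
have H : (map_poly rho q).[rho f / rho g] * rho g ^+ D = 0.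
  by rewrite (rootP rq) mul0r.
apply: etrans _ H; rewrite horner_coef size_map_poly_id0; last first.
  by rewrite (monicP mq) rmorph1 oner_neq0.
rewrite sq big_ord_recr mulrDl addrC; congr (_ + _).
  rewrite mulr_suml; apply: eq_bigr => i _; rewrite !rmorphM !rmorphXn /= coef_map expr_div_n.
  have -> : rho g ^+ D = rho g ^+ i * rho g ^+ (D - i) by rewrite -exprD subnKC // ltnW.
  by rewrite -!mulrA mulKf // expf_neq0.
have lq : q`_D = 1 by rewrite -lead_coefE (monicP mq).
rewrite /= coef_map lq [X in X * _ * _](rmorph1 rho) mul1r expr_div_n divfK //.
by rewrite expf_neq0.
Qed.

Lemma integral_coef_prod (s : seq E) :
  {in s, forall z, integralOver rho z} ->
  forall i, integralOver rho (\prod_(z <- s) ('X - z%:P))`_i.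
Proof.
elim: s => [_ i|z s IH Hs i].
  by rewrite big_nil coef1; case: eqP => _; [exact: integral1|exact: integral0].
rewrite big_cons mulrBl coefB coefXM mul_polyC coefZ.
have {}IH := IH (fun w ws => Hs w (mem_behead (s := z :: s) ws)).
apply: integral_sub; first by case: eqP => _; [exact: integral0|exact: IH].
by apply: integral_mul; [apply: Hs; rewrite mem_head|exact: IH].
Qed.

(** Up to scaling, a relation [p0] of least degree divides the monic relation [P], so its roots in
    [E] are integral, and so are its coefficients divided by the leading one. These are fractions,
    hence polynomials by [integral_fraction]. *)
Lemma monic_minpoly u : integralOver rho u ->
  exists mu : {poly R}, [/\ mu \is monic, root (map_poly rho mu) u &
    forall p : {poly R}, p != 0 -> root (map_poly rho p) u -> (size mu <= size p)%N].
Proof.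
move=> [P mP rP].
have [p0 [p0n0 rp0 minp]] : exists p0 : {poly R}, [/\ p0 != 0, root (map_poly rho p0) u &
    forall p : {poly R}, p != 0 -> root (map_poly rho p) u -> (size p0 <= size p)%N].
  have ex : exists n, `[< exists p : {poly R}, [/\ p != 0, root (map_poly rho p) u & size p = n] >].
    by exists (size P); apply/asboolP; exists P; rewrite monic_neq0.
  case: (ex_minnP ex) => n /asboolP [p0 [H1 H2 H3]] minn.
  by exists p0; split=> // p Hp rp; rewrite H3; apply: minn; apply/asboolP; exists p.
set g := lead_coef p0; have g0 : g != 0 by rewrite lead_coef_eq0.
have rg0 : rho g != 0 by apply: contra_neq g0; apply: rho_inj.
have mod0 : P %% p0 = 0.
  apply/eqP; apply: contraT => m0.
  have : (size (P %% p0)%R < size p0)%N by rewrite Pdiv.Idomain.ltn_modp.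
  rewrite ltnNge minp //; have := congr1 (fun q => (map_poly rho q).[u]) (Pdiv.Idomain.divp_eq P p0).
  rewrite /= rmorphD rmorphM map_polyZ hornerZ hornerD hornerM (rootP rP) (rootP rp0).
  by rewrite !mulr0 add0r => /esym; rewrite rootE => ->.
have [s Hs] := closed_field_poly_normal (map_poly rho p0).
have lp0 : lead_coef (map_poly rho p0) = rho g.
  by rewrite lead_coef_map_eq.
have ints : {in s, forall z, integralOver rho z}.
  move=> z zs; exists P => //.
  have rz : (map_poly rho p0).[z] = 0.
    rewrite Hs hornerZ horner_prod (big_rem z) //= hornerXsubC subrr.
    by rewrite mul0r mulr0.
  have := congr1 (fun q => (map_poly rho q).[z]) (Pdiv.Idomain.divp_eq P p0).
  rewrite /= mod0 addr0 rmorphM map_polyZ hornerZ hornerM rz mulr0 => /eqP.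
  by rewrite mulf_eq0 rmorphXn expf_eq0 (negbTE rg0) andbF orFb.
have bP i : exists b, p0`_i = g * b.
  apply: integral_fraction => //.
  have -> : rho p0`_i / rho g = (\prod_(z <- s) ('X - z%:P))`_i.
    by rewrite -coef_map Hs lp0 coefZ mulrC mulKf.
  exact: integral_coef_prod.
have [b Hb] := choice bP; pose mu := \poly_(i < size p0) b i.
have e : p0 = g%:P * mu.
  apply/polyP => i; rewrite coefCM coef_poly; case: ltnP => [_|le]; first exact: Hb.
  by rewrite mulr0 nth_default.
have szm : size mu = size p0.
  by rewrite e mul_polyC size_scale.
exists mu; split=> [||p]; last by rewrite szm; apply: minp.
  apply/monicP/(mulfI g0); rewrite mulr1 -[in RHS]/g /g [in RHS]e lead_coefM lead_coefC.
  by rewrite -/g.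
move: rp0; rewrite e mul_polyC map_polyZ /= !rootE hornerZ mulf_eq0.
by rewrite (negbTE rg0) orFb.
Qed.
End MonicMinPoly.

Section IntegralPoly.
Variables (R S : comNzRingType) (rho : {rmorphism R -> S}).
Definition integral_coefs (q : {poly S}) := forall i, integralOver rho q`_i.

Lemma integral_sum (I : Type) (s : seq I) (P : pred I) (f : I -> S) :
  (forall i, P i -> integralOver rho (f i)) -> integralOver rho (\sum_(i <- s | P i) f i).
Proof.
by move=> H; elim/big_rec: _ => [|i x Pi]; [exact: integral0|apply: integral_add; exact: H].
Qed.
Lemma integral_coefsD p q : integral_coefs p -> integral_coefs q -> integral_coefs (p + q).
Proof. by move=> Hp Hq i; rewrite coefD; apply: integral_add. Qed.
Lemma integral_coefsM p q : integral_coefs p -> integral_coefs q -> integral_coefs (p * q).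
Proof. by move=> Hp Hq i; rewrite coefM; apply: integral_sum => j _; apply: integral_mul. Qed.
Lemma integral_coefsC a : integralOver rho a -> integral_coefs a%:P.
Proof. by move=> Ha i; rewrite coefC; case: eqP => _ //; exact: integral0. Qed.
Lemma integral_coefsX : integral_coefs 'X.
Proof. by move=> i; rewrite coefX; exact: integral_nat. Qed.
Lemma integral_coefs_exp p n : integral_coefs p -> integral_coefs (p ^+ n).
Proof.
move=> Hp; elim: n => [|n IH]; last by rewrite exprS; apply: integral_coefsM.
by apply: integral_coefsC; exact: integral1.
Qed.
End IntegralPoly.

Section TopCoef.
Variable S : comNzRingType.
(** [d] only bounds the degree and [c] may be 0, which makes the notion stable under products
    without case distinctions. *)
Definition top_coef d (c : S) (q : {poly S}) := (size q <= d.+1)%N /\ q`_d = c.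

Lemma top_coefM d e c c' p q : top_coef d c p -> top_coef e c' q ->
  top_coef (d + e) (c * c') (p * q).
Proof.
move=> [sp <-] [sq <-]; split.
  apply: leq_trans (size_polyMleq _ _) _; rewrite -ltnS.
  case: (size p + size q)%N (leq_add sp sq) => [|n] //=.
  by rewrite addSn addnS.
have lt : (d < (d + e).+1)%N by rewrite ltnS leq_addr.
rewrite coefM (bigD1 (Ordinal lt)) //= addKn big1 ?addr0 // => j.
rewrite -val_eqE /= neq_ltn => /orP[jd|dj].
  rewrite [q`_ _]nth_default ?mulr0 //; apply: leq_trans sq _.
  by rewrite ltn_subRL ltn_add2r.
by rewrite nth_default ?mul0r //; apply: leq_trans sp dj.
Qed.

Lemma top_coef_exp d c p n : top_coef d c p -> top_coef (d * n) (c ^+ n) (p ^+ n).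
Proof.
move=> H; elim: n => [|n IH]; last by rewrite exprS exprS mulnS; apply: top_coefM.
by rewrite muln0 !expr0; split; rewrite ?size_poly1 ?coef1.
Qed.

Lemma top_coef_lin a b : top_coef 1 b (a%:P + b%:P * 'X).
Proof.
split; last by rewrite coefD coefC coefMX coefC /= add0r.
apply: leq_trans (size_polyD _ _) _; rewrite geq_max (leq_trans (size_polyC_leq1 _)) //=.
apply: leq_trans (size_polyMleq _ _) _; rewrite size_polyX addn2 /= ltnS.
exact: size_polyC_leq1.
Qed.

Lemma top_coef_mnm n (a b : 'I_n -> S) (m : 'X_{1..n}) :
  top_coef (mdeg m) (\prod_i b i ^+ m i) (\prod_i ((a i)%:P + (b i)%:P * 'X) ^+ m i).
Proof.
rewrite mdegE; elim/big_rec3: _ => [|i d q c _ H]; first by split; rewrite ?size_poly1 ?coef1.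
by apply: top_coefM => //; have := top_coef_exp (m i) (top_coef_lin (a i) (b i)); rewrite mul1n.
Qed.
End TopCoef.

(** * Noether normalisation by linear changes of variables *)

Section Noether.
Variables (K E : closedFieldType) (iota : {rmorphism K -> E}).

(** Along a direction off the zeros of its top form, [p] keeps its full degree; as that form is
    homogeneous, the direction may be scaled to have a coordinate 1. *)
Lemma top_form_nonroot n (p : {mpoly K[n]}) : (1 < msize p)%N ->
  exists (b : 'I_n -> K) t, b t = 1 /\
    \sum_(m <- msupp p | mdeg m == (msize p).-1) p@_m * \prod_i b i ^+ m i != 0.
Proof.
move=> sp; set D := (msize p).-1.
have p0 : p != 0 by rewrite -msize_poly_eq0 -lt0n ltnW.
have D0 : (0 < D)%N by rewrite -ltnS prednK // ltnW.
pose q := \sum_(m <- msupp p | mdeg m == D) p@_m *: 'X_[m].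
have dl : mdeg (mlead p) == D by rewrite /D -mlead_deg.
have q0 : q != 0.
  apply/eqP => /(congr1 (mcoeff (mlead p))); rewrite mcoeff0 raddf_sum /=.
  rewrite big_mkcond (bigD1_seq (mlead p)) ?msupp_uniq ?mlead_supp //= dl.
  rewrite mcoeffZ mcoeffX eqxx mulr1 big1 ?addr0; last first.
    by move=> m ml; case: ifP => // _; rewrite mcoeffZ mcoeffX (negbTE ml) mulr0.
  by apply/eqP; rewrite mleadc_eq0.
have [c qc] := mpoly_nonroot q0.
have qE b : q.@[b] = \sum_(m <- msupp p | mdeg m == D) p@_m * \prod_i b i ^+ m i.
  by rewrite /q raddf_sum /=; apply: eq_bigr => m _; rewrite mevalZ mevalX.
have [t ct] : exists t, c t != 0.
  apply: contrapT => H; move/eqP: qc; apply; rewrite qE big1 // => m /eqP dm.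
  have [i mi] : exists i, m i != 0%N.
    apply: contrapT => H'; move: D0; rewrite -dm mdegE big1 // => i _.
    by apply/eqP; apply: contrapT => mi; apply: H'; exists i; apply/negP.
  rewrite (bigD1 i) //= (_ : c i = 0) ?expr0n ?(negbTE mi) ?mul0r ?mulr0 //.
  by apply/eqP; apply: contrapT => ci; apply: H; exists i; apply/negP.
exists (fun i => c i / c t), t; split; first by rewrite divff.
have e : \sum_(m <- msupp p | mdeg m == D) p@_m * \prod_i (c i / c t) ^+ m i
    = q.@[c] * (c t) ^- D.
  rewrite qE mulr_suml; apply: eq_bigr => m /eqP <-; rewrite -mulrA; congr (_ * _).
  rewrite mdegE expr_sum -prodfV -big_split /=; apply: eq_bigr => i _.
  by rewrite expr_div_n.
by rewrite e mulf_neq0 // invr_eq0 expf_neq0.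
Qed.

(** A relation among the [s j] becomes monic in [s t] after a linear change of variables, and
    induction treats the remaining differences. The [y i] stay linear in [s] so that they specialise
    to 0 whenever [s] does. *)
Lemma noether_normalization M (s : 'I_M -> E) :
  exists r (y : 'I_r -> E) (L : 'I_r -> 'I_M -> K),
    [/\ alg_indep iota y, forall i, y i = \sum_j iota (L i j) * s j
      & forall j, integralOver (mmap iota y) (s j)].
Proof.
elim: M s => [|M IH] s; case: (pselect (alg_indep iota s)) => [ai|nai].
- exists 0%N, s, (fun _ _ => 0); split=> //; by case.
- case: nai => p; rewrite (nvar0_mpolyC p) mmapC => /eqP.
  by rewrite fmorph_eq0 => /eqP ->; rewrite mpolyC0.
- exists M.+1, s, (fun i j => (i == j)%:R); split=> // [i|j].
    rewrite (bigD1 i) //= eqxx rmorph1 mul1r big1 ?addr0 // => j /negbTE.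
    by rewrite eq_sym => ->; rewrite rmorph0 mul0r.
  have {1}<- : mmap iota s 'X_j = s j by rewrite mmapX mmap1U.
  exact: integral_id.
have [p [sp0 p0]] : exists p : {mpoly K[M.+1]}, mmap iota s p = 0 /\ p != 0.
  apply: contrapT => H; apply: nai => p sp; apply: contrapT => /eqP p0.
  by apply: H; exists p.
have sp : (1 < msize p)%N.
  rewrite ltnNge; apply/negP => /msize1_polyC e; move: sp0 p0; rewrite e mmapC => /eqP.
  by rewrite fmorph_eq0 => /eqP ->; rewrite mpolyC0 eqxx.
have [b [t [bt topb]]] := top_form_nonroot sp.
have [r [y [L [ai yL inty]]]] := IH (fun i => s (lift t i) - iota (b (lift t i)) * s t).
pose rho : {rmorphism {mpoly K[r]} -> E} := mmap iota y.
have intC a : integralOver rho (iota a).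
  by have <- : rho a%:MP = iota a; [exact: mmapC|exact: integral_id].
have ints' j : integralOver rho (s j - iota (b j) * s t).
  case: (unliftP t j) => [i ->|->]; first exact: inty.
  by rewrite bt rmorph1 mul1r subrr; exact: integral0.
set D := (msize p).-1 in topb; set c := \sum_(m <- _ | _) _ in topb.
(* Replacing [s t] by ['X] with the differences held fixed turns the relation [p] into a polynomial
   [P] with root [s t], integral coefficients and a constant top coefficient. *)
pose f j := (s j - iota (b j) * s t)%:P + (iota (b j))%:P * 'X.
pose P := \sum_(m <- msupp p) (iota p@_m)%:P * \prod_j f j ^+ m j.
have intP : integral_coefs rho P.
  rewrite /P; elim/big_rec: _ => [|m q _]; first by move=> i; rewrite coef0; exact: integral0.
  apply: integral_coefsD; apply: integral_coefsM; first exact/integral_coefsC/intC.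
  elim/big_rec: _ => [|j q' _]; first exact/integral_coefsC/integral1.
  apply: integral_coefsM; apply: integral_coefs_exp; apply: integral_coefsD.
    exact/integral_coefsC/ints'.
  by apply: integral_coefsM; [exact/integral_coefsC/intC|exact: integral_coefsX].
have [szP topP] : top_coef D (iota c) P.
  split.
    rewrite /P big_seq; elim/big_rec: _ => [|m q mp Hq]; first by rewrite size_poly0.
    apply: leq_trans (size_polyD _ _) _; rewrite geq_max Hq andbT mul_polyC.
    apply: leq_trans (size_scale_leq _ _) _.
    have [+ _] := top_coef_mnm (fun j => s j - iota (b j) * s t) (fun j => iota (b j)) m.
    move/leq_trans; apply; rewrite /D prednK ?(ltnW sp) //; exact: msize_mdeg_lt.
  rewrite coef_sum /c rmorph_sum /= [RHS]big_mkcond /=; apply: eq_big_seq => m mp.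
  have [sm tm] := top_coef_mnm (fun j => s j - iota (b j) * s t) (fun j => iota (b j)) m.
  rewrite coefCM; case: eqP => [<-|/eqP mD].
    rewrite tm rmorphM rmorph_prod; congr (_ * _); apply: eq_bigr => j _.
    by rewrite rmorphXn.
  rewrite nth_default ?mulr0 //; apply: leq_trans sm _.
  have := msize_mdeg_lt mp; rewrite -(prednK (ltnW sp)) ltnS leq_eqVlt.
  by rewrite (negbTE mD).
have Pst : P.[s t] = 0.
  rewrite /P horner_sum -[RHS]sp0 /mmap; apply: eq_bigr => m _.
  rewrite hornerM hornerC; congr (_ * _); rewrite horner_prod /mmap1; apply: eq_bigr => j _.
  by rewrite horner_exp /f !hornerE subrK.
have c0 : iota c != 0 by rewrite fmorph_eq0.
have int_t : integralOver rho (s t).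
  have sP : size P = D.+1.
    apply/eqP; rewrite eqn_leq szP ltnNge; apply/negP => sP.
    by move: c0; rewrite -topP nth_default // eqxx.
  apply: (@integral_root_monic _ _ rho (s t) ((iota c)^-1 *: P)).
  - by rewrite monicE lead_coefZ lead_coefE sP topP mulVf.
  - by rewrite rootE hornerZ Pst mulr0.
  - apply/integral_poly => i; rewrite coefZ -fmorphV.
    by apply: integral_mul; [exact: intC|exact: intP].
have ints j : integralOver rho (s j).
  rewrite -[s j](subrK (iota (b j) * s t)); apply: integral_add; first exact: ints'.
  by apply: integral_mul; [exact: intC|].
exists r, y, (fun i j => if unlift t j is Some j' then L i j' else
   - \sum_j' L i j' * b (lift t j')); split=> // i.
rewrite yL (bigD1_ord t) //= unlift_none.
under [X in _ = _ + X]eq_bigr => j _ do rewrite liftK.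
under eq_bigr => j _ do rewrite mulrBr.
rewrite sumrB addrC rmorphN rmorph_sum mulNr mulr_suml; congr (- _ + _).
by apply: eq_bigr => j _; rewrite rmorphM mulrA.
Qed.
End Noether.

(** * Expansion of algebraic points at a place *)

Section FiniteModule.
Variables (R : comNzRingType) (S : fieldType) (rho : {rmorphism R -> S}).

(** The span over [R] of the entries of [b] is stable under [z]; [W] records the multiplication on
    these generators. *)
Definition mx_acts n (b : 'rV[S]_n) (z : S) :=
  exists W : 'M[R]_n, b *m map_mx rho W = z *: b.

Lemma mx_acts_const n (b : 'rV[S]_n) a : mx_acts b (rho a).
Proof. by exists a%:M; rewrite map_scalar_mx mul_mx_scalar. Qed.
Lemma mx_actsB n (b : 'rV[S]_n) z z' : mx_acts b z -> mx_acts b z' -> mx_acts b (z - z').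
Proof.
by move=> [W HW] [W' HW']; exists (W - W'); rewrite map_mxB mulmxBr HW HW' scalerBl.
Qed.
Lemma mx_actsM n (b : 'rV[S]_n) z z' : mx_acts b z -> mx_acts b z' -> mx_acts b (z * z').
Proof.
move=> [W HW] [W' HW']; exists (W *m W'); rewrite map_mxM mulmxA HW -scalemxAl HW'.
by rewrite scalerA.
Qed.

(** Cayley-Hamilton. The degree [n] is common to all [z], which later bounds the denominators of
    valuations. *)
Lemma mx_acts_root n (b : 'rV[S]_n) z : b != 0 -> mx_acts b z ->
  exists2 p : {poly R}, p \is monic /\ size p = n.+1 & root (map_poly rho p) z.
Proof.
move=> b0 [W HW]; exists (char_poly W); first by rewrite char_poly_monic size_char_poly.
by rewrite map_char_poly -eigenvalue_root_char; apply/eigenvalueP; exists b.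
Qed.

(** Finitely many integral elements generate a finite module: each new [z] replaces [b] by its
    products with the powers of [z] below the degree of an equation. *)
Lemma integral_module (s : seq S) : {in s, forall z, integralOver rho z} ->
  exists n (b : 'rV[S]_n), b != 0 /\ {in s, forall z, mx_acts b z}.
Proof.
elim: s => [|z s IH] Hs.
  exists 1%N, (const_mx 1); split=> //.
  by apply/eqP => /matrixP /(_ ord0 ord0); rewrite !mxE => /eqP; rewrite oner_eq0.
have [|n [b [b0 Hb]]] := IH; first by move=> w ws; apply: Hs; rewrite inE ws orbT.
have [P mP rP] := Hs z (mem_head z s).
pose d := (size P).-1.
have sP : size P = d.+1 by rewrite prednK // lt0n size_poly_eq0 monic_neq0.
have d0 : (0 < d)%N.
  rewrite lt0n; apply/eqP => e; move: (mP) rP; rewrite monicE lead_coefE -/d e.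
  rewrite (@size1_polyC _ P) ?sP ?e // coefC /= => /eqP ->.
  by rewrite polyC1 rmorph1 rootE hornerC oner_eq0.
pose t : 'rV[S]_d := \row_i z ^+ i.
(* The companion matrix of [P], which is multiplication by [z] on its powers. *)
pose C : 'M[R]_d := \matrix_(i, j) if j.+1 == d then - P`_i else (i == j.+1 :> nat)%:R.
have Ct : t *m map_mx rho C = z *: t.
  apply/rowP => j; rewrite !mxE -exprS; case: (eqVneq j.+1 d) => [jd|jd].
    have : (map_poly rho P).[z] = 0 by apply/rootP.
    rewrite (@horner_coef_wide _ d.+1); last by rewrite -sP size_poly.
    rewrite big_ord_recr /= coef_map -{2}[d]/(size P).-1 -lead_coefE (monicP mP).
    rewrite /= rmorph1 mul1r => /eqP; rewrite addrC addr_eq0 => /eqP e.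
    rewrite jd e -sumrN; apply: eq_bigr => i _.
    by rewrite !mxE jd eqxx rmorphN coef_map /= mulrN mulrC.
  have lt : (j.+1 < d)%N by rewrite ltn_neqAle jd ltn_ord.
  rewrite (bigD1 (Ordinal lt)) //= !mxE (negbTE jd) eqxx rmorph1 mulr1 big1 ?addr0 // => i.
  by rewrite -val_eqE /= !mxE (negbTE jd) => /negbTE ->; rewrite rmorph0 mulr0.
(* All products of an entry of [t] and an entry of [b], flattened; [z] acts on the first index, the
   earlier elements on the second. *)
exists (d * n)%N, (mxvec (t^T *m b)); split.
  rewrite mxvec_eq0; apply: contraNneq b0 => /matrixP H; apply/eqP/rowP => j.
  have := H (Ordinal d0) j; rewrite !mxE big_ord1 !mxE expr0 mul1r; exact.
move=> w; rewrite inE => /predU1P[->|ws].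
  exists (lin_mx (mulmx C^T)).
  rewrite (@map_lin_mx _ _ rho _ _ _ _ _ (mulmx (map_mx rho C)^T)); last first.
    by move=> A; rewrite map_mxM map_trmx.
  by rewrite mul_vec_lin /= mulmxA -trmx_mul Ct linearZ /= -scalemxAl linearZ.
have [W HW] := Hb w ws; exists (lin_mx (mulmxr W)).
rewrite (@map_lin_mx _ _ rho _ _ _ _ _ (mulmxr (map_mx rho W))); last first.
  by move=> A; rewrite /= map_mxM.
by rewrite mul_vec_lin /= -mulmxA HW -scalemxAr linearZ.
Qed.
End FiniteModule.

Section PlaceTheory.
Variables (Om : fieldType) (K : closedFieldType) (G : Om -> K -> Prop).
Hypothesis pG : place G.

Lemma place_srel : subring_rel G. Proof. by case: pG. Qed.
Lemma place_fun : rel_functional G. Proof. by case: pG. Qed.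
Let sG := place_srel.

(** The valuation ring of the place; [punit] is its group of units. *)
Definition pfin z := exists w, G z w.
Definition punit z := exists2 a, a != 0 & G z a.

Lemma place_inj a b b' : G a b -> G a b' -> b = b'.
Proof. by apply: srel_inj => //; apply: place_fun. Qed.

Lemma punit_fin z : punit z -> pfin z. Proof. by case=> a _ H; exists a. Qed.
Lemma punit1 : punit 1. Proof. by exists 1; [exact: oner_neq0|exact: srel1]. Qed.
Lemma punitM x y : punit x -> punit y -> punit (x * y).
Proof. by move=> [a a0 Ha] [b b0 Hb]; exists (a * b); [rewrite mulf_neq0|apply: srelM]. Qed.
Lemma punit_neq0 x : punit x -> x != 0.
Proof.
move=> [a a0 Ha]; apply: contra_neq a0 => x0; move: Ha; rewrite x0; exact: place_fun.
Qed.
Lemma pfin_or z : pfin z \/ G z^-1 0. Proof. by case: pG => _ _; apply. Qed.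
Lemma punitV x : punit x -> punit x^-1.
Proof.
move=> ux; have x0 := punit_neq0 ux; case: ux => a a0 Ha.
have [[b Hb]|] := pfin_or x^-1.
  have := srelM sG Ha Hb; rewrite divff // => H1.
  have e : 1 = a * b by apply: place_inj H1; exact: srel1.
  by exists b => //; apply/eqP => b0; move/eqP: e; rewrite b0 mulr0 oner_eq0.
by rewrite invrK => H; move: a0; rewrite (place_inj Ha H) eqxx.
Qed.
Lemma punitX x n : punit x -> punit (x ^+ n).
Proof. by move=> H; elim: n => [|n IH]; [exact: punit1|rewrite exprS; exact: punitM]. Qed.
Lemma pfinM x y : pfin x -> pfin y -> pfin (x * y).
Proof. by move=> [a Ha] [b Hb]; exists (a * b); apply: srelM. Qed.
Lemma pfinD x y : pfin x -> pfin y -> pfin (x + y).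
Proof. by move=> [a Ha] [b Hb]; exists (a + b); apply: srelD. Qed.
Lemma pfinB x y : pfin x -> pfin y -> pfin (x - y).
Proof. by move=> [a Ha] [b Hb]; exists (a - b); apply: srelB. Qed.
Lemma pfinX x n : pfin x -> pfin (x ^+ n).
Proof. by move=> [a Ha]; exists (a ^+ n); apply: srelX. Qed.
Lemma G0_mul x y : G x 0 -> pfin y -> G (x * y) 0.
Proof. by move=> Hx [b Hb]; rewrite -(mul0r b); apply: srelM. Qed.
Lemma not_G0_unit x : punit x -> ~ G x 0.
Proof. by move=> [a a0 Ha] H; move: a0; rewrite (place_inj Ha H) eqxx. Qed.
Lemma pfin_cases x : pfin x -> punit x \/ G x 0.
Proof.
by move=> [a Ha]; have [a0|a0] := eqVneq a 0; [right; rewrite -a0|left; exists a].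
Qed.

Lemma pfin_exp z e : (0 < e)%N -> pfin (z ^+ e) -> pfin z.
Proof.
move=> e0 Hz; have [//|H] := pfin_or z; have [z0|z0] := eqVneq z 0.
  by rewrite z0; exists 0; apply: srel0.
have := srelX sG e H; rewrite expr0n eqn0Ngt e0 => He.
by have := G0_mul He Hz; rewrite -exprMn mulVf // expr1n => /(not_G0_unit punit1).
Qed.

(** Divisibility over a valuation ring is a total preorder, so a finite set has an element of least
    valuation. *)
Lemma place_max (s : seq Om) : s != [::] -> {in s, forall z, z != 0} ->
  exists2 y, y \in s & {in s, forall x, pfin (x / y)}.
Proof.
elim: s => // z s IH _ Hs; have z0 := Hs z (mem_head z s).
have [s0|s0] := eqVneq s [::].
  exists z; first exact: mem_head.
  by move=> x; rewrite s0 inE => /eqP ->; rewrite divff //; apply/punit_fin/punit1.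
have [|y ys Hy] := IH s0; first by move=> w ws; apply: Hs; rewrite inE ws orbT.
have y0 : y != 0 by apply: Hs; rewrite inE ys orbT.
have [fzy|H] := pfin_or (z / y).
  exists y; first by rewrite inE ys orbT.
  by move=> x; rewrite inE => /predU1P[->|xs] //; apply: Hy.
have fyz : pfin (y / z) by exists 0; rewrite -[y / z]invrK invf_div.
exists z; first exact: mem_head.
move=> x; rewrite inE => /predU1P[->|xs]; first by rewrite divff //; apply/punit_fin/punit1.
by have := pfinM (Hy x xs) fyz; rewrite mulrA divfK.
Qed.

(** Valuation rings are integrally closed: if [z^-1] had residue 0, the equation divided by the top
    power of [z] would give 0 the residue 1. *)
Lemma pfin_integral z (P : {poly Om}) : P \is monic -> root P z ->
  (forall i, pfin P`_i) -> pfin z.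
Proof.
move=> mP rP fP; have [//|H] := pfin_or z; have [z0|z0] := eqVneq z 0.
  by rewrite z0; exists 0; apply: srel0.
pose d := (size P).-1.
have sP : size P = d.+1 by rewrite prednK // lt0n size_poly_eq0 monic_neq0.
have e : z^-1 ^+ d * P.[z] = 0 by rewrite (rootP rP) mulr0.
have : G (z^-1 ^+ d * P.[z]) 1.
  rewrite horner_coef sP big_ord_recr /= mulrDr addrC -[X in G _ X]addr0; apply: srelD => //.
    rewrite -/d -{2}[d]/(size P).-1 -lead_coefE (monicP mP) mul1r -exprMn mulVf // expr1n.
    exact: srel1.
  rewrite mulr_sumr; elim/big_rec: _ => [|i x _ Hx]; first exact: srel0.
  rewrite -[X in G _ X]addr0; apply: srelD => //.
  have -> : z^-1 ^+ d * (P`_i * z ^+ i) = z^-1 ^+ (d - i) * P`_i.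
    have -> : z^-1 ^+ d = z^-1 ^+ (d - i) * z^-1 ^+ i by rewrite -exprD subnK // ltnW.
    by rewrite -!mulrA [P`_i * _]mulrC [z^-1 ^+ i]exprVn mulKf // expf_neq0.
  apply: G0_mul; last exact: fP.
  by have := srelX sG (d - i) H; rewrite expr0n subn_eq0 leqNgt ltn_ord.
by rewrite e => /(place_fun) /eqP; rewrite oner_eq0.
Qed.
End PlaceTheory.

(** * Valuations of elements algebraic over the rational functions in [eps] *)

Section DiscretePlace.
Variables (Om : fieldType) (K : closedFieldType) (G : Om -> K -> Prop).
Hypothesis pG : place G.
Variables (iota : {rmorphism K -> Om}) (eps : Om).
Hypothesis Giota : forall a, G (iota a) a.
Hypotheses (eps0 : eps != 0) (Geps : G eps 0).
Let sG := place_srel pG.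
Notation fin := (pfin G).
Notation unit := (punit G).

Definition evp (p : {poly K}) : Om := (map_poly iota p).[eps].
Lemma evp_zmod : zmod_morphism evp.
Proof. by move=> p q; rewrite /evp rmorphB hornerD hornerN. Qed.
Lemma evp_monoid : monoid_morphism evp.
Proof. by split=> [|p q]; rewrite /evp ?rmorph1 ?hornerC // rmorphM hornerM. Qed.
HB.instance Definition _ := GRing.isZmodMorphism.Build {poly K} Om evp evp_zmod.
HB.instance Definition _ := GRing.isMonoidMorphism.Build {poly K} Om evp evp_monoid.

Lemma evpC a : evp a%:P = iota a.
Proof. by rewrite /evp map_polyC hornerC. Qed.
Lemma evpX : evp 'X = eps.
Proof. by rewrite /evp map_polyX hornerX. Qed.

Lemma G_evp p : G (evp p) p`_0.
Proof.
rewrite -horner_coef0 /evp; apply: poly_rel_horner => // i.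
by rewrite coef_map; exact: Giota.
Qed.

Lemma evp_val p : p != 0 -> exists s : nat, unit (evp p / eps ^+ s).
Proof.
move=> p0; have [m [q]] := multiplicity_XsubC p 0; rewrite p0 /= => q0 e.
exists m; rewrite e polyC0 subr0 rmorphM rmorphXn /= evpX mulfK ?expf_neq0 //.
by exists q`_0; [rewrite -horner_coef0|exact: G_evp].
Qed.

Lemma evp_neq0 p : p != 0 -> evp p != 0.
Proof.
by move=> /evp_val [s /(punit_neq0 pG)]; rewrite mulf_eq0 negb_or => /andP[].
Qed.

Lemma unit_evp_ratio p q : p != 0 -> q != 0 ->
  exists l : int, unit (evp p / evp q * eps ^ l).
Proof.
move=> p0 q0; have [s Hs] := evp_val p0; have [t Ht] := evp_val q0.
exists (t%:Z - s%:Z); have := punitM pG Hs (punitV pG Ht).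
rewrite expfzDr // invf_div mulrACA -mulrA -!exprnP -exprnN.
by rewrite [eps ^- s * _]mulrC [X in _ * X]mulrC mulrA mulrC mulrACA; congr unit; ring.
Qed.

(** Newton polygon: a vanishing sum cannot have a single term of least valuation. Two terms [t i]
    and [t j] of equal valuation show that [z ^+ (i - j)] has the valuation of a power of [eps]. *)
Lemma root_val (p : {poly {poly K}}) n z : p \is monic -> size p = n.+1 ->
  root (map_poly evp p) z -> z != 0 ->
  exists (j : nat) (l : int), [/\ (0 < j)%N, (j <= n)%N & unit (z ^+ j * eps ^ l)].
Proof.
move=> mp sp rp z0; pose t i := evp p`_i * z ^+ i.
pose I := [seq i <- seq.iota 0 n.+1 | p`_i != 0].
have t0 i : p`_i != 0 -> t i != 0 by move=> pi; rewrite mulf_neq0 ?evp_neq0 ?expf_neq0.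
have pn : p`_n != 0.
  by have := monic_neq0 mp; rewrite -lead_coef_eq0 lead_coefE sp.
have nI : n \in I by rewrite mem_filter pn mem_iota ltnSn.
have [||y ys Hy] := @place_max _ _ _ pG [seq t i | i <- I].
- by case: (I) nI.
- by move=> _ /mapP[i + ->]; rewrite mem_filter => /andP[+ _]; apply: t0.
have /mapP[j jI ey] := ys.
have [pj jn] : p`_j != 0 /\ (j <= n)%N by move: jI; rewrite mem_filter mem_iota ltnS => /andP[].
have sum0 : \sum_(i < n.+1) t i / t j = 0.
  rewrite -mulr_suml; suff -> : \sum_(i < n.+1) t i = 0 by rewrite mul0r.
  apply: etrans (rootP rp); rewrite (@horner_coef_wide _ n.+1) -?sp ?size_poly //; apply: eq_bigr => i _.
  by rewrite coef_map.
have finr i : (i <= n)%N -> fin (t i / t j).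
  move=> ilen; have [pi|pi] := eqVneq p`_i 0.
    by rewrite /t pi rmorph0 !mul0r; exists 0; apply: srel0.
  rewrite -ey; apply: Hy; apply/mapP; exists i => //.
  by rewrite mem_filter pi mem_iota ltnS.
have [i [ilen ij ui]] : exists i, [/\ (i <= n)%N, i != j & unit (t i / t j)].
  apply: contrapT => H.
  have : G (\sum_(i < n.+1) t i / t j) 1.
    have jn' : (j < n.+1)%N by [].
    rewrite (bigD1 (Ordinal jn')) //= divff ?t0 // -[X in G _ X]addr0; apply: srelD => //.
      exact: srel1.
    elim/big_rec: _ => [|i x ij Hx]; first exact: srel0.
    rewrite -[X in G _ X]addr0; apply: srelD => //; have ilen : (i <= n)%N by rewrite -ltnS.
    case: (pfin_cases (finr i ilen)) => // ui; case: H; exists i; split=> //.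
  by rewrite sum0 => /(place_fun pG) /eqP; rewrite oner_eq0.
have pi : p`_i != 0.
  by apply/eqP => pi; have := punit_neq0 pG ui; rewrite /t pi rmorph0 !mul0r eqxx.
clear sum0 finr Hy ys ey jI.
wlog ji : i j pi pj ilen jn ij ui / (j < i)%N.
  move=> W; case: (ltngtP i j) ij => // [lt|gt] _; last by apply: (W i j); rewrite ?gtn_eqF.
  apply: (W j i) => //; first by rewrite gtn_eqF.
  by rewrite -invf_div; apply: punitV.
have [l Hl] := unit_evp_ratio pi pj.
exists (i - j)%N, (- l); split; first by rewrite subn_gt0.
  exact: leq_trans (leq_subr _ _) ilen.
have := punitM pG ui (punitV pG Hl); congr unit.
have a0 := evp_neq0 pi; have b0 := evp_neq0 pj.
have e0 : eps ^ l != 0 by rewrite expfz_neq0.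
have zj := expf_neq0 j z0.
have zi : z ^+ i = z ^+ (i - j) * z ^+ j by rewrite -exprD subnK // ltnW.
rewrite /t zi -invr_expz.
move: (evp p`_i) (evp p`_j) (eps ^ l) (z ^+ j) (z ^+ (i - j)) a0 b0 e0 zj => aa bb u v w x0 y0 u0 v0.
by field; rewrite ?x0 ?y0 ?u0 ?v0.
Qed.
End DiscretePlace.

Section Expansion.
Import Order.TTheory Num.Theory.
Variables (Om : fieldType) (K : closedFieldType) (G : Om -> K -> Prop).
Hypothesis pG : place G.
Variables (iota : {rmorphism K -> Om}).
Hypothesis Giota : forall a, G (iota a) a.
Let sG := place_srel pG.
Notation fin := (pfin G).
Notation unit := (punit G).

Section Uniformizer.
Variable eps : Om.
Hypotheses (eps0 : eps != 0) (Geps : G eps 0).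
Variables (n : nat) (b : 'rV[Om]_n).
Hypothesis b0 : b != 0.
Local Notation S := (mx_acts (evp iota eps) b).

(** A finite extension of the rational functions in [eps], given as fractions of elements that act
    on one finite module. *)
Definition ratio_in (z : Om) := exists a c, [/\ S a, S c, c != 0 & z = a / c].

Lemma ratio_in_S a : S a -> ratio_in a.
Proof.
exists a, 1; rewrite divr1 oner_neq0; split=> //.
by rewrite -(rmorph1 (evp iota eps)); exact: mx_acts_const.
Qed.
Lemma ratio_inB x y : ratio_in x -> ratio_in y -> ratio_in (x - y).
Proof.
move=> [a [c [Sa Sc c0 ->]]] [a' [c' [Sa' Sc' c0' ->]]].
exists (a * c' - a' * c), (c * c'); split; [|exact: mx_actsM|by rewrite mulf_neq0|].
  by apply: mx_actsB; apply: mx_actsM.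
by rewrite -mulNr addf_div // mulNr.
Qed.
Lemma ratio_inM x y : ratio_in x -> ratio_in y -> ratio_in (x * y).
Proof.
move=> [a [c [Sa Sc c0 ->]]] [a' [c' [Sa' Sc' c0' ->]]].
by exists (a * a'), (c * c'); rewrite mulf_div mulf_neq0 //; split=> //; apply: mx_actsM.
Qed.
Lemma ratio_inV x : ratio_in x -> ratio_in x^-1.
Proof.
move=> [a [c [Sa Sc c0 ->]]]; have [->|a0] := eqVneq a 0.
  rewrite mul0r invr0 -(rmorph0 (evp iota eps)); apply: ratio_in_S; exact: mx_acts_const.
by exists c, a; rewrite invf_div.
Qed.

(** Every [j] with [0 < j <= n] divides [n!], so one exponent clears the denominators of all
    valuations from [root_val]. *)
Let e := (n`!)%N.
Let e0 : (0 < e)%N. Proof. exact: fact_gt0. Qed.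
(** The valuation of [z] is [l / n!] when [eps] has valuation 1; units express this without a value
    group. *)
Definition has_val (z : Om) (l : int) := unit (z ^+ e / eps ^ l).

Lemma has_valM x y l m : has_val x l -> has_val y m -> has_val (x * y) (l + m).
Proof.
move=> Hx Hy; have := punitM pG Hx Hy; rewrite /has_val exprMn expfzDr // invfM.
by rewrite mulrACA.
Qed.
Lemma has_valV x l : has_val x l -> has_val x^-1 (- l).
Proof.
by move/(punitV pG); rewrite /has_val invf_div exprVn -invr_expz invrK mulrC.
Qed.
Lemma has_val_eps : has_val eps e%:Z.
Proof. by rewrite /has_val -exprnP divff ?expf_neq0 //; exact: punit1. Qed.

Lemma eps_exp_fin (m : nat) : fin (eps ^+ m).
Proof. by apply: pfinX => //; exists 0. Qed.

Lemma has_val_fin x l : 0 <= l -> has_val x l -> fin x.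
Proof.
case: l => // l _ H; apply: (pfin_exp pG e0).
rewrite -[x ^+ e](divfK (expf_neq0 l eps0)); apply: pfinM => //; last exact: eps_exp_fin.
exact: punit_fin H.
Qed.
Lemma has_val_pos x l : has_val x l -> G x 0 -> 0 < l.
Proof.
move=> H Gx; rewrite ltNge; apply/negP => l0.
case: (not_G0_unit pG H); apply: G0_mul => //.
  by have := srelX sG e Gx; rewrite expr0n eqn0Ngt e0.
have : 0 <= - l by rewrite oppr_ge0.
by rewrite invr_expz; case: (- l) => // m _; exact: eps_exp_fin.
Qed.

Lemma S_val z : S z -> z != 0 -> exists l, has_val z l.
Proof.
move=> Sz z0; have [p [mp sp] rp] := mx_acts_root b0 Sz.
have [j [l [j0 jn Hu]]] := root_val pG Giota eps0 Geps mp sp rp z0.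
exists (- l * (e %/ j)%N%:Z); rewrite /has_val.
have je : (j %| e)%N by apply: dvdn_fact; rewrite j0.
have := punitX pG (e %/ j) Hu; rewrite exprMn -exprM mulnC divnK //.
by rewrite invr_expz mulNr opprK exprnP -exprz_exp.
Qed.

Lemma ratio_val z : ratio_in z -> z != 0 -> exists l, has_val z l.
Proof.
move=> [a [c [Sa Sc c0 ->]]]; rewrite mulf_eq0 invr_eq0 negb_or => /andP[a0 _].
have [l Hl] := S_val Sa a0; have [m Hm] := S_val Sc c0.
by exists (l + - m); apply: has_valM => //; apply: has_valV.
Qed.

(** Scaled by [n!], valuations are integers, so a least positive one exists; [pi] attains it. *)
Lemma uniformizer : exists pi, [/\ ratio_in pi, pi != 0, G pi 0,
    forall z, ratio_in z -> G z 0 -> fin (z / pi)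
  & forall z, ratio_in z -> exists s, fin (pi ^+ s * z)].
Proof.
have ex : exists m : nat, `[< exists z, [/\ ratio_in z, z != 0 & has_val z m.+1%:Z] >].
  exists e.-1; apply/asboolP; exists eps; split=> //; last by rewrite prednK //; exact: has_val_eps.
  by apply: ratio_in_S; have := mx_acts_const (evp iota eps) b 'X; rewrite /= evpX.
case: (ex_minnP ex) => m /asboolP [pi [Epi pi0 Vpi]] minm.
have Gpi : G pi 0.
  have [//|/(punitX pG e) ue|//] := pfin_cases (has_val_fin _ Vpi).
  case: (not_G0_unit pG ue); rewrite -[pi ^+ e](divfK (expf_neq0 m.+1 eps0)) mulrC.
  apply: G0_mul => //; last exact: punit_fin Vpi.
  by have := srelX sG m.+1 Geps; rewrite expr0n.
exists pi; split=> // [z Ez Gz|z Ez].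
  have [->|z0] := eqVneq z 0; first by rewrite mul0r; exists 0; apply: srel0.
  have [l Vl] := ratio_val Ez z0; have l0 := has_val_pos Vl Gz.
  apply: (@has_val_fin _ (l + - m.+1%:Z)); last by apply: has_valM => //; apply: has_valV.
  case: l l0 Vl => // -[//|l] _ Vl; rewrite subr_ge0 lez_nat ltnS; apply: minm.
  by apply/asboolP; exists z.
have [->|z0] := eqVneq z 0; first by exists 0%N; rewrite mulr0; exists 0; apply: srel0.
have [l Vl] := ratio_val Ez z0; exists `|l|%N.
have Vs s : has_val (pi ^+ s) (s%:Z * m.+1%:Z).
  elim: s => [|s IH].
    by rewrite mul0r /has_val expr1n expr0z divr1; exact: punit1.
  by rewrite exprS -addn1 PoszD mulrDl mul1r addrC; apply: has_valM.
by apply: has_val_fin (has_valM (Vs _) Vl); nia.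
Qed.
End Uniformizer.

Section Truncation.
Variables (pi : Om) (E1 : Om -> Prop).
Hypotheses (pi0 : pi != 0) (Gpi : G pi 0).
Hypotheses (E1B : forall x y, E1 x -> E1 y -> E1 (x - y))
  (E1M : forall x y, E1 x -> E1 y -> E1 (x * y)) (E1V : forall x, E1 x -> E1 x^-1)
  (E1iota : forall a, E1 (iota a)) (E1pi : E1 pi).
Hypothesis pi_unif : forall z, E1 z -> G z 0 -> fin (z / pi).
Local Notation ev := (evp iota pi).

(** Taylor expansion at the place: subtract the residue, divide by [pi], repeat. *)
Lemma expand z L : E1 z -> fin z ->
  exists w z', [/\ E1 z', fin z' & z = ev w + pi ^+ L * z'].
Proof.
move=> Ez fz; elim: L => [|L [w [z' [Ez' [a Ha] ->]]]].
  by exists 0, z; rewrite rmorph0 add0r expr0 mul1r.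
have Ed : E1 (z' - iota a) by apply: E1B.
exists (w + a%:P * 'X^L), ((z' - iota a) / pi); split.
- by apply: E1M => //; apply: E1V.
- by apply: pi_unif => //; rewrite -(subrr a); apply: srelB.
- by rewrite rmorphD rmorphM rmorphXn /= evpC evpX exprSr; field.
Qed.

(** The valuation of a polynomial in [pi] is its order at 0; this turns an estimate in [Om] into
    divisibility of formal polynomials. *)
Lemma evp_dvd L (H : {poly K}) : fin (ev H / pi ^+ L) -> exists h, H = 'X^L * h.
Proof.
elim: L H => [|L IH] H fH; first by exists H; rewrite expr0 mul1r.
have H0 : H`_0 = 0.
  apply: (place_inj pG (G_evp pG Giota Gpi H)).
  rewrite -[ev H](divfK (expf_neq0 L.+1 pi0)) mulrC; apply: G0_mul => //.
  by have := srelX sG L.+1 Gpi; rewrite expr0n.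
have e : H = 'X * drop_poly 1 H.
  rewrite -{1}(poly_take_drop 1 H) mulrC; suff -> : take_poly 1 H = 0 by rewrite add0r.
  by apply/polyP => -[|i]; rewrite coef_take_poly ?coef0 //= H0.
have [|h Hh] := IH (drop_poly 1 H); last by exists h; rewrite e Hh mulrA -exprS.
move: fH; rewrite {1}e rmorphM /= evpX exprS.
by congr fin; field; rewrite pi0 expf_neq0.
Qed.

Definition pi_congr L x y := [/\ fin x, fin y & fin ((x - y) / pi ^+ L)].

Lemma pi_congr_ring L : subring_rel (pi_congr L).
Proof.
split.
- have f1 := punit_fin (punit1 pG); split=> //.
  by rewrite subrr mul0r; exists 0; apply: srel0.
- move=> x y x' y' [fx fy H] [fx' fy' H']; split; [exact: pfinB|exact: pfinB|].
  by have := pfinB pG H H'; congr fin; rewrite -mulrBl; congr (_ / _); ring.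
- move=> x y x' y' [fx fy H] [fx' fy' H']; split; [exact: pfinM|exact: pfinM|].
  have := pfinD pG (pfinM pG H fx') (pfinM pG fy H'); congr fin.
  by rewrite mulrAC mulrA -mulrDl; congr (_ / _); ring.
Qed.

Lemma mmap_rel (A B : comNzRingType) (R : A -> B -> Prop) (N : nat)
    (f : K -> A) (g : K -> B) (u : 'I_N -> A) (v : 'I_N -> B) (p : {mpoly K[N]}) :
  subring_rel R -> (forall a, R (f a) (g a)) -> (forall i, R (u i) (v i)) ->
  R (mmap f u p) (mmap g v p).
Proof.
move=> sR Rc Ruv; apply: srel_sum => // m _; apply: srelM => //.
by apply: srel_prod => // i _; apply: srelX.
Qed.

(** Multiplication by [pi ^+ s] makes the coordinates finite and, by homogeneity, multiplies each
    form by [pi ^+ (k * s)]. Polynomial truncations change the forms only modulo [pi ^+ L]. *)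
Lemma truncate_curve N (om : 'I_N -> Om) (I : Type) (psi : I -> {mpoly K[N]})
    (x : I -> K) (k : nat) :
  (forall j, E1 (om j)) ->
  (forall z, E1 z -> exists s, fin (pi ^+ s * z)) ->
  (forall i (c : Om) v, mmap iota (fun j => c * v j) (psi i) = c ^+ k * mmap iota v (psi i)) ->
  (forall i, G (mmap iota om (psi i)) (x i)) ->
  exists (s : nat) (w : 'I_N -> {poly K}), forall i, exists h : {poly K},
    mmap polyC w (psi i) = 'X^s * ((x i)%:P + 'X * h).
Proof.
move=> Eom bnd hom Gx.
have [s fs] : exists s, forall j, fin (pi ^+ s * om j).
  have [s Hs] := choice (fun j => bnd _ (Eom j)); exists (\max_j s j)%N => j.
  have -> : pi ^+ (\max_j s j)%N * om j = pi ^+ (\max_j s j - s j)%N * (pi ^+ s j * om j).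
    by rewrite mulrA -exprD subnK // leq_bigmax.
  by apply: pfinM => //; apply: pfinX => //; exists 0.
have EX z m : E1 z -> E1 (z ^+ m).
  by move=> Ez; elim: m => [|m IH]; [rewrite expr0 -(rmorph1 iota)|rewrite exprS; apply: E1M].
set v := fun j => pi ^+ s * om j.
have Ev j : E1 (v j) by apply: E1M => //; apply: EX.
(* One order beyond [pi ^+ (k * s)], so that the truncation error falls into the term ['X * h]. *)
pose L := (k * s).+1.
have [w /choice [z' Hz]] := choice (fun j => expand L (Ev j) (fs j)).
exists (k * s)%N, w => i.
have Eps u : (forall j, E1 (u j)) -> E1 (mmap iota u (psi i)).
  move=> Eu; apply: (@mmap_rel _ _ (fun a _ => E1 a) N iota iota u u) => //.
  by split=> [|a _ c _|a _ c _]; [rewrite -(rmorph1 iota)|exact: E1B|exact: E1M].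
pose H := mmap polyC w (psi i) - 'X^(k * s) * (x i)%:P.
have evw : ev (mmap polyC w (psi i)) = mmap iota (fun j => ev (w j)) (psi i).
  rewrite /mmap rmorph_sum; apply: eq_bigr => m _; rewrite rmorphM /= evpC; congr (_ * _).
  by rewrite rmorph_prod; apply: eq_bigr => j _; rewrite rmorphXn.
have [_ _ c1] : pi_congr L (mmap iota (fun j => ev (w j)) (psi i)) (mmap iota v (psi i)).
  apply: mmap_rel => [||j]; first exact: pi_congr_ring.
    move=> a; have fa : fin (iota a) by exists a.
    by split=> //; rewrite subrr mul0r; exists 0; apply: srel0.
  have [Ez fz vE] := Hz j; split=> //; last first.
    rewrite vE opprD addrA subrr sub0r mulNr [pi ^+ L * _]mulrC mulfK ?expf_neq0 //.
    by rewrite -sub0r; apply: pfinB => //; exists 0; apply: srel0.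
  exact: fs.
  by exists (w j)`_0; apply: (G_evp pG Giota Gpi).
have c2 : fin ((mmap iota v (psi i) - pi ^+ (k * s) * iota (x i)) / pi ^+ L).
  rewrite /v hom -exprM [(s * k)%N]mulnC -mulrBr exprSr invfM mulrACA divff ?expf_neq0 //.
  rewrite mul1r; apply: pi_unif; first by apply: E1B => //; apply: Eps.
  by rewrite -(subrr (x i)); apply: srelB.
have : fin (ev H / pi ^+ L).
  have := pfinD pG c1 c2; congr fin; rewrite -mulrDl; congr (_ / _).
  by rewrite rmorphB rmorphM rmorphXn /= evpX evpC evw addrA subrK.
move=> /evp_dvd [h Hh]; exists h.
by rewrite mulrDr mulrA -exprSr -Hh /H addrC subrK.
Qed.
End Truncation.

(** All coordinates lie in one finite extension, whose uniformizer becomes the parameter of the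
    curve, as in a Puiseux expansion. *)
Lemma algebraic_curve_expansion (eps : Om) N (om : 'I_N -> Om) (I : Type)
    (psi : I -> {mpoly K[N]}) (x : I -> K) (k : nat) :
  eps != 0 -> G eps 0 ->
  (forall j, exists l : {poly K}, l != 0 /\ integralOver (evp iota eps) (evp iota eps l * om j)) ->
  (forall i (c : Om) v, mmap iota (fun j => c * v j) (psi i) = c ^+ k * mmap iota v (psi i)) ->
  (forall i, G (mmap iota om (psi i)) (x i)) ->
  exists (s : nat) (w : 'I_N -> {poly K}), forall i, exists h : {poly K},
    mmap polyC w (psi i) = 'X^s * ((x i)%:P + 'X * h).
Proof.
move=> eps0 Geps intl hom Gx.
have evn0 := evp_neq0 pG Giota eps0 Geps.
have [l Hl] := choice intl.
have [|n [b [b0 Hb]]] := @integral_module _ _ (evp iota eps) [seq evp iota eps (l j) * om j | j <- enum 'I_N].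
  by move=> z /mapP[j _ ->]; case: (Hl j).
have Sin a : ratio_in eps b (evp iota eps a) by apply: ratio_in_S; exact: mx_acts_const.
have Eom j : ratio_in eps b (om j).
  have [lj0 _] := Hl j; rewrite -[om j](mulKf (evn0 _ lj0)); apply: ratio_inM.
    exact/ratio_inV/Sin.
  by apply: ratio_in_S; apply: Hb; apply: map_f; rewrite mem_enum.
have [pi [Epi pi0 Gpi piu bnd]] := uniformizer eps0 Geps b0.
apply: (truncate_curve (E1 := ratio_in eps b) pi0 Gpi _ _ _ _ _ piu Eom bnd hom Gx) => //.
- exact: ratio_inB.
- exact: ratio_inM.
- exact: ratio_inV.
- by move=> a; rewrite -(evpC iota eps).
Qed.
End Expansion.

(** * Curve selection *)

Section IntegralScaling.
Variables (R : comNzRingType) (S : fieldType) (rho : {rmorphism R -> S}).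

(** With [d] the degree, the equation times the power [d - 1] of the leading coefficient [a] is
    monic in [a * z]. *)
Lemma integral_scaled_root (q : {poly S}) z : q != 0 -> root q z ->
  integral_coefs rho q -> integralOver rho (lead_coef q * z).
Proof.
move=> q0 rq intq; set a := lead_coef q.
pose d := (size q).-1; have sq : size q = d.+1 by rewrite prednK // lt0n size_poly_eq0.
have d0 : (0 < d)%N.
  rewrite lt0n; apply/eqP => d_0; move: rq q0; rewrite (@size1_polyC _ q) ?sq ?d_0 //.
  by rewrite rootE hornerC polyC_eq0 => /eqP ->; rewrite eqxx.
pose T := \poly_(i < d) (q`_i * a ^+ (d.-1 - i)).
have inta : integralOver rho a by exact: intq.
apply: (@integral_root_monic _ _ rho _ ('X^d + T)).
- by rewrite monicE lead_coefDl ?lead_coefXn // size_polyXn ltnS; exact: size_poly.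
- have H : a ^+ d.-1 * q.[z] = 0 by rewrite (rootP rq) mulr0.
  apply/rootP; apply: etrans H; rewrite hornerD hornerXn horner_poly horner_coef sq big_ord_recr /=.
  rewrite mulrDr addrC [q`_d](_ : _ = a); last by rewrite /a lead_coefE sq.
  rewrite exprMn mulrA -exprSr prednK //; congr (_ + _).
  rewrite mulr_sumr; apply: eq_bigr => i _; rewrite exprMn.
  have -> : a ^+ d.-1 = a ^+ (d.-1 - i) * a ^+ i by rewrite -exprD subnK // -ltnS prednK.
  by ring.
- apply/integral_poly; apply: integral_coefsD.
    exact/integral_coefs_exp/integral_coefsX.
  move=> i; rewrite coef_poly; case: ifP => _; last exact: integral0.
  apply: integral_mul; first exact: intq.
  by elim: (_ - _)%N => [|n IH]; [rewrite expr0; exact: integral1|rewrite exprS; apply: integral_mul].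
Qed.

(** [l] is the constant term of a monic equation of least degree for [a]: nonzero by minimality, a
    multiple of [a] by the equation. *)
Lemma integral_multiple a : a != 0 -> integralOver rho a ->
  exists l c, [/\ l != 0, integralOver rho c & rho l = a * c].
Proof.
move=> a0 inta; have [P [mP rP minP]] : exists P : {poly R}, [/\ P \is monic, root (map_poly rho P) a
    & forall Q : {poly R}, Q \is monic -> root (map_poly rho Q) a -> (size P <= size Q)%N].
  have ex : exists n, `[< exists Q : {poly R}, [/\ Q \is monic, root (map_poly rho Q) a & size Q = n] >].
    by case: inta => Q mQ rQ; exists (size Q); apply/asboolP; exists Q.
  case: (ex_minnP ex) => n /asboolP [P [H1 H2 H3]] minn.
  by exists P; split=> // Q mQ rQ; rewrite H3; apply: minn; apply/asboolP; exists Q.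
have e : P = (P`_0)%:P + 'X * drop_poly 1 P.
  rewrite -{1}(poly_take_drop 1 P) mulrC; congr (_ + _).
  by apply/polyP => -[|i]; rewrite coef_take_poly coefC.
have ea : rho P`_0 + a * (map_poly rho (drop_poly 1 P)).[a] = 0.
  apply: etrans (rootP rP); rewrite {3}e rmorphD rmorphM /= map_polyC map_polyX.
  by rewrite hornerD hornerC hornerM hornerX.
have P0 : P`_0 != 0.
  apply/eqP => p0; have dm : drop_poly 1 P \is monic.
    move: mP; rewrite {1}e p0 polyC0 add0r !monicE mulrC lead_coefMX; exact.
  have := minP _ dm; rewrite rootE; move/eqP: ea; rewrite p0 rmorph0 add0r mulf_eq0 (negbTE a0) /= => -> /(_ isT).
  by rewrite size_drop_poly leqNgt subn1 ltn_predL lt0n size_poly_eq0 monic_neq0.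
exists (P`_0), (- (map_poly rho (drop_poly 1 P)).[a]); split=> //.
  apply: integral_opp; apply: integral_horner => //; apply/integral_poly => i.
  by rewrite coef_map; exact: integral_id.
by apply/eqP; rewrite mulrN -subr_eq0 opprK ea.
Qed.
End IntegralScaling.

(** * Specialisations, going down and the selection of a curve *)

Section Specialization.
Variables (K E : closedFieldType) (j0 : {rmorphism K -> E}).

(** Sending [psi] to [x] defines a [K]-algebra morphism from [K[psi]] to [K]. *)
Definition specializes M (psi : 'I_M -> E) (x : 'I_M -> K) :=
  forall p : {mpoly K[M]}, mmap j0 psi p = 0 -> p.@[x] = 0.
Definition poly_in M (psi : 'I_M -> E) (a : E) := exists p : {mpoly K[M]}, a = mmap j0 psi p.
Definition alg_over M (psi : 'I_M -> E) (z : E) :=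
  exists q : {poly E}, [/\ q != 0, root q z & forall i, poly_in psi q`_i].

Lemma poly_in_widen M M' (psi : 'I_M -> E) (psi' : 'I_M' -> E) (f : 'I_M -> 'I_M') a :
  (forall i, psi' (f i) = psi i) -> poly_in psi a -> poly_in psi' a.
Proof.
move=> Hf [p ->]; exists (mmap (@mpolyC M' K) (fun i => 'X_(f i)) p).
rewrite mmap_comp; apply: mmap_eq => [b|i] /=; first by rewrite mmapC.
by rewrite mmapX mmap1U Hf.
Qed.

Lemma poly_coefs_lift M (psi : 'I_M -> E) (q : {poly E}) : (forall i, poly_in psi q`_i) ->
  exists P : {poly {mpoly K[M]}}, q = map_poly (mmap j0 psi) P.
Proof.
move/choice => [p Hp]; exists (\poly_(i < size q) p i).
apply/polyP => i; rewrite coef_map coef_poly; case: ltnP => [_|le]; first by rewrite Hp.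
by rewrite /= mmap0 nth_default.
Qed.

(* An element transcendental over K[psi] may be adjoined to psi and given the
   value 0. *)
Lemma adjoin_transcendentals (s : seq E) M (psi : 'I_M -> E) (x : 'I_M -> K) :
  specializes psi x ->
  exists M' (psi' : 'I_M' -> E) (x' : 'I_M' -> K) (f : 'I_M -> 'I_M'),
    [/\ specializes psi' x', forall i, psi' (f i) = psi i, forall i, x' (f i) = x i
      & {in s, forall z, alg_over psi' z}].
Proof.
move=> Hs; elim: s => [|z s [M' [psi' [x' [f [Hs' Hf Hx Ha]]]]]].
  by exists M, psi, x, id.
case: (pselect (alg_over psi' z)) => [az|naz].
  exists M', psi', x', f; split=> // w; rewrite inE => /predU1P[->|] //; exact: Ha.
pose psi2 (i : 'I_M'.+1) := if unlift ord_max i is Some j then psi' j else z.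
pose x2 (i : 'I_M'.+1) := if unlift ord_max i is Some j then x' j else 0.
have H2 j : psi2 (lift ord_max j) = psi' j by rewrite /psi2 liftK.
exists M'.+1, psi2, x2, (fun i => lift ord_max (f i)); split=> [p| i|i|w].
- rewrite /psi2 mmap_muni => rz.
  have coef0 : forall i, mmap j0 psi' (muni p)`_i = 0.
    move=> i; apply: contrapT => /eqP ci; apply: naz.
    exists (map_poly (mmap j0 psi') (muni p)); split.
    + by apply: contraNneq ci => e; rewrite -coef_map e coef0.
    + exact/rootP.
    + by move=> l; rewrite coef_map; exists (muni p)`_l.
  rewrite [LHS](@mmap_muni _ _ _ idfun).
  rewrite horner_coef big1 // => i _; rewrite coef_map.
  by have := Hs' _ (coef0 i); rewrite /meval /= => ->; rewrite mul0r.
- by rewrite H2.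
- by rewrite /x2 liftK.
- rewrite inE => /predU1P[->|/Ha [q [q0 rq qi]]].
    exists ('X - z%:P); split; [by rewrite polyXsubC_eq0|by rewrite root_XsubC|].
    move=> i; rewrite coefB coefX coefC; exists ((i == 1%N)%:R%:MP - (if i == 0%N then 'X_ord_max else 0)).
    rewrite mmapB mmapC; congr (_ - _); first by case: eqP => _ /=; rewrite ?mulr0n ?mulr1n ?rmorph0 ?rmorph1.
    by case: eqP => _; rewrite ?mmap0 // mmapX mmap1U /psi2 unlift_none.
  exists q; split=> // i; exact: poly_in_widen (qi i).
Qed.
End Specialization.

(** The tuples with entries in [Z] give finitely many polynomials in [tau]; some [tau] avoids the
    roots of all nonzero ones. *)
Lemma separating_parameter (K : closedFieldType) (Z : seq K) M :
  exists tau : K, forall z : 'I_M -> K, (forall i, z i \in Z) ->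
    \sum_i z i * tau ^+ i = 0 -> forall i, z i = 0.
Proof.
pose q (z : 'I_M -> K) : {poly K} := \sum_i z i *: 'X^i.
have qE z t : (q z).[t] = \sum_i z i * t ^+ i.
  by rewrite horner_sum; apply: eq_bigr => i _; rewrite hornerZ hornerXn.
have qi z (i : 'I_M) : (q z)`_i = z i.
  rewrite coef_sum (bigD1 i) //= coefZ coefXn eqxx mulr1 big1 ?addr0 // => j ji.
  by rewrite coefZ coefXn eq_sym val_eqE (negbTE ji) mulr0.
pose zg (g : {ffun 'I_M -> 'I_(size Z)}) i := nth 0 Z (g i).
pose Q := \prod_(g | q (zg g) != 0) q (zg g).
have Q0 : Q != 0 by apply/prodf_neq0.
have [tau Qtau] := closed_nonrootP _ Q0.
exists tau => z zZ; rewrite -qE => z0 i.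
have lt j : (index (z j) Z < size Z)%N by rewrite index_mem.
pose g := [ffun j => Ordinal (lt j)].
have e : z = zg g by apply/funext => j; rewrite /zg ffunE nth_index.
have [q0|q0] := eqVneq (q z) 0; first by rewrite -qi q0 coef0.
by case/negP: Qtau; rewrite rootE horner_prod (bigD1 g) -?e //= z0 mul0r.
Qed.

Section GoingDown.
Variables (K E Om K1 : closedFieldType) (j0 : {rmorphism K -> E}) (j2 : {rmorphism K -> Om})
  (i1 : {rmorphism K -> K1}).
Variables (M : nat) (psi : 'I_M -> E).
Hypothesis psi0 : specializes j0 psi (fun=> 0).
Variables (r : nat) (y : 'I_r -> E) (L : 'I_r -> 'I_M -> K).
Hypotheses (y_indep : alg_indep j0 y) (yL : forall i, y i = \sum_j j0 (L i j) * psi j)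
  (psi_int : forall j, integralOver (mmap j0 y) (psi j)).
Variables (eta : 'I_r -> Om) (G : Om -> K1 -> Prop).
Hypotheses (pG : place G) (Gj2 : forall a, G (j2 a) (i1 a))
  (Geta : forall i, G (eta i) 0).
Local Notation R := {mpoly K[r]}.
Let rho : {rmorphism R -> E} := mmap j0 y.
Let sig : {rmorphism R -> Om} := mmap j2 eta.

Lemma G_sig p : G (sig p) (i1 p.@[fun=> 0]).
Proof.
have -> : i1 p.@[fun=> 0] = mmap i1 (fun=> 0) p.
  by rewrite /meval mmap_comp; apply: mmap_eq => // i; rewrite /= rmorph0.
by apply: mmap_rel => //; exact: place_srel.
Qed.

(* If u vanishes at the point, then so does the constant term of its minimal
   polynomial over K[y], which is up to sign the product of the conjugates. *)
Lemma conjugate_in_ideal u : poly_in j0 psi u -> integralOver rho u ->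
  (forall p, u = mmap j0 psi p -> p.@[fun=> 0] = 0) ->
  exists (mu : {poly R}) u0, [/\ mu \is monic,
    forall P : {poly R}, root (map_poly rho P) u -> root (map_poly sig P) u0 & G u0 0].
Proof.
move=> [U uU] intu u0; have U0 := u0 _ uU.
have [mu [mmu rmu minmu]] := monic_minpoly y_indep intu.
have c0 : (mu`_0).@[fun=> 0] = 0.
  (* Rewrites [y] by linear forms in [psi]; they have no constant term, so values at the origin are
     preserved. *)
  pose s : {rmorphism R -> {mpoly K[M]}} := mmap (@mpolyC M K) (fun i => \sum_j L i j *: 'X_j).
  have sE p : mmap j0 psi (s p) = rho p.
    rewrite /s mmap_comp; apply: mmap_eq => [a|i] /=; first by rewrite mmapC.
    rewrite raddf_sum /= yL; apply: eq_bigr => j _.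
    by rewrite mmapZ mmapX mmap1U.
  have s0 p : (s p).@[fun=> 0] = p.@[fun=> 0].
    rewrite /meval /s mmap_comp; apply: mmap_eq => [a|i] /=; first by rewrite mmapC.
    rewrite raddf_sum /= big1 // => j _; by rewrite mmapZ mmapX mmap1U mulr0.
  (* [mu] at [U] is a relation among the [psi]; at the origin, where [U] vanishes, only its constant
     term remains. *)
  have : ((map_poly s mu).[U]).@[fun=> 0] = 0.
    apply: psi0; apply: etrans (rootP rmu).
    rewrite !horner_coef !size_map_poly_id0.
    - rewrite raddf_sum; apply: eq_bigr => i _.
      by rewrite /= rmorphM rmorphXn !coef_map /= sE -uU.
    - by rewrite (monicP mmu) rmorph1 oner_neq0.
    - by rewrite (monicP mmu) rmorph1 oner_neq0.
  rewrite (_ : (_).@[_] = (map_poly (meval (fun=> 0) \o s) mu).[U.@[fun=> 0]]).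
    by rewrite U0 horner_coef0 coef_map /= s0.
  by rewrite map_poly_comp horner_map.
have msig : map_poly sig mu \is monic by apply: monic_map.
have [us Hus] := closed_field_poly_normal (map_poly sig mu).
rewrite (monicP msig) scale1r in Hus.
have fus : {in us, forall z, pfin G z}.
  move=> z zus; apply: (pfin_integral pG msig).
    by rewrite Hus root_prod_XsubC.
  by move=> i; rewrite coef_map; exists (i1 (mu`_i).@[fun=> 0]); exact: G_sig.
have [u1 [u1us Gu1]] : exists u1, u1 \in us /\ G u1 0.
  apply: contrapT => H.
  have uu : punit G (\prod_(z <- us) (0 - z)).
    rewrite big_seq; elim/big_rec: _ => [|z x zus]; first exact: punit1.
    apply: punitM => //; case: (pfin_cases (fus z zus)) => [[a a0 Ha]|Gz].
      exists (0 - a); first by rewrite sub0r oppr_eq0.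
      by apply: srelB => //; [exact: place_srel|apply: srel0; exact: place_srel].
    by case: H; exists z.
  apply: (not_G0_unit pG uu).
  have -> : \prod_(z <- us) (0 - z) = sig mu`_0.
    rewrite -coef_map Hus -horner_coef0 horner_prod; apply: eq_bigr => z _.
    by rewrite hornerXsubC.
  by have := G_sig mu`_0; rewrite c0 rmorph0.
exists mu, u1; split=> // P rP.
have e := Pdiv.RingMonic.rdivp_eq mmu P.
have rm : Pdiv.Ring.rmodp P mu = 0.
  apply/eqP; apply: contraT => m0.
  have := Pdiv.Ring.ltn_rmodpN0 P (monic_neq0 mmu); rewrite ltnNge minmu //.
  move: rP; rewrite {1}e rmorphD rmorphM /= !rootE hornerD hornerM (rootP rmu).
  by rewrite mulr0 add0r.
rewrite e rm addr0 rmorphM rootM; apply/orP; right.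
by rewrite /= Hus root_prod_XsubC.
Qed.

(** [H] extends the specialisation of [y] to [eta] and of [u] to [u0]. The residue of each [zeta l]
    is one of the finitely many roots of [P0 l]. The residue 0 of [u0] is the sum of these residues
    weighted by powers of [tau], so the choice of [tau] makes them all 0. *)
Lemma going_down : exists (H : E -> Om -> Prop) (zeta : 'I_M -> Om),
  [/\ place H, forall p, H (rho p) (sig p), forall i, H (psi i) (zeta i),
      forall i, integralOver sig (zeta i) & forall i, G (zeta i) 0].
Proof.
have exP i : exists P : {poly R}, P \is monic /\ root (map_poly rho P) (psi i).
  by have [P mP rP] := psi_int i; exists P.
have [P HP] := choice exP.
pose P0 i := map_poly (meval (fun=> 0)) (P i).
have mP0 i : P0 i \is monic by apply: monic_map; case: (HP i).
have exz i : exists zs : seq K, P0 i = \prod_(z <- zs) ('X - z%:P).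
  have [zs] := closed_field_poly_normal (P0 i).
  by rewrite (monicP (mP0 i)) scale1r => H; exists zs.
have [zs Hzs] := choice exz.
(* The possible residues are known before [H] is built: they are the roots of the equations reduced
   at the origin. *)
have [tau Htau] := separating_parameter (flatten [seq zs i | i <- enum 'I_M]) M.
pose U : {mpoly K[M]} := \sum_(i < M) tau ^+ i *: 'X_i.
pose u := mmap j0 psi U.
have uE : u = \sum_(i < M) j0 (tau ^+ i) * psi i.
  by rewrite /u raddf_sum; apply: eq_bigr => i _; rewrite /= mmapZ mmapX mmap1U.
have intu : integralOver rho u.
  rewrite uE; apply: integral_sum => i _; apply: integral_mul => //.
  by rewrite -[j0 _](mmapC y); exact: integral_id.
have [||mu [u0 [mmu Hu0 Gu0]]] := conjugate_in_ideal _ intu; first by exists U.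
  move=> p e; have : mmap j0 psi (U - p) = 0 by rewrite mmapB -e subrr.
  move/psi0; rewrite mevalB => /eqP; rewrite subr_eq0 => /eqP <-.
  by rewrite raddf_sum big1 // => i _; rewrite /= mevalZ mevalXU mulr0.
pose G1 a b := exists P : {poly R}, a = (map_poly rho P).[u] /\ b = (map_poly sig P).[u0].
have sG1 : subring_rel G1.
  split.
  - by exists 1; rewrite !rmorph1 !hornerC.
  - by move=> _ _ _ _ [A [-> ->]] [B [-> ->]]; exists (A - B); rewrite !rmorphB /= !hornerD !hornerN.
  - by move=> _ _ _ _ [A [-> ->]] [B [-> ->]]; exists (A * B); rewrite !rmorphM /= !hornerM.
have fG1 : rel_functional G1.
  by move=> b [A [/esym/rootP rA ->]]; apply/rootP/Hu0.
have [H pH subH] := place_extension sG1 fG1.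
have sH := place_srel pH.
have Hrho p : H (rho p) (sig p).
  by apply: subH; exists p%:P; rewrite !map_polyC !hornerC.
have exzeta i : exists zeta, H (psi i) zeta.
  have [mP rP] := HP i; apply: (pfin_integral pH _ rP); first exact: monic_map.
  by move=> l; rewrite coef_map; exists (sig (P i)`_l); exact: Hrho.
have [zeta Hz] := choice exzeta.
have rz l : root (map_poly sig (P l)) (zeta l).
  apply/rootP/(place_fun pH); rewrite -(rootP (proj2 (HP l))).
  by apply: poly_rel_horner => // m; rewrite !coef_map; exact: Hrho.
exists H, zeta; split=> // i; first by exists (P i); case: (HP i).
have sG := place_srel pG.
have fz l : pfin G (zeta l).
  apply: (pfin_integral pG _ (rz l)); first by apply: monic_map; case: (HP l).
  by move=> m; rewrite coef_map; exists (i1 ((P l)`_m).@[fun=> 0]); exact: G_sig.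
have exGz l : exists z, G (zeta l) (i1 z) /\ z \in zs l.
  have [w Gw] := fz l.
  have rw : root (map_poly i1 (P0 l)) w.
    apply/rootP/(place_fun pG); rewrite -(rootP (rz l)).
    apply: poly_rel_horner => // m; rewrite !coef_map; exact: G_sig.
  move: rw; rewrite Hzs rmorph_prod rootE horner_prod prodf_seq_eq0 => /hasP[/= z zl].
  rewrite rmorphB /= map_polyX map_polyC hornerXsubC subr_eq0 => /eqP e.
  by exists z; rewrite -e.
have [z Gz] := choice exGz.
have Hu : H u u0 by apply: subH; exists 'X; rewrite !map_polyX !hornerX.
have e0 : u0 = \sum_(l < M) j2 (tau ^+ l) * zeta l.
  apply: (place_inj pH Hu); rewrite uE; apply: srel_sum => // l _; apply: srelM => //.
  by have := Hrho (tau ^+ l)%:MP; rewrite /rho /sig /= !mmapC.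
have : i1 (\sum_(l < M) z l * tau ^+ l) = 0.
  apply: (place_inj pG _ Gu0); rewrite e0 rmorph_sum; apply: srel_sum => // l _.
  by rewrite mulrC rmorphM; apply: srelM => //; case: (Gz l).
move/eqP; rewrite fmorph_eq0 => /eqP /Htau Hz0.
have [Gzi _] := Gz i; rewrite Hz0 ?rmorph0 // in Gzi => l.
by apply/flattenP; exists (zs l); [apply: map_f; rewrite mem_enum|case: (Gz l)].
Qed.
End GoingDown.

Lemma transcendental_evp (K Om : closedFieldType) (iota : {rmorphism K -> Om}) (c : 'I_1 -> Om) :
  alg_indep iota c -> forall P : {poly K}, evp iota (c ord0) P = 0 -> P = 0.
Proof.
move=> ai P HP; pose p : {mpoly K[1]} := (map_poly (@mpolyC 1 K) P).['X_ord0].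
have p0 : p = 0.
  apply: ai; rewrite /p -horner_map /= -map_poly_comp mmapX mmap1U -[RHS]HP /evp.
  by congr (_.[_]); apply: eq_map_poly => a /=; rewrite mmapC.
have : mmap (polyC : {rmorphism _ -> _}) (fun=> 'X) p = 0 by rewrite p0 rmorph0.
rewrite /p -horner_map /= -map_poly_comp mmapX mmap1U => <-.
rewrite -[LHS]comp_polyXr /comp_poly; congr (_.[_]).
by apply: eq_map_poly => a /=; rewrite mmapC.
Qed.

Lemma pfin_root (Om : fieldType) (K : closedFieldType) (G : Om -> K -> Prop) (q : {poly Om}) z :
  place G -> root q z -> (forall i, pfin G q`_i) -> punit G (lead_coef q) -> pfin G z.
Proof.
move=> pG rq fq ua; have a0 := punit_neq0 pG ua.
apply: (@pfin_integral _ _ _ pG z ((lead_coef q)^-1 *: q)).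
- by rewrite monicE lead_coefZ mulVf.
- by rewrite rootZ // invr_eq0.
- by move=> i; rewrite coefZ; apply: pfinM => //; apply: punit_fin; apply: punitV.
Qed.

(** [K1] supplies a generic direction [w0] for the line. The [eta i] then stay independent over [K],
    so the leading coefficients of equations for the parameters [v] survive and [v] gets finite
    images. *)
Theorem curve_selection (K : closedFieldType) N M k (psi : 'I_M -> {mpoly K[N]}) (x : 'I_M -> K) :
  (forall i, psi i \is k.-homog) ->
  (forall p : {mpoly K[M]}, (forall v : 'I_N -> K, p.@[fun i => (psi i).@[v]] = 0) -> p.@[x] = 0) ->
  exists (K1 : closedFieldType) (i1 : {rmorphism K -> K1}) (s : nat) (w : 'I_N -> {poly K1}),
    forall i, exists h, mmap (polyC \o i1) w (psi i) = 'X^s * ((i1 (x i))%:P + 'X * h).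
Proof.
move=> hom cl; have [E [j0 [v vgen]]] := generic_extension K N.
pose Psi i := mmap j0 v (psi i).
have spec : specializes j0 Psi x.
  move=> p Hp; apply: cl => u.
  have : mmap (@mpolyC N K) psi p = 0.
    by apply: vgen; rewrite mmap_comp -[RHS]Hp; apply: mmap_eq => [a|i] //=; rewrite mmapC.
  move=> /(congr1 (meval u)); rewrite meval0 => H; rewrite -[RHS]H mmap_comp.
  by apply: mmap_eq => [a|i] //=; rewrite mevalC.
(* The coordinates are enlarged until every [v j] is algebraic over them, so that its image is
   algebraic over the rational functions in [eps]. *)
have [M' [psi' [x' [f [spec' Hpsi' Hx' alg]]]]] := adjoin_transcendentals (codom v) spec.
pose psi2 i := psi' i - j0 (x' i).
have spec2 : specializes j0 psi2 (fun=> 0).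
  move=> p Hp; pose q := mmap (@mpolyC M' K) (fun i => 'X_i - (x' i)%:MP) p.
  have : mmap j0 psi' q = 0.
    rewrite /q mmap_comp -[RHS]Hp; apply: mmap_eq => [a|i] /=; first by rewrite mmapC.
    by rewrite mmapB mmapX mmap1U mmapC.
  move/spec'; rewrite /q mmap_comp => H; rewrite -[RHS]H [LHS]/meval.
  apply: mmap_eq => [a|i] /=; first by rewrite mevalC.
  by rewrite mevalB mevalXU mevalC subrr.
have [r [y [L [ai yL inty]]]] := noether_normalization j0 psi2.
have [K1 [i1 [w0 w0gen]]] := generic_extension K r.
have [Om [i2 [c /transcendental_evp evp_inj]]] := generic_extension K1 1.
set eps := c ord0 in evp_inj; pose ev : {rmorphism {poly K1} -> Om} := evp i2 eps.
pose j2 : {rmorphism K -> Om} := i2 \o i1; pose eta i := eps * i2 (w0 i).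
pose sP : {rmorphism {mpoly K[r]} -> {poly K1}} := mmap (polyC \o i1) (fun i => 'X * (w0 i)%:P).
have sPE p : mmap j2 eta p = ev (sP p).
  rewrite mmap_comp; apply: mmap_eq => [a|i] /=; first by rewrite evpC.
  by rewrite rmorphM /= evpX evpC.
have eta_indep : alg_indep j2 eta.
  move=> p; rewrite sPE => /evp_inj /(congr1 (horner_eval 1)); rewrite rmorph0 mmap_comp => H.
  apply: w0gen; rewrite -[RHS]H; apply: mmap_eq => [a|i] /=; rewrite /horner_eval ?hornerC //.
  by rewrite hornerM hornerX hornerC mul1r.
(* The place at 0 of the line: a polynomial in [eps] goes to its constant term. *)
pose G0 a b := exists P : {poly K1}, a = ev P /\ b = P`_0.
have sG0 : subring_rel G0.
  split.
  - by exists 1; rewrite rmorph1 coef1.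
  - by move=> _ _ _ _ [A [-> ->]] [B [-> ->]]; exists (A - B); rewrite rmorphB coefB.
  - by move=> _ _ _ _ [A [-> ->]] [B [-> ->]]; exists (A * B); rewrite rmorphM coefM big_ord1.
have fG0 : rel_functional G0 by move=> b [P [/esym /evp_inj -> ->]]; rewrite coef0.
have [G pG subG] := place_extension sG0 fG0; have sG := place_srel pG.
have Gi2 a : G (i2 a) a by apply: subG; exists a%:P; rewrite /= evpC coefC.
have Geps : G eps 0 by apply: subG; exists 'X; rewrite /= evpX coefX.
have eps0 : eps != 0.
  apply/eqP => e; have : ev 'X = 0 by rewrite /= evpX.
  by move/evp_inj/eqP; rewrite polyX_eq0.
have Geta i : G (eta i) 0 by apply: G0_mul => //; exists (w0 i).
have [H [zeta [pH Hrho Hz intz Gz]]] :=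
  @going_down _ _ _ _ j0 j2 i1 _ _ spec2 _ _ _ ai yL inty _ _ pG (fun a => Gi2 (i1 a)) Geta.
have sH := place_srel pH.
have Hj a : H (j0 a) (j2 a) by have := Hrho a%:MP; rewrite /= !mmapC.
pose zeta' i := zeta i + j2 (x' i).
have Hz' i : H (psi' i) (zeta' i).
  by rewrite -[psi' i](subrK (j0 (x' i))); apply: (srelD sH); [exact: Hz|exact: Hj].
have Hmm p : H (mmap j0 psi' p) (mmap j2 zeta' p) by apply: mmap_rel.
have intev z : integralOver (mmap j2 eta) z -> integralOver ev z.
  move=> [q mq rq]; apply: (@integral_root_monic _ _ ev _ (map_poly (mmap j2 eta) q)).
  - exact: monic_map.
  - by [].
  - by apply/integral_poly => l; rewrite coef_map /= sPE; exact: integral_id.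
have intpsi' i : integralOver (mmap j0 y) (psi' i).
  rewrite -[psi' i](subrK (j0 (x' i))); apply: integral_add; first exact: inty.
  by rewrite -(mmapC y); exact: integral_id.
have intzeta' i : integralOver ev (zeta' i).
  apply: integral_add; first exact/intev/intz.
  by rewrite -[j2 _]/(i2 (i1 _)) -(evpC i2 eps); exact: integral_id.
have mm_int (R S : comNzRingType) (F : {rmorphism R -> S}) (g : K -> S) (u : 'I_M' -> S) p :
    (forall a, integralOver F (g a)) -> (forall i, integralOver F (u i)) ->
    integralOver F (mmap g u p).
  move=> Fg Fu; apply: integral_sum => m _; apply: integral_mul => //.
  rewrite /mmap1; elim/big_rec: _ => [|i b _ Hb]; first exact: integral1.
  apply: integral_mul => //; elim: (m i) => [|e IH]; first exact: integral1.
  by rewrite exprS; apply: integral_mul.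
have curve_v j : exists om, H (v j) om /\
    exists l : {poly K1}, l != 0 /\ integralOver ev (ev l * om).
  have [q [q0 rq qi]] := alg _ (codom_f v j).
  have [P eP] := poly_coefs_lift qi.
  have Hq i : H q`_i (mmap j2 zeta' P`_i) by rewrite eP coef_map; exact: Hmm.
  pose a := lead_coef q; have a0 : a != 0 by rewrite lead_coef_eq0.
  pose b := mmap j2 zeta' P`_(size q).-1.
  have Hab : H a b by exact: Hq.
  (* [a] divides a nonzero element of the polynomial ring with a finite cofactor; [b = 0] would send
     that element to 0, against the independence of [eta]. *)
  have b0 : b != 0.
    have inta : integralOver (mmap j0 y) a.
      rewrite /a lead_coefE eP coef_map; apply: mm_int => // e.
      by rewrite -(mmapC y); exact: integral_id.
    have [l [d [l0 intd eld]]] := integral_multiple a0 inta.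
    have [d' Hd] : pfin H d.
      case: intd => Q mQ rQ; apply: (pfin_integral pH _ rQ); first exact: monic_map.
      by move=> i; rewrite coef_map; exists (mmap j2 eta Q`_i); exact: Hrho.
    apply: contra_neq l0 => bz; apply: eta_indep.
    apply: (place_inj pH (Hrho l)); rewrite eld -(mul0r d'); apply: srelM => //.
    by rewrite -bz.
  have [om Hom] : pfin H (v j).
    by apply: (pfin_root pH rq) => [i|]; [exists (mmap j2 zeta' P`_i)|exists b].
  exists om; split=> //.
  pose qH := map_poly (mmap j2 zeta') P.
  have qHb : qH`_(size q).-1 = b by rewrite coef_map.
  have qH0 : qH != 0 by apply: contraNneq b0 => e; rewrite -qHb e coef0.
  have rqH : root qH om.
    apply/rootP/(place_fun pH); rewrite -(rootP rq); apply: poly_rel_horner => // i.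
    by rewrite coef_map.
  have intqH : integral_coefs ev qH.
    move=> i; rewrite coef_map; apply: mm_int => // e.
    by have := integral_id ev (i1 e)%:P; rewrite /= evpC.
  have A0 : lead_coef qH != 0 by rewrite lead_coef_eq0.
  have [l [d [l0 intd eld]]] := integral_multiple A0 (intqH _).
  exists l; split=> //; rewrite /= eld mulrAC; apply: integral_mul => //.
  exact: integral_scaled_root.
have [om Hom] := choice curve_v.
pose psi1 i := map_mpoly i1 (psi i).
have [||s [w Hw]] := algebraic_curve_expansion pG Gi2 (psi := psi1) (x := fun i => i1 (x i)) (k := k)
    eps0 Geps (fun j => proj2 (Hom j)).
- by move=> i a u; rewrite !mmap_map_mpoly; exact: mmap_homog.
- move=> i; rewrite mmap_map_mpoly.
  have -> : mmap (i2 \o i1) om (psi i) = zeta' (f i).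
    apply: (place_inj pH (a := Psi i)); last by rewrite -Hpsi'.
    by apply: mmap_rel => // j; case: (Hom j).
  by rewrite -[i1 _]add0r -Hx'; apply: srelD => //; apply: Gi2.
exists K1, i1, s, w => i; have [h Hh] := Hw i; exists h.
by rewrite -Hh mmap_map_mpoly.
Qed.

(** * Tensor rank and the Leibniz rule *)

Section TensorRank.
Variables (A : comNzRingType) (k m : nat).
Implicit Types T : {ffun 'I_k -> 'I_m} -> A.

(** Lists instead of indexed families, so that decompositions are added by concatenation. *)
Definition rank_le (r : nat) T := exists V : seq ('I_k -> 'I_m -> A),
  (size V <= r)%N /\ forall ix, T ix = \sum_(v <- V) \prod_t v t (ix t).

Lemma rank_le_eq r T T' : T =1 T' -> rank_le r T -> rank_le r T'.
Proof. by move=> e [V [sV HV]]; exists V; split=> // ix; rewrite -e. Qed.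

Lemma rank_le0 : rank_le 0 (fun=> 0).
Proof. by exists [::]; split=> // ix; rewrite big_nil. Qed.

Lemma rank_leD r r' T T' : rank_le r T -> rank_le r' T' ->
  rank_le (r + r') (fun ix => T ix + T' ix).
Proof.
move=> [V [sV HV]] [V' [sV' HV']]; exists (V ++ V'); rewrite size_cat leq_add //.
by split=> // ix; rewrite big_cat HV HV'.
Qed.

Lemma rank_le_sum (I : eqType) (s : seq I) r (T : I -> {ffun 'I_k -> 'I_m} -> A) :
  {in s, forall i, rank_le r (T i)} -> rank_le (size s * r) (fun ix => \sum_(i <- s) T i ix).
Proof.
elim: s => [_|i s IH H] /=.
  by apply: rank_le_eq rank_le0 => ix; rewrite big_nil.
have {}IH := IH (fun j js => H j (mem_behead (s := i :: s) js)).
rewrite mulSn; apply: rank_le_eq (rank_leD (H i (mem_head _ _)) IH) => ix.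
by rewrite big_cons.
Qed.

Lemma rank_le_mon r r' T : (r <= r')%N -> rank_le r T -> rank_le r' T.
Proof. by move=> le [V [sV HV]]; exists V; split=> //; apply: leq_trans le. Qed.
End TensorRank.

Section Leibniz.
Variables (A : comNzRingType) (P : eqType) (D : P -> A -> A) (k : nat).
Hypothesis D_sub : forall p a b, D p (a - b) = D p a - D p b.
Hypothesis D_mul : forall p a b, D p (a * b) = D p a * b + a * D p b.

Definition word_deriv (l : seq P) (a : A) := foldr D a l.

Lemma derivation0 p : D p 0 = 0. Proof. by have := D_sub p 0 0; rewrite !subrr. Qed.
Lemma derivationD p a b : D p (a + b) = D p a + D p b.
Proof.
have DN c : D p (- c) = - D p c by rewrite -sub0r D_sub derivation0 sub0r.
by rewrite -[b]opprK D_sub [in RHS]DN.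
Qed.
Lemma derivation1 p : D p 1 = 0.
Proof.
have := D_mul p 1 1; rewrite !(mulr1, mul1r) => /eqP.
by rewrite -subr_eq subrr eq_sym => /eqP.
Qed.
Lemma derivation_sum p (I : Type) (s : seq I) (Q : pred I) (f : I -> A) :
  D p (\sum_(i <- s | Q i) f i) = \sum_(i <- s | Q i) D p (f i).
Proof. by apply: (big_morph _ (derivationD p) (derivation0 p)). Qed.

Lemma derivation_prod p (a : 'I_k -> A) :
  D p (\prod_t a t) = \sum_t \prod_s (if s == t then D p (a s) else a s).
Proof.
suff H (s : seq 'I_k) : uniq s -> D p (\prod_(t <- s) a t) =
    \sum_(t <- s) \prod_(u <- s) (if u == t then D p (a u) else a u).
  exact/H/index_enum_uniq.
elim: s => [_|t s IH /= /andP[ts us]]; first by rewrite !big_nil derivation1.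
rewrite big_cons D_mul IH // big_cons big_cons eqxx; congr (_ * _ + _).
  rewrite big_seq [RHS]big_seq; apply: eq_bigr => u uS.
  by case: eqP => // e; move: ts; rewrite -e uS.
rewrite mulr_sumr big_seq [RHS]big_seq; apply: eq_bigr => u uS.
by rewrite big_cons; case: eqP => // e; move: ts; rewrite e uS.
Qed.

Fixpoint assignments (d : nat) : seq (seq 'I_k) :=
  if d is d'.+1 then [seq t :: s | t <- enum 'I_k, s <- assignments d'] else [:: [::]].

Lemma size_assignments d : size (assignments d) = (k ^ d)%N.
Proof. by elim: d => //= d IH; rewrite size_allpairs size_enum_ord IH expnS. Qed.

Lemma assignments_size d s : s \in assignments d -> size s = d.
Proof.
elim: d s => [|d IH] s /=; first by rewrite inE => /eqP ->.
by case/allpairsP => [[t u]] /= [_ /IH <- ->].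
Qed.

(** The subword that [tau] assigns to the factor [t]; the order is kept since the derivations need
    not commute. *)
Definition positions (l : seq P) (tau : seq 'I_k) t := [seq q.1 | q <- zip l tau & q.2 == t].

(** Iterated Leibniz rule: in each term every letter hits exactly one factor. *)
Lemma word_deriv_prod (l : seq P) (a : 'I_k -> A) :
  word_deriv l (\prod_t a t) =
  \sum_(tau <- assignments (size l)) \prod_t word_deriv (positions l tau t) (a t).
Proof.
elim: l => [|p l IH] /=; first by rewrite big_seq1.
rewrite [LHS]/= IH derivation_sum big_allpairs_dep exchange_big /=; apply: eq_bigr => tau _.
rewrite derivation_prod big_enum /=; apply: eq_bigr => t _; apply: eq_bigr => s _.
by rewrite /positions /= eq_sym; case: eqP.
Qed.

Lemma positions_sub l tau t : {subset positions l tau t <= l}.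
Proof.
move=> p /mapP[[q s] + ->]; rewrite mem_filter => /andP[_].
by elim: l tau => [|q' l IH] [|s' tau] //=; rewrite !inE => /predU1P[[-> _]|/IH ->]; rewrite ?eqxx ?orbT.
Qed.

Lemma positions_inj l tau p t t' : uniq l ->
  p \in positions l tau t -> p \in positions l tau t' -> t = t'.
Proof.
elim: l tau => [|q l IH] [|s tau] // ul.
have [ql {}ul] : q \notin l /\ uniq l by apply/andP.
have posE u : positions (q :: l) (s :: tau) u =
    if s == u then q :: positions l tau u else positions l tau u.
  by rewrite /positions /=; case: eqP.
have nq u : p \in positions l tau u -> p != q.
  by move/positions_sub => pl; apply: contraNneq ql => <-.
rewrite !posE; case: (eqVneq s t) => [st|_]; case: (eqVneq s t') => [st'|_].
- by rewrite -st -st'.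
- rewrite inE => /predU1P[e|pt] pt'; last exact: IH ul pt pt'.
  by have := nq _ pt'; rewrite e eqxx.
- by move=> pt; have pq := nq _ pt; rewrite inE (negbTE pq) /=; exact: IH ul pt.
- exact: IH.
Qed.

Lemma positions_uniq l tau t : uniq l -> uniq (positions l tau t).
Proof.
elim: l tau => [|q l IH] [|s tau] // /andP[ql ul]; rewrite /positions /=.
have H : uniq (positions l tau t) by exact: IH.
case: eqP => // _; rewrite /= H andbT; apply: contra ql; exact: (@positions_sub l tau t).
Qed.

Lemma positions_size l tau : size tau = size l -> (\sum_t size (positions l tau t))%N = size l.
Proof.
elim: l tau => [|q l IH] [|s tau] //=; first by rewrite big1.
move=> [/IH e]; rewrite -[in RHS]e (bigD1 s) //= [in RHS](bigD1 s) //=.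
rewrite /positions /= eqxx /= addSn; congr (_.+1); congr (_ + _)%N.
by apply: eq_bigr => t /negbTE ts; rewrite eq_sym ts.
Qed.
End Leibniz.

Lemma word_deriv_eq (A : comNzRingType) (P : eqType) (D D' : P -> A -> A) l a :
  {in l, D =1 D'} -> word_deriv D l a = word_deriv D' l a.
Proof.
elim: l => //= p l IH H; rewrite IH; last by move=> q ql; apply: H; rewrite inE ql orbT.
by rewrite H ?mem_head.
Qed.

Section Counting.
Variables (A : comNzRingType) (k m d n : nat) (D : 'I_n -> A -> A).
Hypothesis D_sub : forall p a b, D p (a - b) = D p a - D p b.
Hypothesis D_mul : forall p a b, D p (a * b) = D p a * b + a * D p b.
Hypotheses (k0 : (0 < k)%N) (n0 : (0 < n)%N).

(** The letters are positions, mapped to variables by [w]. Positions stay distinct when [w] repeats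
    a variable, so an assignment to the factors does not depend on [w]. *)
Definition word_op (w : {ffun 'I_d -> 'I_n}) (s : seq 'I_d) a :=
  word_deriv (fun p => D (w p)) s a.

Lemma large_class (tau : seq 'I_k) : size tau = d ->
  exists t, (d <= k * size (positions (enum 'I_d) tau t))%N.
Proof.
move=> st; have := @positions_size _ _ (enum 'I_d) tau.
rewrite size_enum_ord => /(_ st) sumd; apply/existsP; apply: contraT.
rewrite negb_exists => /forallP H.
have : (\sum_(t < k) (k * size (positions (enum 'I_d) tau t)).+1 <= \sum_(t < k) d)%N.
  by apply: leq_sum => t _; rewrite ltnNge H.
rewrite sum_nat_const card_ord; under eq_bigr do rewrite -addn1.
rewrite big_split /= -big_distrr /= sumd sum1_card card_ord.
by rewrite -ltn_subRL subnn ltn0 || (move=> ?; lia).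
Qed.

(* The words are grouped by their letters outside the largest class t: the
   factors other than the t-th depend only on those letters. *)
Lemma rank_assignment (g : {ffun 'I_d -> 'I_n} -> A) (W : 'I_k -> 'I_m -> A) (tau : seq 'I_k) :
  size tau = d ->
  rank_le (n ^ (k.-1 * d %/ k)) (fun ix : {ffun 'I_k -> 'I_m} => \sum_w g w *
    \prod_t word_op w (positions (enum 'I_d) tau t) (W t (ix t))).
Proof.
move=> st; have [t0 ht0] := large_class st.
pose C := positions (enum 'I_d) tau t0; pose i0 := Ordinal n0.
(* The default [i0] on [C] gives one canonical word per group, so the groups can be counted. *)
pose mk (w : {ffun 'I_d -> 'I_n}) := [ffun p => if p \in C then i0 else w p].
pose Im := codom mk.
have cIm : (#|Im| <= n ^ (k.-1 * d %/ k))%N.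
  (* There are at most [n] to the power [d - size C] groups, and [d <= k * size C] bounds this
     exponent by [k.-1 * d %/ k]. *)
  apply: (@leq_trans #|pffun_on i0 (predC (mem C)) predT|).
    apply/subset_leq_card/fintype.subsetP => _ /codomP[w ->]; apply/pffun_onP; split.
      by apply/supportP => p; rewrite !inE negbK ffunE => ->.
    by [].
  rewrite card_pffun_on card_ord leq_pexp2l // leq_divRL //.
  have uC : uniq C by apply/positions_uniq/enum_uniq.
  have := cardC (mem C); rewrite (card_uniqP uC) card_ord => cC.
  by rewrite -/C in ht0; move: ht0 cC; set c := size C; set c' := #|_| => *; nia.
(* The factor [t0] absorbs the coefficients [g] and the sum over a group. *)
pose v u t := if t == t0 then fun i => \sum_(w | mk w == u) g w * word_op w C (W t0 i)
  else fun i => word_op u (positions (enum 'I_d) tau t) (W t i).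
exists [seq v u | u <- enum Im]; rewrite size_map -cardE; split=> // ix.
rewrite big_map big_enum /= (partition_big mk (mem Im)) /=; last first.
  by move=> w _; exact: codom_f.
apply: eq_bigr => u _; rewrite [RHS](bigD1 t0) //= {1}/v eqxx mulr_suml.
apply: eq_bigr => w /eqP mwu; rewrite (bigD1 t0) //= mulrA; congr (_ * _).
apply: eq_bigr => t /negbTE tt0; rewrite /v tt0; apply: word_deriv_eq => p pt.
rewrite -mwu ffunE; case: ifP => // pC.
by have := positions_inj (enum_uniq _) pt pC => e; rewrite e eqxx in tt0.
Qed.

Lemma rank_word_sum (g : {ffun 'I_d -> 'I_n} -> A) (V : seq ('I_k -> 'I_m -> A)) :
  rank_le (size V * (k ^ d * n ^ (k.-1 * d %/ k))) (fun ix : {ffun 'I_k -> 'I_m} =>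
    \sum_w g w * word_op w (enum 'I_d) (\sum_(W <- V) \prod_t W t (ix t))).
Proof.
have op_sum w s (I : Type) (r : seq I) (f : I -> A) :
    word_op w s (\sum_(i <- r) f i) = \sum_(i <- r) word_op w s (f i).
  by elim: s => //= p s; rewrite /word_op /= => ->; rewrite (derivation_sum (fun p => D_sub (w p))).
elim: V => [|W V IH] /=.
  apply: rank_le_eq (rank_le_mon _ (rank_le0 _ _ _)) => // ix.
  by rewrite big1 // => w _; rewrite op_sum big_nil mulr0.
rewrite mulSn; have HW : rank_le (k ^ d * n ^ (k.-1 * d %/ k)) (fun ix : {ffun 'I_k -> 'I_m} =>
    \sum_w g w * word_op w (enum 'I_d) (\prod_t W t (ix t))).
  rewrite -(size_assignments k d); apply: rank_le_eq (@rank_le_sum _ _ _ _ _ _ _ _) => [ix|]; last first.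
    by move=> tau /assignments_size /(rank_assignment g W); apply.
  rewrite exchange_big /=; apply: eq_bigr => w _.
  rewrite /word_op (word_deriv_prod (fun p => D_sub (w p)) (fun p => D_mul (w p))).
  by rewrite mulr_sumr size_enum_ord.
apply: rank_le_eq (rank_leD HW IH) => ix; rewrite -big_split /=; apply: eq_bigr => w _.
by rewrite -mulrDr !op_sum big_cons.
Qed.
End Counting.

(** * A generic curve *)

Section Los.
Variables (X : Type) (F : closedFieldType) (U : set_system X).
Hypothesis UU : UltraFilter U.
Local Notation K := (upow F UU : closedFieldType).
Local Notation cl := (ucl UU).

(** The member at index [c] of the family that represents [p], through chosen representatives of its
    coefficients. *)
Definition mpoly_rep n (p : {mpoly K[n]}) (c : X) : {mpoly F[n]} :=
  \sum_(m <- msupp p) repr p@_m c *: 'X_[m].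

Lemma meval_ucl n (u : 'I_n -> X -> F) (p : {mpoly K[n]}) :
  p.@[fun i => cl (u i)] = cl (fun c => (mpoly_rep p c).@[fun i => u i c]).
Proof.
rewrite mevalE [in RHS](_ : (fun c => _) =
    (fun c => \sum_(m <- msupp p) repr p@_m c * \prod_i u i c ^+ m i)); last first.
  apply/funext => c; rewrite raddf_sum /=; apply: eq_bigr => m _.
  by rewrite mevalZ mevalX.
rewrite ucl_sum; apply: eq_bigr => m _; rewrite uclM; congr (_ * _).
  by rewrite /ucl reprK.
by rewrite ucl_prod; apply: eq_bigr => i _; rewrite ucl_exp.
Qed.

(** Los's theorem for one statement: if [mpoly_rep p c] were nonzero somewhere on the image for
    almost all [c], the chosen witnesses would form a point over the ultrapower at which [p] does
    not vanish. *)
Lemma closure_transfer n M (psi : 'I_M -> {mpoly F[n]}) (x : 'I_M -> X -> F) :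
  (forall c (p : {mpoly F[M]}), (forall v, p.@[fun i => (psi i).@[v]] = 0) ->
     p.@[fun i => x i c] = 0) ->
  forall p : {mpoly K[M]}, (forall v, p.@[fun i => (map_mpoly (uconst UU) (psi i)).@[v]] = 0) ->
    p.@[fun i => cl (x i)] = 0.
Proof.
move=> H p Hp; rewrite meval_ucl.
pose S : set X := [set c | forall v, (mpoly_rep p c).@[fun i => (psi i).@[v]] = 0]%classic.
have [US|USc] := in_ultra_setVsetC S UU.
  by apply/uclP; apply: filterS US => c Sc; apply: H.
have exv c : exists v : 'I_n -> F, ~ S c -> (mpoly_rep p c).@[fun i => (psi i).@[v]] <> 0.
  case: (pselect (S c)) => Sc; first by exists (fun=> 0).
  by apply: contrapT => nv; apply: Sc => v; apply: contrapT => pv; apply: nv; exists v.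
have [v Hv] := choice exv.
have := Hp (fun j => cl (fun c => v c j)).
have -> : (fun i => (map_mpoly (uconst UU) (psi i)).@[fun j => cl (fun c => v c j)]) =
   (fun i => cl (fun c => (psi i).@[v c])).
  by apply/funext => i; rewrite /meval mmap_map_mpoly /= -mmap_ucl.
rewrite meval_ucl => /uclP Uz.
have PU : ProperFilter U by exact: ultra_proper.
by have [c [/Hv nz /nz]] := @filter_ex _ _ PU _ (filterI USc Uz).
Qed.
End Los.

Lemma generic_curve (F : closedFieldType) n N M k (psi : 'I_M -> {mpoly F[N]})
    (P : 'I_M -> {mpoly F[n]}) :
  (forall i, psi i \is k.-homog) ->
  (forall c (p : {mpoly F[M]}), (forall v, p.@[fun i => (psi i).@[v]] = 0) ->
     p.@[fun i => (P i).@[c]] = 0) ->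
  exists (K : closedFieldType) (iota : {rmorphism F -> K}) (c : 'I_n -> K),
    alg_indep iota c /\ exists (s : nat) (w : 'I_N -> {poly K}), forall i, exists h,
      mmap (polyC \o iota) w (psi i) = 'X^s * ((mmap iota c (P i))%:P + 'X * h).
Proof.
move=> hom H; have [U [UU Ugen]] := exists_generic F n.
pose K : closedFieldType := upow F UU; pose u : {rmorphism F -> K} := uconst UU.
pose x i : K := ucl UU (fun c => (P i).@[c]).
have homK i : map_mpoly u (psi i) \is k.-homog.
  apply/dhomogP => m; rewrite mcoeff_msupp mcoeff_map_mpoly => /= um.
  move/dhomogP: (hom i); apply; rewrite mcoeff_msupp.
  by apply: contra_neq um => ->; rewrite rmorph0.
have [K1 [i1 [s [w Hw]]]] := curve_selection homK (closure_transfer (UU := UU) (x := fun i c => (P i).@[c]) H).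
exists K1, (i1 \o u), (fun i => i1 (gpt UU i)); split.
  move=> p; rewrite -(mmap_comp i1 u (gpt UU)) => /eqP; rewrite fmorph_eq0 => /eqP.
  exact: gpt_generic.
exists s, w => i; have [h Hh] := Hw i; exists h.
rewrite -(mmap_comp i1 u (gpt UU)) [mmap _ _ (P i)]mmap_ucl -Hh.
by rewrite mmap_map_mpoly.
Qed.

(** * Border rank *)

Section TensorPolynomials.
Variables (F : closedFieldType) (r k m : nat).
Local Notation I := (tidx m k).
Local Notation V := ('I_r * 'I_k * 'I_m)%type.

(** A coordinate of the universal sum of [r] products, with the entries of all vectors as
    variables. *)
Definition tensor_poly (ix : I) : {mpoly F[#|{: V}|]} :=
  \sum_(j < r) \prod_(t < k) 'X_(enum_rank (j, t, ix t)).

Lemma tensor_poly_homog ix : tensor_poly ix \is k.-homog.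
Proof.
apply: rpred_sum => j _; rewrite mprodXE dhomogX /= mdeg_sum.
by under eq_bigr do rewrite mdeg1; rewrite sum_nat_const card_ord muln1.
Qed.

Lemma mmap_tensor_poly (S : comNzRingType) (f : {rmorphism F -> S}) (u : 'I_#|{: V}| -> S) ix :
  mmap f u (tensor_poly ix) = \sum_(j < r) \prod_(t < k) u (enum_rank (j, t, ix t)).
Proof.
rewrite rmorph_sum; apply: eq_bigr => j _; rewrite rmorph_prod; apply: eq_bigr => t _.
by rewrite /= mmapX mmap1U.
Qed.

Lemma trk_leP (y : I -> F) : trk_le r [ffun ix => y ix] <->
  exists u, forall ix, y ix = (tensor_poly ix).@[u].
Proof.
split=> [[v /ffunP Hv]|[u Hu]].
  exists (fun i => let: (j, t, l) := enum_val i in v j t l) => ix.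
  have := Hv ix; rewrite !ffunE => ->; rewrite [RHS](mmap_tensor_poly idfun).
  by apply: eq_bigr => j _; apply: eq_bigr => t _; rewrite enum_rankK.
exists (fun j t l => u (enum_rank (j, t, l))); apply/ffunP => ix.
by rewrite !ffunE Hu [LHS](mmap_tensor_poly idfun).
Qed.
End TensorPolynomials.

Section SyntacticPolynomials.
Variables (F : fieldType) (I : finType).

Definition of_defs (p : Defs.mpoly F I) : {mpoly F[#|I|]} :=
  \sum_(t <- p) t.1 *: 'X_[[multinom t.2 (enum_val i) | i < #|I|]].
Definition to_defs (p : {mpoly F[#|I|]}) : Defs.mpoly F I :=
  [seq (p@_m, [ffun i => m (enum_rank i)]) | m <- msupp p].

Lemma meval_of_defs p (x : I -> F) : (of_defs p).@[fun i => x (enum_val i)] = Defs.meval p x.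
Proof.
rewrite /of_defs raddf_sum /Defs.meval; apply: eq_bigr => t _.
rewrite /= mevalZ mevalX; congr (_ * _).
rewrite [RHS](reindex (@enum_val I I)); last by apply: onW_bij; exact: enum_val_bij.
by apply: eq_bigr => i _; rewrite mnmE.
Qed.

Lemma meval_to_defs p (x : I -> F) : Defs.meval (to_defs p) x = p.@[fun i => x (enum_val i)].
Proof.
rewrite /Defs.meval /to_defs big_map mevalE; apply: eq_bigr => m _ /=; congr (_ * _).
rewrite (reindex (@enum_val I I)); last by apply: onW_bij; exact: enum_val_bij.
by apply: eq_bigr => i _; rewrite ffunE enum_valK.
Qed.
End SyntacticPolynomials.

Section BorderRank.
Variables (F : closedFieldType) (m k : nat).
Hypothesis k0 : (0 < k)%N.
Implicit Types T : Ten F m k.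
Local Notation I := (tidx m k).

(** Short lists are padded with zero vectors; the added products vanish because [k] is positive. *)
Lemma rank_le_vectors (S : comNzRingType) r (T : I -> S) : rank_le r T ->
  exists v : 'I_r -> 'I_k -> 'I_m -> S, forall ix, T ix = \sum_(j < r) \prod_(t < k) v j t (ix t).
Proof.
move=> [V [sV HV]]; exists (fun j => nth (fun _ _ => 0) V j) => ix.
rewrite HV (big_nth (fun _ _ => 0)) big_mkord.
rewrite (big_ord_widen r (fun j => \prod_t nth (fun _ _ => 0) V j t (ix t)) sV).
rewrite big_mkcond; apply: eq_bigr => j _; case: ltnP => // le.
by rewrite nth_default // (bigD1 (Ordinal k0)) //= mul0r.
Qed.

Lemma trk_rank r T : trk_le r T <-> rank_le r (fun ix => T ix).
Proof.
split=> [[v Hv]|/rank_le_vectors [v Hv]]; last first.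
  by exists v; apply/ffunP => ix; rewrite ffunE.
exists [seq v j | j <- enum 'I_r]; rewrite size_map size_enum_ord; split=> // ix.
by rewrite Hv ffunE big_map big_enum.
Qed.

Lemma brk_le_mon r r' T : (r <= r')%N -> brk_le r T -> brk_le r' T.
Proof.
move=> le H p Hp; apply: H => y /trk_rank /(rank_le_mon le) /trk_rank; exact: Hp.
Qed.

(** The expansion in standard basis tensors, each coefficient put into the first factor. *)
Lemma trk_le_card T : trk_le #|{: I}| T.
Proof.
apply/trk_rank; pose v (jx : I) (t : 'I_k) l :=
  (if t == Ordinal k0 then T jx else 1) * (jx t == l)%:R.
exists [seq v jx | jx <- enum {: I}]; rewrite size_map -cardE; split=> // ix.
rewrite big_map big_enum /= (bigD1 ix) //= [X in _ + X]big1 ?addr0; last first.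
- move=> jx jxN; have [t jt] : exists t, jx t != ix t.
    by apply/existsP; rewrite -negb_forall; apply: contra jxN => /forallP H; apply/eqP/ffunP => t; apply/eqP.
  by rewrite (bigD1 t) //= /v (negbTE jt) mulr0 mul0r.
- rewrite (bigD1 (Ordinal k0)) //= /v !eqxx mulr1 big1 ?mulr1 // => t /negbTE ->.
  by rewrite eqxx mulr1.
Qed.

Lemma brk_spec T : is_brk T (brk T).
Proof.
apply: ClassicalEpsilon.epsilon_spec.
have ex : exists r, `[< brk_le r T >].
  exists #|{: I}|; apply/asboolP => p; apply.
  by have := trk_le_card T; congr trk_le; apply/ffunP => ix; rewrite ffunE.
case: (ex_minnP ex) => r /asboolP Hr minr; exists r; split=> // r' Hr'.
by apply: minr; apply/asboolP.
Qed.

Lemma brk_leP r T : (brk T <= r)%N <-> brk_le r T.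
Proof.
by have [H minH] := brk_spec T; split=> [le|]; [exact: brk_le_mon H|exact: minH].
Qed.

Local Notation psi r := (fun i : 'I_#|{: I}| => tensor_poly F r (enum_val i)).

Lemma brk_le_eqs r T : brk_le r T <-> forall p : {mpoly F[#|{: I}|]},
  (forall v, p.@[fun i => (psi r i).@[v]] = 0) -> p.@[fun i => T (enum_val i)] = 0.
Proof.
split=> [H p Hp|H p Hp].
  rewrite -meval_to_defs; apply: H => y /trk_leP[u Hu].
  by rewrite meval_to_defs -[RHS](Hp u); apply: meval_eq => i; rewrite Hu.
rewrite -meval_of_defs; apply: H => v.
rewrite (meval_of_defs p (fun ix => (tensor_poly F r ix).@[v])); apply: Hp.
by apply/trk_leP; exists v.
Qed.

(* F being infinite, the hypothesis on p is a polynomial identity. *)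
Lemma vanishing_extension r (L : closedFieldType) (iota : {rmorphism F -> L})
    (p : {mpoly F[#|{: I}|]}) (z : I -> L) :
  (forall v, p.@[fun i => (psi r i).@[v]] = 0) -> rank_le r z ->
  mmap iota (fun i => z (enum_val i)) p = 0.
Proof.
move=> Hp /rank_le_vectors [v Hv].
have p0 : mmap (@mpolyC _ F) (psi r) p = 0.
  apply/eqP; apply: contraT => /mpoly_nonroot[u /eqP []].
  rewrite mmap_comp -[RHS](Hp u); apply: mmap_eq => // a /=; exact: mevalC.
pose u (i : 'I_#|{: 'I_r * 'I_k * 'I_m}|) : L := let: (j, t, l) := enum_val i in v j t l.
have := congr1 (mmap iota u) p0; rewrite mmap0 mmap_comp => H; rewrite -[RHS]H.
apply: mmap_eq => [a|i] /=; first by rewrite mmapC.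
rewrite mmap_tensor_poly Hv; apply: eq_bigr => j _; apply: eq_bigr => t _.
by rewrite /u enum_rankK.
Qed.
End BorderRank.

(** * Differential operators and coefficients *)

Section Apolarity.
Variables (F : fieldType) (n d : nat).
Hypotheses (charF : [pchar F] =i pred0) (n0 : (0 < n)%N).
Implicit Types (e : mon n d) (w : {ffun 'I_d -> 'I_n}).

Definition mon_mnm e : 'X_{1..n} := [multinom (val e i : nat) | i < n].
Definition multinomial e : nat := (d`! %/ \prod_(i < n) (val e i : nat)`!)%N.

Lemma mdeg_mon e : mdeg (mon_mnm e) = d.
Proof. by rewrite mdegE -[RHS](eqP (valP e)); apply: eq_bigr => i _; rewrite mnmE. Qed.

(** Serves to show that the truncated quotient in [multinomial] is positive. *)
Lemma prod_fact_le (I : Type) (s : seq I) (a : I -> nat) :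
  (\prod_(i <- s) (a i)`! <= (\sum_(i <- s) a i)`!)%N.
Proof.
elim: s => [|i s IH]; first by rewrite !big_nil.
rewrite !big_cons -(@bin_fact (a i + \sum_(j <- s) a j) (a i)) ?leq_addr //.
rewrite addKn mulnA -[X in (X <= _)%N]mul1n -mulnA leq_mul ?bin_gt0 ?leq_addr //.
by rewrite leq_mul2l IH orbT.
Qed.

Lemma multinomial_gt0 e : (0 < multinomial e)%N.
Proof.
rewrite divn_gt0; last by rewrite prodn_gt0 // => i; exact: fact_gt0.
by rewrite -[in X in (_ <= X)%N](eqP (valP e)) prod_fact_le.
Qed.

Lemma natF_neq0 a : (0 < a)%N -> a%:R != 0 :> F.
Proof. by move/pcharf0P: charF => ->; rewrite lt0n. Qed.

Lemma word_mderiv w (q : {mpoly F[n]}) :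
  word_op (@mderiv n F) w (enum 'I_d) q = q^`M[\sum_(p < d) U_(w p)].
Proof.
rewrite -big_enum /word_op /=; elim: (enum 'I_d) => [|p l IH] /=.
  by rewrite big_nil mderivm0m.
by rewrite IH big_cons addmC mderivmDm mderivmU1m.
Qed.

Lemma mon_word e : exists w, (\sum_(p < d) U_(w p))%MM = mon_mnm e.
Proof.
have sz : size (m2s (mon_mnm e)) = d by rewrite size_m2s mdeg_mon.
exists [ffun p : 'I_d => nth (Ordinal n0) (m2s (mon_mnm e)) p].
rewrite -[RHS]s2mK; apply/mnmP => i; rewrite mnm_sumE mnmE -sum1_count.
rewrite [RHS]big_mkcond (big_nth (Ordinal n0)) sz big_mkord; apply: eq_bigr => p _.
by rewrite ffunE mnm1E /=; case: (_ == i).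
Qed.

(** Of two different monomials of equal degree, each has a smaller exponent than the other
    somewhere; there the derivative kills it. *)
Lemma mderivm_mon e e' : ('X_[F, mon_mnm e'])^`M[mon_mnm e] =
  ((e == e') * \prod_(i < n) (val e i : nat)`!)%:R%:MP.
Proof.
rewrite mderivmX; case: eqVneq => [->|ne].
  rewrite -mul_mpolyC (_ : _ - _ = 0)%MM; last by apply/mnmP => i; rewrite !mnmE subnn.
  rewrite mpolyX0 mulr1 mul1n; congr (_%:R%:MP).
  by apply: eq_bigr => i _; rewrite mnmE ffactnn.
have [i lti] : exists i, (val e' i < val e i)%N.
  apply/existsP; apply: contraT; rewrite negb_exists => /forallP H.
  have le i : (val e i <= val e' i)%N by rewrite leqNgt H.
  suff : e == e' by rewrite (negbTE ne).
  have [_] := leqif_sum (P := predT) (fun i _ => leqif_eq (le i)).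
  rewrite (eqP (valP e)) (eqP (valP e')) eqxx => /esym/forallP H'.
  by apply/eqP/val_inj/ffunP => i; apply/val_inj/eqP/H'.
by rewrite (bigD1 i) //= !mnmE ffact_small // mul0n scale0r mpolyC0.
Qed.

(* A word of letters with content e differentiates every monomial of degree d
   other than 'X^e to 0. *)
Lemma coefficients_by_words (Y : mon n d -> F) : exists g : {ffun 'I_d -> 'I_n} -> F,
  forall T : mon n d -> F,
    \sum_w g w *: word_op (@mderiv n F) w (enum 'I_d)
        (\sum_e ((multinomial e)%:R * T e) *: 'X_[mon_mnm e])
      = (\sum_e Y e * T e)%:MP.
Proof.
have [W HW] := choice mon_word.
pose b e := Y e / ((multinomial e)%:R * (\prod_(i < n) (val e i : nat)`!)%:R).
exists (fun w => \sum_(e | W e == w) b e) => T.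
under eq_bigr do rewrite scaler_suml.
rewrite (exchange_big_dep predT) //= rmorph_sum; apply: eq_bigr => e _.
rewrite (big_pred1 (W e)) => [|w]; last by rewrite eq_sym.
rewrite word_mderiv HW raddf_sum (bigD1 e) //= big1 => [|e' ne]; last first.
  by rewrite mderivmZ mderivm_mon eq_sym (negbTE ne) mul0n mpolyC0 scaler0.
rewrite addr0 mderivmZ mderivm_mon eqxx mul1n -!mul_mpolyC -!mpolyCM; congr (_%:MP).
rewrite /b; set N := _%:R; set p := _%:R.
have N0 : N != 0 by rewrite natF_neq0 ?multinomial_gt0.
have p0 : p != 0 by rewrite natF_neq0 ?prodn_gt0 // => i; exact: fact_gt0.
by field; rewrite N0 p0.
Qed.
End Apolarity.

(** Independence of [c] makes partial differentiation well defined on [F[c]], and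
    [derivation_extension] carries it to [K]. *)
Lemma partial_derivations (F K : fieldType) (iota : {rmorphism F -> K}) n (c : 'I_n -> K) :
  [pchar F] =i pred0 -> alg_indep iota c ->
  exists D : 'I_n -> K -> K, [/\ forall i a b, D i (a - b) = D i a - D i b,
    forall i a b, D i (a * b) = D i a * b + a * D i b &
    forall i p, D i (mmap iota c p) = mmap iota c (mderiv i p)].
Proof.
move=> charF ind.
have charK : [pchar K] =i pred0 by move=> p; rewrite (fmorph_pchar iota) charF.
have exD i : exists D : K -> K, [/\ forall a b, D (a - b) = D a - D b,
    forall a b, D (a * b) = D a * b + a * D b &
    forall p, D (mmap iota c p) = mmap iota c (mderiv i p)].
  pose D0 (x y : K) := exists p, x = mmap iota c p /\ y = mmap iota c (mderiv i p).
  have [|D [D_sub D_mul HD]] := derivation_extension charK (D0 := D0); last first.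
    by exists D; split=> // p; apply: HD; exists p.
  split.
  - by exists 1; rewrite rmorph1 -mpolyC1 mderivC mmap0.
  - move=> _ _ _ _ [p [-> ->]] [q [-> ->]]; exists (p - q).
    by rewrite mderivB !mmapB.
  - move=> _ _ _ _ [p [-> ->]] [q [-> ->]]; exists (p * q).
    by rewrite mderivM mmapD !rmorphM.
  - by move=> _ [p [/esym/ind -> ->]]; rewrite mderiv0 mmap0.
have [D HD] := choice exD.
by exists D; split=> i; have [] := HD i.
Qed.

Section CoefficientwiseDerivation.
Variables (K : fieldType) (D : K -> K).
Hypothesis D_sub : forall a b, D (a - b) = D a - D b.
Hypothesis D_mul : forall a b, D (a * b) = D a * b + a * D b.

(** ['X] is a constant for this derivation, so powers of ['X] pass through it. *)
Definition poly_der (q : {poly K}) : {poly K} := \poly_(l < size q) D q`_l.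

Let D_0 : D 0 = 0.
Proof. by have := D_sub 0 0; rewrite !subrr. Qed.

Lemma coef_poly_der q l : (poly_der q)`_l = D q`_l.
Proof. by rewrite coef_poly; case: ltnP => // le; rewrite nth_default. Qed.

Lemma poly_derB p q : poly_der (p - q) = poly_der p - poly_der q.
Proof. by apply/polyP => l; rewrite !(coef_poly_der, coefB). Qed.

Lemma poly_derM p q : poly_der (p * q) = poly_der p * q + p * poly_der q.
Proof.
apply/polyP => l; rewrite coef_poly_der coefD !coefM.
rewrite (derivation_sum (D := fun=> D) (fun=> D_sub) tt) -big_split /=; apply: eq_bigr => j _.
by rewrite D_mul !coef_poly_der.
Qed.

Lemma poly_derXM p : poly_der ('X * p) = 'X * poly_der p.
Proof.
by apply/polyP => [[|l]]; rewrite coef_poly_der !coefXM //= coef_poly_der.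
Qed.

Lemma poly_derXnM s p : poly_der ('X^s * p) = 'X^s * poly_der p.
Proof. by elim: s => [|s IH]; rewrite ?expr0 ?mul1r // exprS -!mulrA poly_derXM IH. Qed.

Lemma poly_derD p q : poly_der (p + q) = poly_der p + poly_der q.
Proof. exact: (derivationD (D := fun=> poly_der) (fun=> poly_derB) tt). Qed.

Lemma poly_derC a : poly_der a%:P = (D a)%:P.
Proof. by apply/polyP => l; rewrite coef_poly_der !coefC; case: ifP. Qed.
End CoefficientwiseDerivation.

Lemma word_op_poly_der (F K : fieldType) (iota : {rmorphism F -> K}) n (c : 'I_n -> K)
    (D : 'I_n -> K -> K) (s d : nat) (w : {ffun 'I_d -> 'I_n}) l (p : {mpoly F[n]}) (h : {poly K}) :
  (forall i a b, D i (a - b) = D i a - D i b) ->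
  (forall i p, D i (mmap iota c p) = mmap iota c (mderiv i p)) ->
  word_op (fun i => poly_der (D i)) w l ('X^s * ((mmap iota c p)%:P + 'X * h)) =
  'X^s * ((mmap iota c (word_op (@mderiv n F) w l p))%:P
          + 'X * word_op (fun i => poly_der (D i)) w l h).
Proof.
move=> D_sub HD; elim: l => //= i l; rewrite /word_op /= => ->.
by rewrite poly_derXnM // poly_derD // poly_derC // poly_derXM // HD.
Qed.

Lemma poly_eq0_off0 (K : closedFieldType) (q : {poly K}) :
  (forall x, x != 0 -> q.[x] = 0) -> q = 0.
Proof.
move=> H; apply/eqP; apply: contraT => q0.
have /closed_nonrootP [x] : q * 'X != 0 by rewrite mulf_neq0 ?polyX_eq0.
rewrite /root hornerM hornerX mulf_eq0 => /norP[+ x0].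
by rewrite H // eqxx.
Qed.

Lemma rank_le_map (A B : comNzRingType) (f : {rmorphism A -> B}) k m r
    (T : {ffun 'I_k -> 'I_m} -> A) : rank_le r T -> rank_le r (fun ix => f (T ix)).
Proof.
move=> [V [sV HV]]; exists [seq fun t i => f (v t i) | v <- V]; rewrite size_map.
split=> // ix; rewrite HV rmorph_sum big_map; apply: eq_bigr => v _; exact: rmorph_prod.
Qed.

Lemma rank_le_scale (A : comNzRingType) k m r (a : A) (T : {ffun 'I_k -> 'I_m} -> A) :
  (0 < k)%N -> rank_le r T -> rank_le r (fun ix => a * T ix).
Proof.
move=> k0 [V [sV HV]]; pose i0 := Ordinal k0.
exists [seq fun t i => (if t == i0 then a else 1) * v t i | v <- V]; rewrite size_map.
split=> // ix; rewrite HV mulr_sumr big_map; apply: eq_bigr => v _.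
by rewrite big_split /= -big_mkcond /= big_pred1_eq.
Qed.

(** * From the generic curve to the border rank of every [phi f] *)

Section Main.
Variables (F : closedFieldType) (d k n m : nat).
Hypotheses (charF : [pchar F] =i pred0) (k0 : (0 < k)%N) (n0 : (0 < n)%N).
Variable phi : {linear Pol F n d -> Ten F m k}.
Local Notation I := (tidx m k).

Let delta (e : mon n d) : Pol F n d := [ffun e' => (e' == e)%:R].

Let phiE (f : Pol F n d) ix : phi f ix = \sum_e f e * phi (delta e) ix.
Proof.
have {1}-> : f = \sum_e f e *: delta e.
  apply/ffunP => e; rewrite sum_ffunE (bigD1 e) //= big1 => [|e' ne]; last first.
    by rewrite !ffunE eq_sym (negbTE ne) scaler0.
  by rewrite addr0 !ffunE eqxx [RHS]mulr1.
by rewrite linear_sum sum_ffunE; apply: eq_bigr => e _; rewrite linearZ !ffunE.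
Qed.

(** Coordinate [ix] of the image of the d-th power of a linear form, as a polynomial in the
    coefficients of that form. *)
Definition powers_poly ix : {mpoly F[n]} :=
  \sum_e ((multinomial e)%:R * phi (delta e) ix) *: 'X_[mon_mnm e].

Lemma meval_powers_poly c ix : (powers_poly ix).@[c] = phi (lin_pow d c) ix.
Proof.
rewrite phiE raddf_sum; apply: eq_bigr => e _.
rewrite /= mevalZ mevalX ffunE mulrAC; congr (_ * _ * _).
by apply: eq_bigr => i _; rewrite mnmE.
Qed.

Lemma brk_le_of_powers a : (forall c, brk_le a (phi (lin_pow d c))) ->
  forall f, brk_le (a * (k ^ d * n ^ (k.-1 * d %/ k))) (phi f).
Proof.
move=> Ha f.
have closure c (p : {mpoly F[#|{: I}|]}) : (forall v, p.@[fun i => (tensor_poly F a (enum_val i)).@[v]] = 0) ->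
    p.@[fun i => (powers_poly (enum_val i)).@[c]] = 0.
  move=> Hp; rewrite -[RHS](((brk_le_eqs _ _).1 (Ha c)) p Hp).
  by apply: meval_eq => i; rewrite meval_powers_poly.
have [K [iota [c [ind [s [w Hw]]]]]] := generic_curve
  (fun i : 'I_#|{: I}| => tensor_poly_homog F a (enum_val i)) closure.
have [D [D_sub D_mul HD]] := partial_derivations charF ind.
have [h Hh] := choice Hw.
(* The weights [g] are chosen so that the operators turn [powers_poly] into the coordinates of
   [phi f]. *)
have [g Hg] := coefficients_by_words charF n0 f.
pose W := [seq (fun t l => w (enum_rank (j, t, l))) | j <- enum 'I_a].
have := rank_word_sum (fun i => poly_derB (D_sub i)) (fun i => poly_derM (D_sub i) (D_mul i))
  k0 n0 (fun u => (iota (g u))%:P) W.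
rewrite size_map size_enum_ord; set R := (a * _)%N => rk.
pose H i := \sum_u (iota (g u))%:P * word_op (fun i => poly_der (D i)) u (enum 'I_d) (h i).
pose z i := (iota (phi f (enum_val i)))%:P + 'X * H i.
(* Read off on the leading term, the differentiated sum of products is ['X^s] times a curve through
   [phi f] at 0. *)
have {}rk : rank_le R (fun ix => 'X^s * z (enum_rank ix)).
  apply: rank_le_eq rk => ix.
  have E : \sum_(V <- W) \prod_t V t (ix t) = 'X^s * ((mmap iota c (powers_poly ix))%:P + 'X * h (enum_rank ix)).
    have := Hh (enum_rank ix); rewrite enum_rankK mmap_tensor_poly => <-.
    by rewrite big_map big_enum.
  under eq_bigr do rewrite E word_op_poly_der // mulrCA mulrDr mulrCA.
  rewrite -mulr_sumr big_split /= -mulr_sumr; congr (_ * (_ + _)).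
  rewrite enum_rankK phiE.
  have := congr1 (mmap iota c) (Hg (fun e => phi (delta e) ix)).
  rewrite mmapC => /(congr1 polyC) <-; rewrite (raddf_sum (mmap iota c)) raddf_sum; apply: eq_bigr => u _.
  by rewrite /= mmapZ rmorphM.
apply/brk_le_eqs => p Hp.
(* At [x != 0] the scalar [x ^- s] is absorbed into one factor, so [z] at [x] has rank at most [R]
   and [p] vanishes there. *)
have Q0 : mmap (polyC \o iota) z p = 0.
  apply: poly_eq0_off0 => x x0; rewrite -[LHS]/(horner_eval x _) mmap_comp.
  rewrite -[RHS](vanishing_extension k0 iota Hp (z := fun ix => (z (enum_rank ix)).[x])) //.
    apply: mmap_eq => [b|i] /=; first by rewrite /horner_eval hornerC.
    by rewrite enum_valK.
  apply: rank_le_eq (rank_le_scale (x ^- s) k0 (rank_le_map (horner_eval x) rk)) => ix.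
  by rewrite /= /horner_eval hornerM hornerXn mulrA mulVf ?mul1r // expf_neq0.
have := congr1 (horner_eval 0) Q0; rewrite rmorph0 mmap_comp => H0.
apply/eqP; rewrite -(fmorph_eq0 iota) -H0 mmap_comp; apply/eqP; apply: mmap_eq => [b|i] /=.
  by rewrite /horner_eval hornerC.
by rewrite /horner_eval hornerD hornerM hornerX mul0r addr0 hornerC.
Qed.
End Main.

Theorem theorem7p9 (F : closedFieldType) (charF : [pchar F] =i pred0)
  (d k : nat) (hk : (2 <= k)%N) (hdk : (k < d)%N) :
  exists B : nat,
    forall (n m : nat), (1 <= n)%N -> (1 <= m)%N ->
    forall (phi : {linear Pol F n d -> Ten F m k}) (a : nat),
      (forall c : 'I_n -> F, (brk (phi (lin_pow d c)) <= a)%N) ->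
      (exists c : 'I_n -> F, brk (phi (lin_pow d c)) = a) ->
      (1 <= a)%N ->
      forall f : Pol F n d,
        (brk (phi f) <= B * n ^ ((k.-1 * d) %/ k) * a)%N.
Proof.
have k0 : (0 < k)%N by exact: leq_trans hk.
(* [k ^ d] counts the distributions of [d] derivatives over [k] factors. *)
exists (k ^ d)%N => n m n0 _ phi a Ha _ _ f; rewrite mulnC.
by apply/(brk_leP k0)/brk_le_of_powers => // c; apply/(brk_leP k0).
Qed.
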